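(* A function $\mathcal E:L^p(\mathrm{co}\,\mathcal F(\mathbb C))\to \mathrm{co}\,\mathcal F$ is a scalarly lower semicontinuous minimal normalised sublinear expectation if and only if $h(\mathcal E(X),u)=\infty$ for $u\notin\mathbb G$ and $$h(\mathcal E(X),u)=\sup_{\zeta\in\mathcal Z_u,\ \mathbf E\zeta=u}\mathbf E\,h(X,\zeta),\qquad u\in\mathbb G,$$ for all $X\in L^p(\mathrm{co}\,\mathcal F(\mathbb C))$, where $\mathcal Z_u$, $u\in\mathbb G$, are convex $\sigma(L^q,L^p)$-closed cones in $L^q(\mathbb G)$ such that $\{\mathbf E\zeta:\zeta\in\mathcal Z_u\}=\{tu:t\ge 0\}$ for all $u\ne 0$, $\mathcal Z_{cu}=\mathcal Z_u$ for all $c>0$, $\mathcal Z_0=\{0\}$, and $\mathcal Z_{u+v}\subset \mathcal Z_u+\mathcal Z_v$ for all $u,v\in\mathbb G$.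
   Context: Fix a probability space $(\Omega,\mathfrak F,\mathbf P)$, $d\ge 1$, $p\in[1,\infty]$ and $q$ with $1/p+1/q=1$. $\mathbf E$ is expectation. $L^p(\mathbb R^d)$ is the space of $p$-integrable random vectors (essentially bounded if $p=\infty$); $\sigma(L^p,L^q)$ and $\sigma(L^q,L^p)$ are the topologies from the pairing $\mathbf E\langle\xi,\zeta\rangle$. The support function of non-empty $F\subset\mathbb R^d$ is $h(F,u)=\sup_{x\in F}\langle x,u\rangle\in(-\infty,\infty]$. $\mathbb C\ne\mathbb R^d$ is a fixed deterministic closed convex cone and $\mathbb G=\{u\in\mathbb R^d: h(\mathbb C,u)\le 0\}$ is its polar cone. Sums of closed sets are closed Minkowski sums, $F_1+F_2=\mathrm{cl}\{x+y:x\in F_1,y\in F_2\}$ (empty if a summand is empty); likewise $\mathcal Z_u+\mathcal Z_v$ denotes the closure in $\sigma(L^q,L^p)$ of the set of sums. $cF=\{cx:x\in F\}$. $\mathrm{co}\,\mathcal F$ is the family of closed convex sets in $\mathbb R^d$; $\mathrm{co}\,\mathcal F(\mathbb C)$ is the family of those $F$ with $F=F+\mathbb C$. A random closed set $X$ is a random element in the closed sets of $\mathbb R^d$ with $\{X\cap K\ne\emptyset\}$ measurable for all compact $K$; it is always a.s. non-empty. For a (random) set $A$, $L^p(A)$ is the family of $\xi\in L^p(\mathbb R^d)$ with $\xi\in A$ a.s. $X$ is $p$-integrable if $L^p(X)\neq\emptyset$. $L^p(\mathrm{co}\,\mathcal F(\mathbb C))$ is the family of $p$-integrable random closed sets with values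 in $\mathrm{co}\,\mathcal F(\mathbb C)$. For such $X$ and $\zeta\in L^q(\mathbb R^d)$, $h(X,\zeta)$ is a $(-\infty,\infty]$-valued random variable with integrable negative part, so $\mathbf E h(X,\zeta)\in(-\infty,\infty]$ is defined. A sublinear (set-valued) expectation is a map $\mathcal E:L^p(\mathrm{co}\,\mathcal F(\mathbb C))\to\mathrm{co}\,\mathcal F$ with non-empty values such that: (i) $\mathcal E(X+a)=\mathcal E(X)+a$ for deterministic $a\in\mathbb R^d$; (ii) $\mathcal E(F)\supset F$ for all deterministic (non-empty) $F\in\mathrm{co}\,\mathcal F(\mathbb C)$; (iii) $\mathcal E(X)\subset\mathcal E(Y)$ if $X\subset Y$ a.s.; (iv) $\mathcal E(cX)=c\,\mathcal E(X)$ for $c>0$; (v) $\mathcal E(X+Y)\subset\mathcal E(X)+\mathcal E(Y)$. It is normalised if $\mathcal E(\mathbb C)=\mathbb C$. It is minimal if $\mathcal E(X)=\overline{\mathrm{co}}\bigcup_{\xi\in L^p(X)}\mathcal E(\xi+\mathbb C)$ for all $X$ ($\overline{\mathrm{co}}$ = closed convex hull). $X_n\to X$ scalarly means $\mathbf E h(X_n,\zeta)\to\mathbf E h(X,\zeta)$ in $(-\infty,\infty]$ for all $\zeta\in L^q(\mathbb G)$. $\mathcal E$ is scalarly lower semicontinuous if $h(\mathcal E(X),u)\le\liminf h(\mathcal E(X_n),u)$ for all $u\in\mathbb R^d$ whenever $X_n\to X$ scalarly. *)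

(* Defs.v *)
From HB Require Import structures.
From mathcomp Require Export all_boot all_order all_algebra.
From mathcomp Require Export all_classical all_reals all_analysis.
Export Order.TTheory GRing.Theory Num.Theory.
Export numFieldNormedType.Exports.

Set Implicit Arguments.
Unset Strict Implicit.
Unset Printing Implicit Defensive.

Local Open Scope classical_set_scope.
Local Open Scope ring_scope.

Section ClosedSets.
Context {R : realType} {d : nat}.
Implicit Types (x y u : 'rV[R]_d) (F C : set 'rV[R]_d).

Definition dotv x y : R := \sum_(i < d) x ord0 i * y ord0 i.

Definition enorm x : R := Num.sqrt (dotv x x).

(* The supremum over the empty set is -oo. *)
Definition support_fun F u : \bar R := ereal_sup [set (dotv x u)%:E | x in F].

Definition polar_cone C : set 'rV[R]_d := [set u | (support_fun C u <= 0)%E].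

Definition closed_sum F1 F2 : set 'rV[R]_d :=
  closure [set x + y | x in F1 & y in F2].

Definition coF : set (set 'rV[R]_d) :=
  [set F | closed F /\ @convex_set R 'rV[R]_d F].

Definition coFC C : set (set 'rV[R]_d) :=
  [set F | coF F /\ closed_sum F C = F].

Definition closed_convex_hull F : set 'rV[R]_d := smallest coF F.

End ClosedSets.

Definition cone {R : realType} {V : lmodType R} (A : set V) : Prop :=
  A !=set0 /\ forall (c : R) (x : V), 0 <= c -> A x -> A (c *: x).

(* Random vectors are functions rather than classes modulo a.s. equality. *)
Section RandomVectors.
Context {R : realType} {disp : measure_display} {T : measurableType disp}.
Context (P : probability T R) (d : nat).
Implicit Types (p q : \bar R).

Definition vecLp p : set (T -> 'rV[R]_d) :=
  [set xi : T -> 'rV[R]_d |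
     (forall i, measurable_fun [set: T] (fun w => xi w ord0 i))
     /\ finite_norm P p (fun w => enorm (xi w))].

Definition selLp p (A : T -> set 'rV[R]_d) : set (T -> 'rV[R]_d) :=
  [set xi : T -> 'rV[R]_d | vecLp p xi /\ {ae P, forall w, A w (xi w)}].

Definition expect_vec (zeta : T -> 'rV[R]_d) : 'rV[R]_d :=
  \row_i fine 'E_P[fun w => zeta w ord0 i].

Definition pairing (xi zeta : T -> 'rV[R]_d) : R :=
  fine 'E_P[fun w => dotv (xi w) (zeta w)].

(* sigma(L^q, L^p): the coarsest topology on L^q for which all maps
   zeta |-> E<xi, zeta>, xi in L^p, are continuous.  It does not separate
   a.s. equal functions, so its closed sets are unions of a.s. classes. *)
Definition weak_eval p q (zeta : set_type (vecLp q)) :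
    {ptws set_type (vecLp p) -> R} :=
  fun xi : set_type (vecLp p) => pairing (val xi) (val zeta).

Definition weakLq p q : topologicalType := initial_topology (@weak_eval p q).

Definition weak_trace p q (Z : set (T -> 'rV[R]_d)) : set (weakLq p q) :=
  [set z : set_type (vecLp q) | Z (val z)].

Definition weakly_closed p q (Z : set (T -> 'rV[R]_d)) : Prop :=
  closed (@weak_trace p q Z).

Definition weak_closure p q (Z : set (T -> 'rV[R]_d)) : set (T -> 'rV[R]_d) :=
  [set val (z : set_type (vecLp q)) | z in closure (@weak_trace p q Z)].

End RandomVectors.

Section RandomSets.
Context {R : realType} {disp : measure_display} {T : measurableType disp}.
Context (P : probability T R) {d : nat}.
Implicit Types (p q : \bar R) (C : set 'rV[R]_d).
Implicit Types (X Y : T -> set 'rV[R]_d).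

Definition random_closed_set X : Prop :=
  [/\ forall w, closed (X w),
      forall K : set 'rV[R]_d, compact K ->
        measurable [set w | X w `&` K !=set0]
    & {ae P, forall w, X w !=set0}].

Definition LpcoFC p C : set (T -> set 'rV[R]_d) :=
  [set X | [/\ random_closed_set X, forall w, coFC C (X w)
             & selLp P p X !=set0]].

Definition expect_support X (zeta : T -> 'rV[R]_d) : \bar R :=
  (\int[P]_w support_fun (X w) (zeta w))%E.

Definition scalar_cvg q C (X_ : nat -> T -> set 'rV[R]_d) X : Prop :=
  forall zeta, selLp P q (fun=> polar_cone C) zeta ->
    expect_support (X_ n) zeta @[n --> \oo] --> expect_support X zeta.

(* The values of an expectation outside LpcoFC p C are irrelevant. *)
Implicit Types (E : (T -> set 'rV[R]_d) -> set 'rV[R]_d).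

Record sublinear_expectation p C E : Prop := SublinearExpectation {
  se_values : forall X, LpcoFC p C X -> coF (E X) /\ E X !=set0 ;
  se_translation : forall X (a : 'rV[R]_d), LpcoFC p C X ->
    E (fun w => [set x + a | x in X w]) = [set x + a | x in E X] ;
  se_deterministic : forall F, coFC C F -> F !=set0 -> F `<=` E (fun=> F) ;
  se_monotone : forall X Y, LpcoFC p C X -> LpcoFC p C Y ->
    {ae P, forall w, X w `<=` Y w} -> E X `<=` E Y ;
  se_homogeneous : forall X (c : R), LpcoFC p C X -> 0 < c ->
    E (fun w => [set c *: x | x in X w]) = [set c *: x | x in E X] ;
  se_subadditive : forall X Y, LpcoFC p C X -> LpcoFC p C Y ->
    E (fun w => closed_sum (X w) (Y w)) `<=` closed_sum (E X) (E Y)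
}.

Definition normalised C E : Prop := E (fun=> C) = C.

Definition minimal p C E : Prop := forall X, LpcoFC p C X ->
  E X = closed_convex_hull
    (\bigcup_(xi in selLp P p X) E (fun w => [set xi w + x | x in C])).

Definition scalarly_lsc p q C E : Prop :=
  forall (X_ : nat -> T -> set 'rV[R]_d) X,
    (forall n, LpcoFC p C (X_ n)) -> LpcoFC p C X -> scalar_cvg q C X_ X ->
    forall u, (support_fun (E X) u
               <= limn_einf (fun n => support_fun (E (X_ n)) u))%E.

(* The cones Z u for u outside polar_cone C are irrelevant. *)
Record cone_family p q C (Z : 'rV[R]_d -> set (T -> 'rV[R]_d)) : Prop :=
  ConeFamily {
  cf_sub : forall u, polar_cone C u ->
    Z u `<=` selLp P q (fun=> polar_cone C) ;
  cf_convex : forall u, polar_cone C u ->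
    @convex_set R (T -> 'rV[R]_d) (Z u) ;
  cf_closed : forall u, polar_cone C u -> weakly_closed P p q (Z u) ;
  cf_cone : forall u, polar_cone C u -> cone (Z u) ;
  cf_expect : forall u, polar_cone C u -> u != 0 ->
    [set expect_vec P zeta | zeta in Z u]
    = [set t *: u | t in [set t : R | 0 <= t]] ;
  cf_scale : forall u (c : R), polar_cone C u -> 0 < c -> Z (c *: u) = Z u ;
  cf_zero : Z 0 = [set zeta | vecLp P q zeta /\ {ae P, forall w, zeta w = 0}] ;
  cf_add : forall u v, polar_cone C u -> polar_cone C v ->
    Z (u + v) `<=`
      weak_closure P p q [set zeta1 + zeta2 | zeta1 in Z u & zeta2 in Z v]
}.

Definition dual_representation p C E (Z : 'rV[R]_d -> set (T -> 'rV[R]_d)) :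
    Prop :=
  forall X, LpcoFC p C X ->
    (forall u, ~ polar_cone C u -> support_fun (E X) u = +oo%E) /\
    (forall u, polar_cone C u ->
       support_fun (E X) u =
       ereal_sup [set expect_support X zeta
                 | zeta in [set zeta | Z u zeta /\ expect_vec P zeta = u]]).

End RandomSets.

(* Main.v *)
From HB Require Import structures.
Require Import Defs.
From mathcomp Require Import ring lra measurable_realfun ess_sup_inf.

(** For the passage from the cones to the expectation, every property is read off the support
functions, using that E h(X, zeta) is the supremum of E<xi, zeta> over the p-integrable selections
xi of X.

Conversely, put e_u(xi) = h(E(xi + C), u) for u in the polar cone G.  It is a sublinear functional
on L^p that is sequentially lower semicontinuous for sigma(L^p, L^q).  The cone Z_u is the polar of
the acceptance set {e_u <= 0}, so that its closedness and convexity are automatic, and the inclusion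
for Z_{u+v} is the bipolar theorem together with e_{u+v} <= e_u + e_v.  What has to be proved is
that e_u is the supremum of the pairings with those zeta in Z_u for which E zeta = u.

By Hahn-Banach this amounts to bounding e_u from below near 0 and near a given xi by a seminorm
whose dual lies in L^q.  For finite p the norm of L^p serves.  For p = oo a convex set D of bounded
vectors closed under bounded a.s. convergence and not containing 0 is separated from 0 by
N(eta) = sup_k M_{m_k}(eta)/(k+1), where M_m(eta) is the mean of |eta| over its upper tail of mass
1/m.  The m_k are chosen one at a time, as in the Krein-Smulian theorem; the step rests on the fact
that a decreasing sequence of nonempty bounded sets of this kind has a common point, obtained from
elements of nearly minimal second moment.  Functionals bounded by such an N are absolutely
continuous, and the Radon-Nikodym theorem represents them. *)

(** Lower semicontinuity is assumed along sequences only. For finite p this suffices, because norm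
    convergence implies convergence of all pairings. For p = oo the norm would yield functionals
    that are merely finitely additive and are represented by no element of L^1. What survives is
    closedness under bounded almost sure convergence, where dominated convergence makes the pairings
    converge; the seminorm has to be built from this alone. The mean condition comes from constants.
    Normalisation and translation give e_u(a) = <a, u> for deterministic a, so a zeta whose pairing
    stays below e_u satisfies <a, E zeta> <= <a, u> for all a, that is, E zeta = u. Conversely, let
    zeta in Z_u have mean u. If u is nonzero and e_u(xi) is finite, a constant added to xi brings
    e_u to exactly 0; the sum is acceptable, and its pairing with zeta being at most 0 says that
    zeta lies below e_u at xi. Minimality reduces a general X to the sets xi + C, and measurable
    selections do the same for E h(X, zeta); this is why functionals of random vectors are
    enough. *)

Set Implicit Arguments.
Unset Strict Implicit.
Unset Printing Implicit Defensive.

Local Open Scope classical_set_scope.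
Local Open Scope ring_scope.

(** * Geometry of convex sets *)

Section Geometry.
Context {R : realType} {d : nat}.
Implicit Types (x y z u v : 'rV[R]_d) (A B F C : set 'rV[R]_d).

Lemma dotvC x y : dotv x y = dotv y x.
Proof. by apply: eq_bigr => i _; rewrite mulrC. Qed.

Lemma dotvDl x y z : dotv (x + y) z = dotv x z + dotv y z.
Proof. by rewrite /dotv -big_split; apply: eq_bigr => i _; rewrite mxE mulrDl. Qed.

Lemma dotvDr x y z : dotv z (x + y) = dotv z x + dotv z y.
Proof. by rewrite dotvC dotvDl !(dotvC z). Qed.

Lemma dotvZl c x z : dotv (c *: x) z = c * dotv x z.
Proof. by rewrite /dotv mulr_sumr; apply: eq_bigr => i _; rewrite mxE mulrA. Qed.

Lemma dotvZr c x z : dotv z (c *: x) = c * dotv z x.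
Proof. by rewrite dotvC dotvZl (dotvC z). Qed.

Lemma dotv0l z : dotv 0 z = 0.
Proof. by rewrite -(scale0r z) dotvZl mul0r. Qed.

Lemma dotv0r z : dotv z 0 = 0.
Proof. by rewrite dotvC dotv0l. Qed.

Lemma dotvNl x z : dotv (- x) z = - dotv x z.
Proof. by rewrite -scaleN1r dotvZl mulN1r. Qed.

Lemma dotvNr x z : dotv z (- x) = - dotv z x.
Proof. by rewrite dotvC dotvNl (dotvC z). Qed.

Lemma dotvBl x y z : dotv (x - y) z = dotv x z - dotv y z.
Proof. by rewrite dotvDl dotvNl. Qed.

Lemma dotvBr x y z : dotv z (x - y) = dotv z x - dotv z y.
Proof. by rewrite dotvDr dotvNr. Qed.

Lemma dotv_delta x i : dotv x (delta_mx ord0 i) = x ord0 i.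
Proof.
rewrite /dotv (bigD1 i)//= mxE !eqxx mulr1 big1 ?addr0// => j ji.
by rewrite mxE (negbTE ji) andbF mulr0.
Qed.

Lemma dotv_ge0 x : 0 <= dotv x x.
Proof. by apply: sumr_ge0 => i _; rewrite -expr2 sqr_ge0. Qed.

Lemma dotv_coord_le x i : x ord0 i ^+ 2 <= dotv x x.
Proof.
rewrite /dotv (bigD1 i)//= -expr2 lerDl; apply: sumr_ge0 => j _.
by rewrite -expr2 sqr_ge0.
Qed.

Lemma dotv_eq0 x : (dotv x x == 0) = (x == 0).
Proof.
apply/eqP/eqP => [x0|->]; last exact: dotv0l.
apply/rowP => i; rewrite mxE; apply/eqP; rewrite -sqrf_eq0 eq_le sqr_ge0 andbT.
by rewrite -x0 dotv_coord_le.
Qed.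

Lemma dotv_gt0 x : (0 < dotv x x) = (x != 0).
Proof. by rewrite lt_def dotv_ge0 andbT dotv_eq0. Qed.

Lemma enorm_ge0 x : 0 <= enorm x.
Proof. exact: sqrtr_ge0. Qed.

Lemma sqr_enorm x : enorm x ^+ 2 = dotv x x.
Proof. by rewrite sqr_sqrtr// dotv_ge0. Qed.

Lemma enorm_coord_le x i : `|x ord0 i| <= enorm x.
Proof. by rewrite -sqrtr_sqr ler_wsqrtr// dotv_coord_le. Qed.

Lemma enorm_leE x (a : R) : 0 <= a -> (enorm x <= a) = (dotv x x <= a ^+ 2).
Proof. by move=> a0; rewrite -sqr_enorm ler_sqr ?nnegrE ?enorm_ge0. Qed.

(** Cauchy-Schwarz: the vector squared below is [dotv x x] times the part of y orthogonal to x,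
    which avoids a division. *)
Lemma dotv_enorm x y : dotv x y <= enorm x * enorm y.
Proof.
have [x0|x0] := eqVneq x 0; first by rewrite x0 dotv0l mulr_ge0 ?enorm_ge0.
apply: (le_trans (ler_norm _)).
rewrite -ler_sqr ?nnegrE ?mulr_ge0 ?enorm_ge0// exprMn !sqr_enorm real_normK ?num_real//.
have := dotv_ge0 (dotv x x *: y - dotv x y *: x).
rewrite !dotvBl !dotvBr !dotvZl !dotvZr (dotvC y x).
have := x0; rewrite -dotv_gt0 => x1.
rewrite (_ : _ - _ = dotv x x * (dotv x x * dotv y y - dotv x y ^+ 2)); last by ring.
by rewrite pmulr_rge0// subr_ge0.
Qed.

Lemma dotv_abs_enorm x y : `|dotv x y| <= enorm x * enorm y.
Proof.
rewrite ler_norml dotv_enorm andbT lerNl -dotvNl.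
apply: (le_trans (dotv_enorm _ _)).
by rewrite /enorm dotvNl dotvNr opprK.
Qed.

Lemma enormZ (c : R) x : enorm (c *: x) = `|c| * enorm x.
Proof.
by rewrite /enorm dotvZl dotvZr mulrA -expr2 sqrtrM ?sqr_ge0// sqrtr_sqr.
Qed.

Lemma enormN x : enorm (- x) = enorm x.
Proof. by rewrite /enorm dotvNl dotvNr opprK. Qed.

Lemma enormD x y : enorm (x + y) <= enorm x + enorm y.
Proof.
rewrite -ler_sqr ?nnegrE ?addr_ge0 ?enorm_ge0// sqr_enorm sqrrD !sqr_enorm.
by have := dotv_enorm x y; rewrite !dotvDl !dotvDr (dotvC y x); lra.
Qed.

Lemma enorm_le_sum x : enorm x <= \sum_i `|x ord0 i|.
Proof.
have s0 : 0 <= \sum_i `|x ord0 i| by exact: sumr_ge0.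
rewrite enorm_leE// expr2 mulr_sumr ler_sum// => i _.
rewrite (le_trans (ler_norm _))// normrM ler_wpM2r//.
by rewrite (bigD1 i)//= lerDl sumr_ge0.
Qed.

Lemma continuous_dotv2 (V : topologicalType) (f g : V -> 'rV[R]_d) :
  continuous f -> continuous g -> continuous (fun w => dotv (f w) (g w)).
Proof.
move=> cf cg; apply: continuous_big => [|i _]; first exact: add_continuous.
move=> w; apply: cvgM.
  by apply: (@cvg_comp _ _ _ f (fun M : 'rV[R]_d => M ord0 i)); [exact: cf|exact: coord_continuous].
by apply: (@cvg_comp _ _ _ g (fun M : 'rV[R]_d => M ord0 i)); [exact: cg|exact: coord_continuous].
Qed.

Lemma continuous_dotv u : continuous (dotv ^~ u : 'rV[R]_d -> R).
Proof. by apply: continuous_dotv2 => y; [exact: cvg_id|exact: (@cst_continuous _ 'rV[R]_d u y)]. Qed.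

Lemma continuous_sqdist x : continuous (fun y => dotv (y - x) (y - x)).
Proof.
by apply: continuous_dotv2 => y; exact: (cvgB cvg_id (cvg_cst x)).
Qed.

Lemma closed_ball_dotv x (a : R) : closed [set y | dotv (y - x) (y - x) <= a].
Proof.
apply: (@closed_comp _ _ (fun y => dotv (y - x) (y - x)) [set r : R | r <= a]).
  by move=> y _; exact: continuous_sqdist.
exact: closed_le.
Qed.

Lemma closed_halfspace u (a : R) : closed [set y | dotv y u <= a].
Proof.
apply: (@closed_comp _ _ (dotv ^~ u) [set r : R | r <= a]).
  by move=> y _; exact: continuous_dotv.
exact: closed_le.
Qed.

(** The topology on row vectors comes from the maximum norm; this comparison carries boundedness and
    closure over to [enorm]. *)
Lemma mx_norm_enorm x : `|x| <= enorm x.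
Proof.
rewrite /Num.norm/= mx_normrE; apply: bigmax_le; first exact: enorm_ge0.
by move=> [i j] _ /=; rewrite (ord1 i) enorm_coord_le.
Qed.

Lemma compact_ball x (a : R) : compact [set y | dotv (y - x) (y - x) <= a].
Proof.
apply: bounded_closed_compact; last exact: closed_ball_dotv.
exists (enorm x + Num.sqrt a); split; first exact: num_real.
move=> M M1 y /= ya; apply: (le_trans (mx_norm_enorm _)); apply: ltW.
apply: le_lt_trans M1.
rewrite -{1}(subrK x y) addrC; apply: (le_trans (enormD _ _)).
by rewrite lerD2l ler_wsqrtr.
Qed.

Lemma nearest_point F x : closed F -> F !=set0 ->
  exists2 y, F y & forall z, F z -> dotv (y - x) (y - x) <= dotv (z - x) (z - x).
Proof.
move=> cF [z0 Fz0].
(* Cutting F by the ball around x through z0 makes it compact without losing any competitor nearer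
   than z0. *)
pose A := F `&` [set y | dotv (y - x) (y - x) <= dotv (z0 - x) (z0 - x)].
have cA : compact A.
  rewrite /A setIC; apply: compact_closedI => //; exact: compact_ball.
have [||y /set_mem[Fy yz0] ymin] := @EVT_min_rV R d (fun y => dotv (y - x) (y - x)) A _ cA.
- by exists z0; split => /=.
- by apply: continuous_subspaceT => ?; exact: continuous_sqdist.
exists y => // z Fz.
have [zz0|/ltW zz0] := leP (dotv (z - x) (z - x)) (dotv (z0 - x) (z0 - x)).
  by apply: ymin; apply/mem_set.
exact: le_trans zz0.
Qed.

End Geometry.

Lemma convex_setP (R : realType) (V : lmodType R) (A : set V) :
  @convex_set R V A <->
  forall (x y : V) (t : R), A x -> A y -> 0 <= t <= 1 -> A (t *: x + (1 - t) *: y).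
Proof.
split=> [cA x y t Ax Ay /andP[t0 t1]|cA x y l xA yA].
  exact: (set_mem (cA x y (Itv01 t0 t1) (mem_set Ax) (mem_set Ay))).
by apply: mem_set; apply: cA; [exact: set_mem xA|exact: set_mem yA|rewrite ge0 le1].
Qed.

(** * Separation and support functions *)

Section Support.
Context {R : realType} {d : nat}.
Implicit Types (x y z u v : 'rV[R]_d) (A B F C : set 'rV[R]_d).

(** Moving from y by a fraction t towards z changes the squared distance to x by t^2 b - 2 t a; if a
    were positive, a small t would come nearer to x than y. *)
Lemma nearest_point_obtuse F x y : @convex_set R 'rV[R]_d F -> F y ->
  (forall z, F z -> dotv (y - x) (y - x) <= dotv (z - x) (z - x)) ->
  forall z, F z -> dotv (x - y) (z - y) <= 0.
Proof.
move=> /convex_setP cF Fy ymin z Fz; rewrite leNgt; apply/negP => h.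
set a := dotv (x - y) (z - y) in h.
set b := dotv (z - y) (z - y).
have key (t : R) : 0 <= t <= 1 -> 2 * t * a <= t ^+ 2 * b.
  move=> t01; have := ymin _ (cF _ _ t Fz Fy t01).
  rewrite (_ : t *: z + (1 - t) *: y - x = t *: (z - y) - (x - y)); last first.
    by apply/rowP => i; rewrite !mxE; ring.
  rewrite (_ : y - x = - (x - y)); last by rewrite opprB.
  rewrite !(dotvBl (t *: _)) !(dotvBr (t *: _)) !dotvZl !dotvZr dotvNl dotvNr opprK.
  by rewrite (dotvC (z - y) (x - y)) -/a -/b; lra.
have b0 : 0 <= b by exact: dotv_ge0.
(* This t lies in ]0, 1] whatever b >= 0 is, and t b < a contradicts 2 a <= t b. *)
have [t tE] : exists t, t = a / (a + b) by eexists.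
have ab : 0 < a + b by lra.
have t01 : 0 <= t <= 1.
  apply/andP; split; first by rewrite tE divr_ge0 ?ltW.
  by rewrite tE ler_pdivrMr// mul1r lerDl.
have tpos : 0 < t by rewrite tE divr_gt0.
have := key t t01; rewrite expr2 -!mulrA mulrCA ler_pM2l//.
move=> h1; suff h2 : t * b < a by lra.
by rewrite tE mulrAC ltr_pdivrMr// ltr_pM2l// ltrDr.
Qed.

(** The normal is x - y for the point y of F nearest to x. *)
Lemma separation F x : closed F -> @convex_set R 'rV[R]_d F -> F !=set0 -> ~ F x ->
  exists u (r : R), (forall z, F z -> dotv z u <= r) /\ r < dotv x u.
Proof.
move=> cF coF F0 nFx; have [y Fy ymin] := nearest_point x cF F0.
have xy : x - y != 0.
  by apply/eqP => /eqP; rewrite subr_eq0 => /eqP xy; apply: nFx; rewrite xy.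
exists (x - y), (dotv y (x - y)); split=> [z Fz|].
  by have := nearest_point_obtuse coF Fy ymin Fz; rewrite dotvC dotvBl subr_le0.
by rewrite -subr_gt0 -dotvBl dotv_gt0.
Qed.

Lemma support_fun_leP F u (a : \bar R) :
  (support_fun F u <= a)%E <-> forall x, F x -> ((dotv x u)%:E <= a)%E.
Proof.
split=> [h x Fx|h]; first by apply: le_trans h; apply: ereal_sup_ubound; exists x.
by apply: ge_ereal_sup => _ [x Fx <-]; exact: h.
Qed.

Lemma support_fun_ge F u x : F x -> ((dotv x u)%:E <= support_fun F u)%E.
Proof. by move=> Fx; apply: ereal_sup_ubound; exists x. Qed.

Lemma support_fun_set0 u : support_fun (set0 : set 'rV[R]_d) u = -oo%E.
Proof. by apply/eqP; rewrite -leeNy_eq; apply/support_fun_leP. Qed.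

Lemma support_fun_gtNy F u : F !=set0 -> (-oo < support_fun F u)%E.
Proof. by move=> [x Fx]; apply: lt_le_trans (support_fun_ge u Fx); rewrite ltNyr. Qed.

Lemma support_funN0 F u : (-oo < support_fun F u)%E -> F !=set0.
Proof.
move=> h; apply/set0P; apply/eqP => F0; move: h; rewrite F0.
by rewrite support_fun_set0.
Qed.

Lemma support_fun0 F : F !=set0 -> support_fun F 0 = 0%E.
Proof.
move=> [x Fx]; apply/eqP; rewrite eq_le; apply/andP; split.
  by apply/support_fun_leP => y _; rewrite dotv0r.
by have := support_fun_ge 0 Fx; rewrite dotv0r.
Qed.

Lemma support_funS A B u : A `<=` B -> (support_fun A u <= support_fun B u)%E.
Proof. by move=> AB; apply/support_fun_leP => x /AB; exact: support_fun_ge. Qed.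

Lemma mem_support F x : coF F ->
  (forall u, ((dotv x u)%:E <= support_fun F u)%E) -> F x.
Proof.
move=> [cF coF] h; apply: contrapT => nFx.
have F0 : F !=set0 by apply: (@support_funN0 _ 0); apply: lt_le_trans (h 0); rewrite ltNyr.
have [u [r [ur rx]]] := separation cF coF F0 nFx.
have : (support_fun F u <= r%:E)%E by apply/support_fun_leP => z /ur; rewrite lee_fin.
by move=> /(le_trans (h u)); rewrite lee_fin leNgt rx.
Qed.

Lemma sub_support A F : coF F ->
  (forall u, (support_fun A u <= support_fun F u)%E) -> A `<=` F.
Proof.
move=> cF h x Ax; apply: mem_support => // u.
by apply: le_trans (h u); exact: support_fun_ge.
Qed.

Lemma eq_support A F : coF A -> coF F ->
  (forall u, support_fun A u = support_fun F u) -> A = F.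
Proof.
by move=> cA cF h; apply/seteqP; split; apply: sub_support => // u; rewrite h.
Qed.

Lemma closureP A x :
  closure A x <-> forall e : R, 0 < e -> exists2 y, A y & `|x - y| < e.
Proof.
split=> [cA e e0|h B /nbhs_ballP[e /= e0 eB]].
  by have [y [Ay]] := cA _ (nbhsx_ballx x e e0); rewrite -ball_normE /= => xy; exists y.
by have [y Ay xy] := h e e0; exists y; split => //; apply: eB; rewrite -ball_normE.
Qed.

Lemma coF_halfspace u (r : R) : coF [set y | dotv y u <= r].
Proof.
split; first exact: closed_halfspace.
apply/convex_setP => x y t /= xr yr /andP[t0 t1]; rewrite dotvDl !dotvZl.
have h1 : t * dotv x u <= t * r by rewrite ler_wpM2l.
have h2 : (1 - t) * dotv y u <= (1 - t) * r by rewrite ler_wpM2l// subr_ge0.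
lra.
Qed.

Lemma coF_set0 : coF (set0 : set 'rV[R]_d).
Proof. by split; [exact: closed0|apply/convex_setP]. Qed.

Lemma support_hull A u : support_fun (closed_convex_hull A) u = support_fun A u.
Proof.
apply/eqP; rewrite eq_le; apply/andP; split; last first.
  by apply: support_funS; exact: sub_smallest.
case E : (support_fun A u) => [r| |]; last 2 first.
- by rewrite leey.
(* The value -oo forces A to be empty, and the empty set is itself closed and convex, so the hull is
   empty too. *)
- have -> : closed_convex_hull A = set0.
    rewrite -subset0; apply: smallest_sub; first exact: coF_set0.
    by move=> x Ax; have := support_fun_ge u Ax; rewrite E.
  by rewrite support_fun_set0.
suff h : closed_convex_hull A `<=` [set y | dotv y u <= r].
  by apply/support_fun_leP => x /h; rewrite /= lee_fin.
apply: smallest_sub; first exact: coF_halfspace.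
by move=> y Ay /=; rewrite -lee_fin -E; exact: support_fun_ge.
Qed.

Lemma coF_hull A : coF (closed_convex_hull A).
Proof.
rewrite /closed_convex_hull /smallest.
split; first by apply: closed_bigI => i [[]].
apply/convex_setP => x y t Fx Fy t01 i /[dup] -[[_ /convex_setP h] _] Di.
by apply: h; [exact: Fx|exact: Fy|].
Qed.

Lemma support_closure A u : support_fun (closure A) u = support_fun A u.
Proof.
apply/eqP; rewrite eq_le; apply/andP; split; last first.
  by apply: support_funS; exact: subset_closure.
case E : (support_fun A u) => [r| |]; last 2 first.
- by rewrite leey.
- have -> : A = set0.
    by rewrite -subset0 => x Ax; have := support_fun_ge u Ax; rewrite E.
  by rewrite closure0 support_fun_set0.
suff h : closure A `<=` [set y | dotv y u <= r].
  by apply/support_fun_leP => x /h; rewrite /= lee_fin.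
rewrite closureE; apply: smallest_sub; first exact: closed_halfspace.
by move=> y Ay /=; rewrite -lee_fin -E; exact: support_fun_ge.
Qed.

(** Nonemptiness keeps both values off -oo, so -oo + oo never occurs. In the lower bound the suprema
    over A and B are taken one after the other; fixing y0 first shows that the one over A is
    finite. *)
Lemma support_closed_sum A B u : A !=set0 -> B !=set0 ->
  support_fun (closed_sum A B) u = (support_fun A u + support_fun B u)%E.
Proof.
move=> A0 B0; rewrite /closed_sum support_closure; apply/eqP; rewrite eq_le.
apply/andP; split.
  apply/support_fun_leP => _ [x Ax [y By <-]].
  by rewrite dotvDl EFinD leeD// support_fun_ge.
have := support_fun_gtNy u A0; have := support_fun_gtNy u B0.
case: A0 => x0 Ax0; case: B0 => y0 By0.
set s := support_fun [set _ | _ in _ & _ in _] u.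
have xy x y : A x -> B y -> ((dotv x u)%:E + (dotv y u)%:E <= s)%E.
  by move=> Ax By; rewrite -EFinD -dotvDl; apply: support_fun_ge; exists x => //; exists y.
case: s xy => [s| |] xy hB hA; last 2 first.
- by rewrite leey.
- by have := xy _ _ Ax0 By0.
have h1 : (support_fun A u <= (s - dotv y0 u)%:E)%E.
  by apply/support_fun_leP => x Ax; have := xy _ _ Ax By0; rewrite -EFinD !lee_fin lerBrDr.
case E : (support_fun A u) h1 hA => [a| |] // _ _.
have : (support_fun B u <= (s - a)%:E)%E.
  apply/support_fun_leP => y By; rewrite lee_fin lerBrDr -lerBrDl -lee_fin -E.
  apply/support_fun_leP => x Ax; have := xy _ _ Ax By.
  by rewrite -EFinD !lee_fin lerBrDr.
by case: (support_fun B u) hB => [b| |]//; rewrite -EFinD !lee_fin; lra.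
Qed.

Lemma support_translate A a u :
  support_fun [set x + a | x in A] u = (support_fun A u + (dotv a u)%:E)%E.
Proof.
apply/eqP; rewrite eq_le; apply/andP; split.
  apply/support_fun_leP => _ [x Ax <-].
  by rewrite dotvDl EFinD leeD// support_fun_ge.
rewrite -leeBrDr//; apply/support_fun_leP => x Ax; rewrite leeBrDr// -EFinD -dotvDl.
by apply: support_fun_ge; exists x.
Qed.

Lemma support_scale A (c : R) u : 0 < c ->
  support_fun [set c *: x | x in A] u = (c%:E * support_fun A u)%E.
Proof.
move=> c0; apply/eqP; rewrite eq_le; apply/andP; split.
  apply/support_fun_leP => _ [x Ax <-].
  by rewrite dotvZl EFinM lee_pmul2l// support_fun_ge.
rewrite -lee_pdivlMl//; apply/support_fun_leP => x Ax; rewrite lee_pdivlMl// -EFinM -dotvZl.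
by apply: support_fun_ge; exists x.
Qed.

Lemma support_scaler A (c : R) u : 0 < c ->
  support_fun A (c *: u) = (c%:E * support_fun A u)%E.
Proof.
move=> c0; rewrite -support_scale//; apply/eqP; rewrite eq_le; apply/andP; split.
  apply/support_fun_leP => x Ax; rewrite dotvZr -dotvZl.
  by apply: support_fun_ge; exists x.
by apply/support_fun_leP => _ [x Ax <-]; rewrite dotvZl -dotvZr; exact: support_fun_ge.
Qed.

Lemma support_subadd A u v : A !=set0 ->
  (support_fun A (u + v) <= support_fun A u + support_fun A v)%E.
Proof.
by move=> A0; apply/support_fun_leP => x Ax; rewrite dotvDr EFinD leeD// support_fun_ge.
Qed.

End Support.

(** * Closed convex sets that absorb the cone C *)

Section Cones.
Context {R : realType} {d : nat} (C : set 'rV[R]_d).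
Hypotheses (C_closed : closed C) (C_convex : @convex_set R 'rV[R]_d C).
Hypothesis C_cone : cone C.
Implicit Types (x y z u v : 'rV[R]_d) (A B F : set 'rV[R]_d).

Lemma cone0 : C 0.
Proof. by have [[x Cx] CZ] := C_cone; rewrite -(scale0r x); exact: CZ. Qed.

Lemma coneD x y : C x -> C y -> C (x + y).
Proof.
move=> Cx Cy; have /convex_setP cC := C_convex.
have := cC x y (2^-1) Cx Cy; rewrite (_ : 1 - 2^-1 = 2^-1 :> R); last by lra.
have h : 0 <= (2^-1 : R) <= 1 by lra.
move=> /(_ h); rewrite -scalerDr => /(C_cone.2 2); rewrite scalerA mulfV// scale1r.
exact.
Qed.

Lemma coneZ c x : 0 <= c -> C x -> C (c *: x).
Proof. exact: C_cone.2. Qed.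

Lemma polar_coneP u : polar_cone C u <-> forall x, C x -> dotv x u <= 0.
Proof.
rewrite /polar_cone /=; split=> [/support_fun_leP h x /h|h]; first by rewrite lee_fin.
by apply/support_fun_leP => x /h; rewrite lee_fin.
Qed.

Lemma support_cone u : polar_cone C u -> support_fun C u = 0%E.
Proof.
rewrite /polar_cone /= => Gu; apply/eqP; rewrite eq_le Gu /=.
by have := support_fun_ge u cone0; rewrite dotv0l.
Qed.

Lemma support_cone_pinfty u : ~ polar_cone C u -> support_fun C u = +oo%E.
Proof.
move=> nGu; apply: contrapT => fin; apply: nGu; apply/polar_coneP => x Cx.
have [r Er] : exists r : R, support_fun C u = r%:E.
  have := support_fun_ge u cone0.
  by case: (support_fun C u) fin => // r _ _; exists r.
have r0 : 0 <= r by have := support_fun_ge u cone0; rewrite Er dotv0l lee_fin.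
rewrite leNgt; apply/negP => xu.
(* The multiple of x by this factor has product r + 1 with u, above the supposed supremum r. *)
have c0 : 0 <= (r + 1) / dotv x u by rewrite divr_ge0 ?ltW// ltr_wpDl.
have := support_fun_ge u (coneZ c0 Cx); rewrite Er lee_fin dotvZl.
by rewrite divfK ?gt_eqF//; lra.
Qed.

Lemma polar_cone0 : polar_cone C 0.
Proof. by apply/polar_coneP => x _; rewrite dotv0r. Qed.

(** Since F is closed and C contains 0, the equation F = F + C amounts to pointwise absorption; this
    form needs no closure and is the one verified everywhere below. *)
Lemma coFCP F : coFC C F <-> coF F /\ forall x c, F x -> C c -> F (x + c).
Proof.
split=> [[cF FC]|[cF FC]]; split=> //.
  by move=> x c Fx Cc; rewrite -FC; apply: subset_closure; exists x => //; exists c.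
apply/seteqP; split=> [x|x Fx].
  rewrite /closed_sum closureE; apply: smallest_sub; first by have [] := cF.
  by move=> _ [y Fy [c Cc <-]]; exact: FC.
apply: subset_closure; exists x => //; exists 0; first exact: cone0.
by rewrite addr0.
Qed.

Lemma coFC_cone : coFC C C.
Proof. by apply/coFCP; split => // x c; exact: coneD. Qed.

Lemma closed_closed_sum A B : closed (closed_sum A B).
Proof. exact: closed_closure. Qed.

Lemma coF_closed_sum A B : coF A -> coF B -> coF (closed_sum A B).
Proof.
move=> [_ /convex_setP cA] [_ /convex_setP cB]; split; first exact: closed_closed_sum.
apply/convex_setP => x y t /closureP hx /closureP hy t01; apply/closureP => e e0.
have [_ [x1 Ax1 [x2 Bx2 <-]] xe] := hx e e0.
have [_ [y1 Ay1 [y2 By2 <-]] ye] := hy e e0.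
exists (t *: (x1 + x2) + (1 - t) *: (y1 + y2)).
  exists (t *: x1 + (1 - t) *: y1); first exact: cA.
  exists (t *: x2 + (1 - t) *: y2); first exact: cB.
  by rewrite !scalerDr addrACA.
rewrite opprD addrACA -!scalerBr; apply: le_lt_trans (ler_normD _ _) _.
rewrite !normrZ; have /andP[t0 t1] := t01.
rewrite ger0_norm// ger0_norm ?subr_ge0//.
(* Only the term with weight t is estimated strictly, so t = 0 is set apart. *)
have [->|tn0] := eqVneq t 0; first by rewrite mul0r add0r subr0 mul1r.
have tp : 0 < t by rewrite lt_def tn0.
have h1 : t * `|x - (x1 + x2)| < t * e by rewrite ltr_pM2l.
have h2 : (1 - t) * `|y - (y1 + y2)| <= (1 - t) * e.
  by rewrite ler_wpM2l ?subr_ge0// ltW.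
lra.
Qed.

Lemma coFC_closed_sum A B : coF A -> coFC C B -> coFC C (closed_sum A B).
Proof.
move=> cA /coFCP[cB BC]; apply/coFCP; split; first exact: coF_closed_sum.
move=> x c /closureP h Cc; apply/closureP => e /h[_ [a Aa [b Bb <-]] xe].
exists (a + (b + c)); first by exists a => //; exists (b + c) => //; exact: BC.
by rewrite addrA opprD addrACA subrr addr0.
Qed.

Lemma image_translateE A a : [set x + a | x in A] = [set x | A (x - a)].
Proof.
apply/seteqP; split=> [_ [x Ax <-]|x Ax] /=; first by rewrite addrK.
by exists (x - a) => //; rewrite subrK.
Qed.

Lemma image_translatelE A a : [set a + x | x in A] = [set x | A (x - a)].
Proof.
rewrite -image_translateE; apply/seteqP; split => _ [x Ax <-]; exists x => //;
  by rewrite addrC.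
Qed.

Lemma image_scaleE A (c : R) : 0 < c -> [set c *: x | x in A] = [set x | A (c^-1 *: x)].
Proof.
move=> c0; apply/seteqP; split=> [_ [x Ax <-]|x Ax] /=.
  by rewrite scalerA mulVf ?gt_eqF// scale1r.
by exists (c^-1 *: x) => //; rewrite scalerA mulfV ?gt_eqF// scale1r.
Qed.

Lemma closed_translate A a : closed A -> closed [set x + a | x in A].
Proof.
move=> clA; rewrite image_translateE; apply: (@closed_comp _ _ (fun y => y - a) A) => //.
by move=> y _; exact: (cvgB cvg_id (@cvg_cst 'rV[R]_d a _ _ _)).
Qed.

Lemma closed_scale A (c : R) : 0 < c -> closed A -> closed [set c *: x | x in A].
Proof.
move=> c0 clA; rewrite image_scaleE//.
apply: (@closed_comp _ _ (fun y => c^-1 *: y) A) => // y _.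
exact: (@scaler_continuous R 'rV[R]_d c^-1 y).
Qed.

Lemma coF_translate A a : coF A -> coF [set x + a | x in A].
Proof.
move=> [clA /convex_setP cA]; split; first exact: closed_translate.
rewrite image_translateE.
apply/convex_setP => x y t /= Ax Ay t01.
rewrite (_ : _ - a = t *: (x - a) + (1 - t) *: (y - a)); first exact: cA.
by apply/rowP => i; rewrite !mxE; ring.
Qed.

Lemma coF_scale A (c : R) : 0 < c -> coF A -> coF [set c *: x | x in A].
Proof.
move=> c0 [clA /convex_setP cA]; split; first exact: closed_scale.
rewrite image_scaleE//.
apply/convex_setP => x y t /= Ax Ay t01.
rewrite (_ : _ *: _ = t *: (c^-1 *: x) + (1 - t) *: (c^-1 *: y)); first exact: cA.
by apply/rowP => i; rewrite !mxE; ring.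
Qed.

Lemma coFC_translate A a : coFC C A -> coFC C [set x + a | x in A].
Proof.
move=> /coFCP[cA AC]; apply/coFCP; split; first exact: coF_translate.
by move=> _ c [x Ax <-] Cc; exists (x + c); [exact: AC|rewrite addrAC].
Qed.

Lemma coFC_scale A (c : R) : 0 < c -> coFC C A -> coFC C [set c *: x | x in A].
Proof.
move=> c0 /coFCP[cA AC]; apply/coFCP; split; first exact: coF_scale.
move=> _ a [x Ax <-] Ca; exists (x + c^-1 *: a).
  by apply: AC => //; apply: coneZ => //; rewrite invr_ge0 ltW.
by rewrite scalerDr scalerA mulfV ?gt_eqF// scale1r.
Qed.

End Cones.

(** * Random vectors and the pairing *)

Section Integrals.
Context {R : realType} {disp : measure_display} {T : measurableType disp}.
Context (P : probability T R).
Implicit Types (f g h : T -> R).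

Definition integrableR f := P.-integrable [set: T] (EFin \o f).

Lemma integrableR_measurable f : integrableR f -> measurable_fun setT f.
Proof. by move=> /measurable_int/measurable_EFinP. Qed.

Lemma integrableR_EFin f : integrableR f -> (\int[P]_w (f w)%:E)%E = (\int[P]_w f w)%:E.
Proof. by move=> If; rewrite /Rintegral fineK//; exact: integrable_fin_num. Qed.

Lemma integrableRD f g : integrableR f -> integrableR g -> integrableR (fun w => f w + g w).
Proof. by move=> If Ig; exact: (integrableD measurableT If Ig). Qed.

Lemma integrableRZ c f : integrableR f -> integrableR (fun w => c * f w).
Proof. by move=> If; exact: (integrableZl measurableT c If). Qed.

Lemma integrableRN f : integrableR f -> integrableR (fun w => - f w).
Proof. by move=> If; exact: (integrableN If). Qed.

Lemma integrableRB f g : integrableR f -> integrableR g -> integrableR (fun w => f w - g w).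
Proof. by move=> If /integrableRN; exact: integrableRD. Qed.

Lemma integrableR_sum n (f : 'I_n -> T -> R) :
  (forall i, integrableR (f i)) -> integrableR (fun w => \sum_i f i w).
Proof.
move=> If; rewrite /integrableR (_ : EFin \o _ = fun w => (\sum_i (f i w)%:E)%E).
  by apply: integrable_sum => // i _; exact: If.
by apply/funext => w; rewrite /= sumEFin.
Qed.

Lemma RintegralS n (f : 'I_n -> T -> R) : (forall i, integrableR (f i)) ->
  \int[P]_w (\sum_i f i w) = \sum_i \int[P]_w f i w.
Proof.
move=> If; apply: EFin_inj; rewrite -integrableR_EFin; last exact: integrableR_sum.
under eq_integral do rewrite -sumEFin.
rewrite integral_sum//.
by rewrite -sumEFin; apply: eq_bigr => i _; rewrite integrableR_EFin.
Qed.

Lemma integrableR_cst c : integrableR (fun=> c).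
Proof. exact: finite_measure_integrable_cst. Qed.

Lemma Rintegral_cstT c : \int[P]_w c = c.
Proof. rewrite Rintegral_cst// (congr1 fine (probability_setT P)) mulr1. by []. Qed.

Lemma integrableR_le_ae f g : measurable_fun setT f -> integrableR g ->
  {ae P, forall w, `|f w| <= g w} -> integrableR f.
Proof.
move=> mf Ig fg; apply/integrableP; split; first exact/measurable_EFinP.
have /integrableP[mg] := Ig; apply: le_lt_trans.
apply: ae_ge0_le_integral => //.
- by do 2 apply: measurableT_comp => //.
- by apply: measurableT_comp => //.
- apply: filterS fg => w fgw _ /=; rewrite lee_fin.
  by rewrite (le_trans fgw)// ler_norm.
Qed.

Lemma integrableR_norm f : integrableR f -> integrableR (fun w => `|f w|).
Proof. by move=> If; apply: integrable_norm. Qed.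

Lemma ae_le_Rintegral f g : integrableR f -> integrableR g ->
  {ae P, forall w, f w <= g w} -> \int[P]_w f w <= \int[P]_w g w.
Proof.
move=> If Ig fg; rewrite -subr_ge0 -RintegralB//.
have mfg : measurable_fun setT (fun w => g w - f w).
  by apply: measurable_funB; exact: integrableR_measurable.
rewrite (_ : \int[P]_w _ = \int[P]_w `|g w - f w|); first exact: Rintegral_ge0.
congr fine; apply: ae_eq_integral => //.
- exact/measurable_EFinP.
- by apply/measurable_EFinP; apply: measurableT_comp.
- by apply: filterS fg => w fgw _; rewrite /= ger0_norm ?subr_ge0.
Qed.

Lemma ae_eq_Rintegral f g : measurable_fun setT f -> measurable_fun setT g ->
  {ae P, forall w, f w = g w} -> \int[P]_w f w = \int[P]_w g w.
Proof.
move=> mf mg fg; congr fine; apply: ae_eq_integral => //.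
- exact/measurable_EFinP.
- exact/measurable_EFinP.
- by apply: filterS fg => w fgw _; rewrite /= fgw.
Qed.

Lemma Lfun_measurable p f : f \in Lfun P p -> measurable_fun setT f.
Proof. by rewrite inE => /andP[/set_mem]. Qed.

Lemma Lfun_finite p f : f \in Lfun P p -> finite_norm P p f.
Proof. by rewrite inE => /andP[_ /set_mem]. Qed.

Lemma LfunI p f : measurable_fun setT f -> finite_norm P p f -> f \in Lfun P p.
Proof. by move=> mf ff; rewrite inE; apply/andP; split; apply/mem_set. Qed.

Lemma Lnorm_le_ae p f g : (1 <= p)%E -> measurable_fun setT f -> measurable_fun setT g ->
  {ae P, forall w, `|f w| <= `|g w|} ->
  ('N[P]_p[EFin \o f] <= 'N[P]_p[EFin \o g])%E.
Proof.
move=> p1 mf mg fg; rewrite unlock.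
move: p p1 => [r|_|//]; last first.
  case: ifPn => // _; apply: le_ess_sup.
  by apply: filterS fg => w; rewrite /= lee_fin.
rewrite lee_fin => r1; have r0 : 0 < r by exact: lt_le_trans r1.
have mp h : measurable_fun setT h -> measurable_fun setT (fun w => (`|(h w)%:E| `^ r)%E).
  move=> mh; apply: (measurableT_comp (measurable_poweR r)).
  by apply: measurableT_comp => //; exact/measurable_EFinP.
apply: gt0_ler_poweR; first by rewrite invr_ge0 ltW.
- by rewrite in_itv /= leey andbT; apply: integral_ge0 => w _; rewrite lee_fin powR_ge0.
- by rewrite in_itv /= leey andbT; apply: integral_ge0 => w _; rewrite lee_fin powR_ge0.
apply: ae_ge0_le_integral => //.
- by move=> w _; exact: poweR_ge0.
- exact: mp.
- by move=> w _; exact: poweR_ge0.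
- exact: mp.
apply: filterS fg => w fgw _; apply: gt0_ler_poweR; first exact: ltW.
- by rewrite in_itv/= leey andbT.
- by rewrite in_itv/= leey andbT.
- by rewrite lee_fin.
Qed.

Lemma Lfun_le_ae p f g : (1 <= p)%E -> measurable_fun setT f -> g \in Lfun P p ->
  {ae P, forall w, `|f w| <= `|g w|} -> f \in Lfun P p.
Proof.
move=> p1 mf Lg fg; apply: LfunI => //.
apply: le_lt_trans (Lfun_finite Lg); apply: Lnorm_le_ae => //.
exact: Lfun_measurable Lg.
Qed.

Lemma probability_gt0 : (0 < P [set: T])%E = true.
Proof. by rewrite (congr1 (fun x => (0 < x)%E) (probability_setT P)) lte01. Qed.

Lemma LfunyP f : f \in Lfun P +oo <->
  measurable_fun setT f /\ exists M, {ae P, forall w, `|f w| <= M}.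
Proof.
split=> [Lf|[mf [M fM]]].
  split; first exact: Lfun_measurable Lf.
  have := Lfun_finite Lf; rewrite /finite_norm unlock.
  by rewrite probability_gt0 => /ess_supr_bounded.
apply: LfunI => //; rewrite /finite_norm unlock probability_gt0.
apply: (@le_lt_trans _ _ M%:E); last exact: ltry.
by apply/ess_supP; apply: filterS fM => w; rewrite /= lee_fin.
Qed.

Lemma Lfun_bounded p f M : (1 <= p)%E -> measurable_fun setT f ->
  {ae P, forall w, `|f w| <= M} -> f \in Lfun P p.
Proof.
move=> p1 mf fM.
apply: (@Lfun_subset _ _ _ P p +oo%E) => //; last by apply/LfunyP; split => //; exists M.
- exact: leey.
- by rewrite (congr1 (fun x => x \is a fin_num) (probability_setT P)).
- exact: leey.
Qed.

Lemma LfunD p f g : (1 <= p)%E -> f \in Lfun P p -> g \in Lfun P p ->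
  (fun w => f w + g w) \in Lfun P p.
Proof. by move=> p1 Lf Lg; have [_] := Lfun_addr_closed P p1; apply. Qed.

Lemma Lfun0 p : (1 <= p)%E -> (fun=> 0) \in Lfun P p.
Proof. by move=> p1; have [] := Lfun_addr_closed P p1. Qed.

Lemma LfunZ p c f : (1 <= p)%E -> f \in Lfun P p -> (fun w => c * f w) \in Lfun P p.
Proof.
move=> p1 Lf; have [L0 LZ] := Lfun_submod_closed P p1.
by have := LZ c _ _ Lf L0; rewrite addr0.
Qed.

Lemma Lfun_abs p f : (1 <= p)%E -> f \in Lfun P p -> (fun w => `|f w|) \in Lfun P p.
Proof.
move=> p1 Lf; apply: (Lfun_le_ae p1 _ Lf).
  by apply: measurableT_comp => //; exact: Lfun_measurable Lf.
by apply: aeW => w; rewrite normr_id.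
Qed.

Lemma Lfun_sum p n (f : 'I_n -> T -> R) : (1 <= p)%E ->
  (forall i, f i \in Lfun P p) -> (fun w => \sum_i f i w) \in Lfun P p.
Proof.
move=> p1; elim: n f => [|n IH] f Lf.
  by under eq_fun do rewrite big_ord0; exact: Lfun0.
under eq_fun do rewrite big_ord_recl.
by apply: LfunD => //; apply: IH.
Qed.

Lemma Lfun_integrableR p f : (1 <= p)%E -> f \in Lfun P p -> integrableR f.
Proof.
move=> p1 Lf; apply/Lfun1_integrable.
by apply: (@Lfun_subset _ _ _ P 1 p) => //; by rewrite (congr1 (fun x => x \is a fin_num) (probability_setT P)).
Qed.

(** [fine] turns an infinite norm into 0, so this is the norm only on [Lfun P p], as in [nrmE]. *)
Definition nrm p f := fine 'N[P]_p[EFin \o f]%E.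

Lemma nrm_ge0 p f : 0 <= nrm p f.
Proof. exact/fine_ge0/Lnorm_ge0. Qed.

Lemma nrmE p f : f \in Lfun P p -> (nrm p f)%:E = 'N[P]_p[EFin \o f]%E.
Proof.
move=> Lf; have := Lfun_finite Lf; rewrite /finite_norm => fy.
by rewrite fineK// fin_numElt fy andbT (lt_le_trans _ (Lnorm_ge0 _ _ _))// ltNyr.
Qed.

Lemma nrmD p f g : (1 <= p)%E -> f \in Lfun P p -> g \in Lfun P p ->
  nrm p (fun w => f w + g w) <= nrm p f + nrm p g.
Proof.
move=> p1 Lf Lg; rewrite -lee_fin EFinD !nrmE//; last exact: LfunD.
by apply: eminkowski => //; [exact: Lfun_measurable Lf|exact: Lfun_measurable Lg].
Qed.

Lemma nrmZ p c f : (1 <= p)%E -> f \in Lfun P p ->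
  nrm p (fun w => c * f w) = `|c| * nrm p f.
Proof.
move=> p1 Lf; apply: EFin_inj; rewrite EFinM !nrmE//; last exact: LfunZ.
exact: (LnormZ (Lfun_Sub p1 Lf) c).
Qed.

Lemma nrm_le_ae p f g : (1 <= p)%E -> measurable_fun setT f -> g \in Lfun P p ->
  {ae P, forall w, `|f w| <= `|g w|} -> nrm p f <= nrm p g.
Proof.
move=> p1 mf Lg fg; have Lf := Lfun_le_ae p1 mf Lg fg.
rewrite -lee_fin !nrmE//; apply: Lnorm_le_ae => //; exact: Lfun_measurable Lg.
Qed.

(* Case by case on whether p or q is infinite, since the library has Hoelder only for real exponents *)
Lemma hoelder_Lfun p q g : (1 <= p)%E -> (p^-1 + q^-1 = 1)%E -> g \in Lfun P q ->
  exists2 M, 0 <= M & forall f, f \in Lfun P p ->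
    integrableR (fun w => f w * g w) /\ \int[P]_w `|f w * g w| <= M * nrm p f.
Proof.
move=> p1 pq Lg; have mg := Lfun_measurable Lg.
suff [M M0 H] : exists2 M, 0 <= M & forall f, f \in Lfun P p ->
    (\int[P]_w `|f w * g w|%:E <= (M * nrm p f)%:E)%E.
  exists M => // f Lf; have mf := Lfun_measurable Lf.
  have Ifg : integrableR (fun w => f w * g w).
    apply/integrableP; split; first by apply/measurable_EFinP; exact: measurable_funM.
    by apply: le_lt_trans (H _ Lf) _; exact: ltry.
  split=> //; rewrite -lee_fin -integrableR_EFin; first exact: H.
  exact: integrableR_norm.
case: p p1 pq => [r r1|_|//]; last first.
  rewrite invey add0e => /eqP; rewrite inve_eq1 => /eqP q1; rewrite q1 in Lg.
  have Ig := Lfun_integrableR (lexx _) Lg.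
  exists (\int[P]_w `|g w|); first exact: Rintegral_ge0.
  move=> f Lf; have mf := Lfun_measurable Lf.
  rewrite mulrC -RintegralZl//; last exact: integrableR_norm.
  rewrite -integrableR_EFin; last exact/integrableRZ/integrableR_norm.
  apply: ae_ge0_le_integral => //.
  - by apply/measurable_EFinP; apply: measurableT_comp => //; exact: measurable_funM.
  - by move=> w _; rewrite lee_fin mulr_ge0// nrm_ge0.
  - by apply/measurable_EFinP; apply: measurable_funM => //; apply: measurableT_comp.
  have := Lfun_finite Lf.
  have : {ae P, forall w, (`|(f w)%:E| <= (nrm +oo f)%:E)%E}.
    by rewrite nrmE// unlock probability_gt0; apply/ess_supP.
  move=> fM _; apply: filterS fM => w fM _.
  by rewrite normrM lee_fin ler_wpM2r.
rewrite lee_fin in r1.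
have r0 : 0 < r by exact: lt_le_trans r1.
case: q Lg => [s Lg|Lg|_]; last by rewrite addeNy.
  rewrite !inver (gt_eqF r0); have [_|s0] := eqVneq s 0; first by rewrite addey.
  rewrite -EFinD => -[rs].
  have s0' : 0 < s.
    rewrite -invr_gt0 lt_def invr_eq0 s0 /=.
    rewrite (_ : s^-1 = 1 - r^-1); last by lra.
    by rewrite subr_ge0 invf_le1.
  exists (nrm s%:E g); first exact: nrm_ge0.
  move=> f Lf; have mf := Lfun_measurable Lf.
  have := hoelder P mf mg r0 s0' rs.
  by rewrite Lnorm1 mulrC EFinM !nrmE.
rewrite invey adde0 => /eqP; rewrite inve_eq1 => /eqP [req]; rewrite req -/(1%E).
have [_ [M gM]] := (LfunyP _).1 Lg.
exists `|M| => // f Lf; have mf := Lfun_measurable Lf.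
have If := Lfun_integrableR (lexx _) Lf.
rewrite (_ : nrm 1 f = \int[P]_w `|f w|); last first.
  by apply: EFin_inj; rewrite nrmE// Lnorm1 -integrableR_EFin//; exact: integrableR_norm.
rewrite -RintegralZl//; last exact: integrableR_norm.
rewrite -integrableR_EFin; last exact/integrableRZ/integrableR_norm.
apply: ae_ge0_le_integral => //.
- by apply/measurable_EFinP; apply: measurableT_comp => //; exact: measurable_funM.
- by apply/measurable_EFinP; apply: measurable_funM => //; apply: measurableT_comp.
apply: filterS gM => w gM _; rewrite normrM lee_fin mulrC ler_wpM2r//.
by rewrite (le_trans gM)// ler_norm.
Qed.

End Integrals.

Section MeasurableVectors.
Context {R : realType} {disp : measure_display} {T : measurableType disp} {d : nat}.
Implicit Types (xi eta zeta : T -> 'rV[R]_d).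

Definition mvec xi := forall i, measurable_fun [set: T] (fun w => xi w ord0 i).

Lemma mvec_cst x : mvec (fun=> x).
Proof. by move=> i; exact: measurable_cst. Qed.

Lemma mvecD xi eta : mvec xi -> mvec eta -> mvec (fun w => xi w + eta w).
Proof.
move=> mx me i; under eq_fun do rewrite mxE.
exact: measurable_funD.
Qed.

Lemma mvecZ (f : T -> R) xi : measurable_fun setT f -> mvec xi -> mvec (fun w => f w *: xi w).
Proof.
move=> mf mx i; under eq_fun do rewrite mxE.
exact: measurable_funM.
Qed.

Lemma mvecN xi : mvec xi -> mvec (fun w => - xi w).
Proof.
move=> mx i; under eq_fun do rewrite mxE.
exact: measurableT_comp.
Qed.

Lemma mvecB xi eta : mvec xi -> mvec eta -> mvec (fun w => xi w - eta w).
Proof. by move=> mx /mvecN; exact: mvecD. Qed.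

Lemma measurable_dotv xi eta : mvec xi -> mvec eta ->
  measurable_fun setT (fun w => dotv (xi w) (eta w)).
Proof. by move=> mx me; apply: measurable_sum => i; exact: measurable_funM. Qed.

Lemma measurable_enorm xi : mvec xi -> measurable_fun setT (fun w => enorm (xi w)).
Proof.
move=> mx.
exact: (measurableT_comp (continuous_measurable_fun (@sqrt_continuous R)) (measurable_dotv mx mx)).
Qed.

Lemma mvec_if (b : T -> bool) xi eta : measurable_fun setT b -> mvec xi -> mvec eta ->
  mvec (fun w => if b w then xi w else eta w).
Proof.
move=> mb mx me i; rewrite (_ : (fun w => _) = fun w => if b w then xi w ord0 i else eta w ord0 i).
  exact: measurable_fun_ifT.
by apply/funext => w; case: (b w).
Qed.

End MeasurableVectors.

Section VecLp.
Context {R : realType} {disp : measure_display} {T : measurableType disp}.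
Context (P : probability T R) {d : nat}.
Variable p : \bar R.
Hypothesis p1 : (1 <= p)%E.
Implicit Types (xi eta zeta : T -> 'rV[R]_d).

Lemma vecLp_mvec (p' : \bar R) xi : vecLp P p' xi -> mvec xi.
Proof. by case. Qed.

(** From |x_i| <= |x| <= sum of the |x_i|; integrability of vectors thereby reduces to that of
    coordinates. *)
Lemma vecLpP xi : vecLp P p xi <-> forall i, (fun w => xi w ord0 i) \in Lfun P p.
Proof.
split=> [[mx fx] i|Lx].
  apply: (@Lfun_le_ae _ _ _ _ p _ (fun w => enorm (xi w))) => //.
    by apply: LfunI => //; exact: measurable_enorm.
  by apply: aeW => w; rewrite (ger0_norm (enorm_ge0 _)) enorm_coord_le.
have mx : mvec xi by move=> i; exact: Lfun_measurable (Lx i).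
split=> //; apply: Lfun_finite.
apply: (@Lfun_le_ae _ _ _ _ p _ (fun w => \sum_i `|xi w ord0 i|)) => //.
- exact: measurable_enorm.
- by apply: Lfun_sum => // i; apply: Lfun_abs.
- apply: aeW => w; rewrite !ger0_norm ?enorm_ge0//; first exact: enorm_le_sum.
  exact: sumr_ge0.
Qed.

Lemma vecLp0 : vecLp P p (fun=> 0 : 'rV[R]_d).
Proof. by apply/vecLpP => i; under eq_fun do rewrite mxE; exact: Lfun0. Qed.

Lemma vecLpD xi eta : vecLp P p xi -> vecLp P p eta -> vecLp P p (fun w => xi w + eta w).
Proof.
move=> /vecLpP Lx /vecLpP Le; apply/vecLpP => i; under eq_fun do rewrite mxE.
exact: LfunD.
Qed.

Lemma vecLpZ c xi : vecLp P p xi -> vecLp P p (fun w => c *: xi w).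
Proof.
move=> /vecLpP Lx; apply/vecLpP => i; under eq_fun do rewrite mxE.
exact: LfunZ.
Qed.

Lemma vecLpN xi : vecLp P p xi -> vecLp P p (fun w => - xi w).
Proof. by move=> /(vecLpZ (-1)); under eq_fun do rewrite scaleN1r. Qed.

Lemma vecLpB xi eta : vecLp P p xi -> vecLp P p eta -> vecLp P p (fun w => xi w - eta w).
Proof. by move=> Lx /vecLpN; exact: vecLpD. Qed.

Lemma Lfun_enorm xi : vecLp P p xi -> (fun w => enorm (xi w)) \in Lfun P p.
Proof. by move=> [mx fx]; apply: LfunI => //; exact: measurable_enorm. Qed.

Lemma vecLp_le xi (f : T -> R) : mvec xi -> f \in Lfun P p ->
  {ae P, forall w, enorm (xi w) <= f w} -> vecLp P p xi.
Proof.
move=> mx Lf xf; apply/vecLpP => i; apply: (Lfun_le_ae p1 _ Lf) => //.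
apply: filterS xf => w xf.
exact: le_trans (enorm_coord_le _ _) (le_trans xf (ler_norm _)).
Qed.

Lemma vecLp_bounded xi M : mvec xi -> {ae P, forall w, enorm (xi w) <= M} -> vecLp P p xi.
Proof.
move=> mx xM; apply: (@vecLp_le _ (fun=> M)) => //.
by apply: (@Lfun_bounded _ _ _ _ p _ `|M|) => //; exact: aeW.
Qed.

Lemma vecLp_cst x : vecLp P p (fun=> x : 'rV[R]_d).
Proof. by apply: (@vecLp_bounded _ (enorm x)); [exact: mvec_cst|exact: aeW]. Qed.

Lemma vecLp_integrable xi : vecLp P p xi -> forall i, integrableR P (fun w => xi w ord0 i).
Proof. by move=> /vecLpP Lx i; exact: Lfun_integrableR (Lx i). Qed.

End VecLp.

Lemma conjugate_ge1 (R : realType) (p q : \bar R) :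
  (1 <= p)%E -> (p^-1 + q^-1 = 1)%E -> (1 <= q)%E.
Proof.
move=> p1 /hoelder_conjugateP ->; first exact: hoelder_conj_ge1.
- by apply: lt_le_trans p1; rewrite ltNyr.
- by rewrite gt_eqF// (lt_le_trans _ p1).
Qed.

Section Pairing.
Context {R : realType} {disp : measure_display} {T : measurableType disp}.
Context (P : probability T R) {d : nat}.
Variables p q : \bar R.
Hypotheses (p1 : (1 <= p)%E) (pq : (p^-1 + q^-1 = 1)%E).
Implicit Types (xi eta zeta : T -> 'rV[R]_d).

Let q1 : (1 <= q)%E := conjugate_ge1 p1 pq.

Lemma pairingE xi zeta : pairing P xi zeta = \int[P]_w dotv (xi w) (zeta w).
Proof. by rewrite /pairing unlock. Qed.

Lemma pairing_integrable xi zeta : vecLp P p xi -> vecLp P q zeta ->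
  integrableR P (fun w => dotv (xi w) (zeta w)).
Proof.
move=> /(vecLpP P p1) Lx /(vecLpP P q1) Lz; apply: integrableR_sum => i.
by have [M _ H] := hoelder_Lfun p1 pq (Lz i); exact: (H _ (Lx i)).1.
Qed.

Lemma pairingDl xi eta zeta : vecLp P p xi -> vecLp P p eta -> vecLp P q zeta ->
  pairing P (fun w => xi w + eta w) zeta = pairing P xi zeta + pairing P eta zeta.
Proof.
move=> Lx Le Lz; rewrite !pairingE.
under eq_Rintegral do rewrite dotvDl.
by rewrite RintegralD//; exact: pairing_integrable.
Qed.

Lemma pairingZl c xi zeta : vecLp P p xi -> vecLp P q zeta ->
  pairing P (fun w => c *: xi w) zeta = c * pairing P xi zeta.
Proof.
move=> Lx Lz; rewrite !pairingE; under eq_Rintegral do rewrite dotvZl.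
by rewrite RintegralZl//; exact: pairing_integrable.
Qed.

Lemma pairingDr xi zeta1 zeta2 : vecLp P p xi -> vecLp P q zeta1 -> vecLp P q zeta2 ->
  pairing P xi (fun w => zeta1 w + zeta2 w) = pairing P xi zeta1 + pairing P xi zeta2.
Proof.
move=> Lx Le Lz; rewrite !pairingE.
under eq_Rintegral do rewrite dotvDr.
by rewrite RintegralD//; exact: pairing_integrable.
Qed.

Lemma pairingZr c xi zeta : vecLp P p xi -> vecLp P q zeta ->
  pairing P xi (fun w => c *: zeta w) = c * pairing P xi zeta.
Proof.
move=> Lx Lz; rewrite !pairingE; under eq_Rintegral do rewrite dotvZr.
by rewrite RintegralZl//; exact: pairing_integrable.
Qed.

Lemma pairing_ae xi eta zeta zeta' : mvec xi -> mvec eta -> mvec zeta -> mvec zeta' ->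
  {ae P, forall w, xi w = eta w} -> {ae P, forall w, zeta w = zeta' w} ->
  pairing P xi zeta = pairing P eta zeta'.
Proof.
move=> mx me mz mz' xe zz; rewrite !pairingE.
apply: ae_eq_Rintegral; [exact: measurable_dotv|exact: measurable_dotv|].
by apply: filterS2 xe zz => w -> ->.
Qed.

Lemma expect_vecE zeta i : (expect_vec P zeta) ord0 i = \int[P]_w zeta w ord0 i.
Proof. by rewrite mxE unlock. Qed.

Lemma pairing_cst a zeta : vecLp P q zeta -> pairing P (fun=> a) zeta = dotv a (expect_vec P zeta).
Proof.
move=> Lz; rewrite pairingE /dotv RintegralS; last first.
  by move=> i; apply: integrableRZ; exact: (vecLp_integrable q1 Lz).
apply: eq_bigr => i _; rewrite expect_vecE RintegralZl//.
exact: (vecLp_integrable q1 Lz).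
Qed.

Lemma expect_vecZ c zeta : vecLp P q zeta ->
  expect_vec P (fun w => c *: zeta w) = c *: expect_vec P zeta.
Proof.
move=> L1; apply/rowP => i; rewrite [RHS]mxE !expect_vecE.
under eq_Rintegral do rewrite mxE.
by rewrite RintegralZl//; exact: (vecLp_integrable q1).
Qed.

Lemma expect_vec0 : expect_vec P (fun=> 0 : 'rV[R]_d) = 0.
Proof.
apply/rowP => i; rewrite expect_vecE mxE.
by rewrite Rintegral_cstT.
Qed.

End Pairing.

(** * Measurability of random closed sets *)

(* A constant rather than a notation, so that lra sees an atom. *)
Definition invS {R : realType} (n : nat) : R := n.+1%:R^-1.

Lemma exists_invS_lt (R : realType) (e : R) : 0 < e -> exists n, invS n < e.
Proof. by move=> /ltr_add_invr[n]; rewrite add0r => ?; exists n. Qed.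

Lemma invS_gt0 (R : realType) n : 0 < invS n :> R.
Proof. by rewrite invr_gt0. Qed.

Lemma invS_le (R : realType) m n : (m <= n)%N -> invS n <= invS m :> R.
Proof. by move=> mn; rewrite lef_pV2 ?posrE// ler_nat. Qed.

Section Rationals.
Context {R : realType} {d : nat}.
Implicit Types (x y : 'rV[R]_d) (A K : set 'rV[R]_d).

Definition ratv (r : 'rV[rat]_d) : 'rV[R]_d := map_mx ratr r.

(** The denominator [d.+1] covers d = 0 and makes the sum of d such terms strictly smaller than
    e. *)
Lemma enorm_lt x e : 0 < e -> (forall i, `|x ord0 i| <= e / d.+1%:R) -> enorm x < e.
Proof.
move=> e0 xe; apply: le_lt_trans (enorm_le_sum _) _.
have [h hE] : exists h, h = e / d.+1%:R by eexists.
apply: (@le_lt_trans _ _ (\sum_(i < d) h)).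
  by apply: ler_sum => i _; rewrite hE.
rewrite sumr_const card_ord -mulr_natr hE -mulrA gtr_pMr// mulrC ltr_pdivrMr//.
by rewrite mul1r ltr_nat.
Qed.

Lemma ratv_dense x e : 0 < e -> exists r, enorm (x - ratv r) < e.
Proof.
move=> e0; have h0 : 0 < e / d.+1%:R by rewrite divr_gt0.
have /choice[f Hf] (i : 'I_d) : exists q : rat, `|x ord0 i - ratr q| < e / d.+1%:R.
  move: (e / d.+1%:R) h0 => h h0.
  have [|q] := @rat_in_itvoo R (x ord0 i - h) (x ord0 i + h); first lra.
  by rewrite in_itv /= => /andP[q1 q2]; exists q; rewrite ltr_norml; lra.
exists (\row_i f i); apply: enorm_lt => // i.
by rewrite !mxE ltW.
Qed.

Lemma enorm_lt_mx_norm x e : 0 < e -> `|x| < e / d.+1%:R -> enorm x < e.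
Proof.
move=> e0 xe; apply: enorm_lt => // i; apply: le_trans (ltW xe).
rewrite [leRHS]/Num.norm /= mx_normrE.
exact: (@le_bigmax _ _ _ _ (fun ij : 'I_1 * 'I_d => `|x ij.1 ij.2|) (ord0, i)).
Qed.

Lemma nbhs_eball x e : 0 < e -> nbhs x [set y | enorm (y - x) < e].
Proof.
move=> e0; apply/nbhs_ballP; exists (e / d.+1%:R) => /=; first by rewrite divr_gt0.
move=> y; rewrite -ball_normE /= distrC; exact: enorm_lt_mx_norm.
Qed.

Definition eball x (r : R) : set 'rV[R]_d := [set y | enorm (y - x) <= r].

Lemma eball_compact x r : compact (eball x r).
Proof.
have [r0|r0] := leP 0 r.
  rewrite (_ : eball x r = [set y | dotv (y - x) (y - x) <= r ^+ 2]).
    exact: compact_ball.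
  by apply/seteqP; split => y /=; rewrite /eball /= enorm_leE.
rewrite (_ : eball x r = set0); first exact: compact0.
apply/seteqP; split => // y; rewrite /eball /= => h.
by have := enorm_ge0 (y - x); lra.
Qed.

Lemma closureP_enorm A x :
  closure A x <-> forall e : R, 0 < e -> exists2 y, A y & enorm (x - y) < e.
Proof.
split=> [/closureP h e e0|h].
  have e0' : 0 < e / d.+1%:R by rewrite divr_gt0.
  by have [y Ay xy] := h _ e0'; exists y => //; exact: enorm_lt_mx_norm.
apply/closureP => e /h[y Ay xy]; exists y => //.
exact: le_lt_trans (mx_norm_enorm _) xy.
Qed.

Lemma enorm_subC x y : enorm (x - y) = enorm (y - x).
Proof. by rewrite -enormN opprB. Qed.

Lemma enorm_subD x y z : enorm (x - z) <= enorm (x - y) + enorm (y - z).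
Proof. by apply: le_trans (enormD _ _); rewrite addrA subrK. Qed.

(** A cluster point in K of ever better approximants from K lies in A as well. It turns a hit up to
    every error into a true hit. *)
Lemma closed_compact_dist A K : closed A -> compact K ->
  (forall e : R, 0 < e -> exists2 a, A a & exists2 k, K k & enorm (a - k) < e) ->
  A `&` K !=set0.
Proof.
move=> cA cK h.
have /choice[f Hf] (n : nat) : exists k, K k /\ exists2 a, A a & enorm (a - k) < invS n.
  by have [a Aa [k Kk ak]] := h _ (invS_gt0 R n); exists k; split => //; exists a.
have [|k [Kk ck]] := cK (f n @[n --> \oo]) _.
  by exists 0%N => // n _ /=; have [] := Hf n.
exists k; split => //; rewrite ((closure_id A).1 cA); apply/closureP_enorm => e e0.
have [N Ne] := exists_invS_lt (divr_gt0 e0 (ltr0n R 2)).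
have [|_ [[n /= Nn <-]]] := ck (f @` [set n | (N <= n)%N]) _ _ (nbhs_eball k (divr_gt0 e0 (ltr0n R 2))).
  by exists N => // n /= Nn; exists n.
rewrite /= => fk; have [_ [a Aa afn]] := Hf n; exists a => //.
have nN : invS n <= invS N :> R by exact: invS_le.
apply: le_lt_trans (enorm_subD _ (f n) _) _.
rewrite (enorm_subC k) (enorm_subC _ a) (splitr e) ltrD//.
exact: lt_trans afn (le_lt_trans nN Ne).
Qed.

End Rationals.

Section RandomClosedSets.
Context {R : realType} {disp : measure_display} {T : measurableType disp} {d : nat}.
Implicit Types (X Y : T -> set 'rV[R]_d) (K : set 'rV[R]_d) (xi zeta : T -> 'rV[R]_d).

Lemma measurable_exists (I : countType) (Q : I -> set T) :
  (forall i, measurable (Q i)) -> measurable [set w | exists i, Q i w].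
Proof.
move=> mQ; rewrite (_ : [set w | _] = \bigcup_i Q i).
  exact: countable_bigcupT_measurable.
by apply/seteqP; split => w [i]; [move=> h; exists i|move=> _ h; exists i].
Qed.

Lemma measurable_forall (I : countType) (Q : I -> set T) :
  (forall i, measurable (Q i)) -> measurable [set w | forall i, Q i w].
Proof.
move=> mQ; rewrite -(setCK [set w | _]); apply: measurableC.
rewrite (_ : ~` _ = [set w | exists i, (~` Q i) w]).
  by apply: measurable_exists => i; exact: measurableC.
by apply/seteqP; split => w /=; [move/existsNP|move=> h; apply/existsNP].
Qed.

Lemma measurable_Prop (Q : Prop) : measurable [set w : T | Q].
Proof.
have [q|nq] := pselect Q.
  by rewrite (_ : [set w | Q] = setT)//; apply/seteqP; split.
by rewrite (_ : [set w | Q] = set0)//; apply/seteqP; split.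
Qed.

Lemma measurable_ltrs (f g : T -> R) : measurable_fun setT f -> measurable_fun setT g ->
  measurable [set w | f w < g w].
Proof.
move=> mf mg; rewrite -[X in measurable X]setTI.
by have := measurable_fun_ltr mf mg measurableT (Y := [set true]); apply.
Qed.

Lemma measurable_lers (f g : T -> R) : measurable_fun setT f -> measurable_fun setT g ->
  measurable [set w | f w <= g w].
Proof.
move=> mf mg; rewrite -[X in measurable X]setTI.
by have := measurable_fun_ler mf mg measurableT (Y := [set true]); apply.
Qed.

Definition hits X K : set T := [set w | X w `&` K !=set0].

(** [random_closed_set] without almost sure nonemptiness, which [LpcoFC_intro] recovers from a
    selection. *)
Definition effros X :=
  (forall w, closed (X w)) /\ forall K, compact K -> measurable (hits X K).

(** [mvec] speaks of coordinates only, so the event is written with countably many rational balls: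
    xi w lies in K iff at every scale some rational ball contains xi w and meets K. *)
Lemma measurable_preimage_closed xi (K : set 'rV[R]_d) : mvec xi -> closed K ->
  measurable [set w | K (xi w)].
Proof.
move=> mx cK; rewrite (_ : [set w | _] = [set w | forall n : nat, exists r : 'rV[rat]_d,
    eball (ratv r) (invS n) (xi w) /\ (eball (ratv r) (invS n) `&` K !=set0)]).
  apply: measurable_forall => n; apply: measurable_exists => r.
  apply: measurableI; last exact: measurable_Prop.
  apply: measurable_lers; last exact: measurable_cst.
  by apply: measurable_enorm; apply: mvecB => //; exact: mvec_cst.
apply/seteqP; split => w /= h.
  move=> n; have [r xr] := ratv_dense (xi w) (invS_gt0 R n).
  exists r; split; first exact: ltW.
  by exists (xi w); split => //; exact: ltW.
rewrite ((closure_id K).1 cK); apply/closureP_enorm => e e0.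
have [N Ne] := exists_invS_lt (divr_gt0 e0 (ltr0n R 2)).
have [r [xr [k [kr Kk]]]] := h N; exists k => //.
apply: le_lt_trans (enorm_subD _ (ratv r) _) _.
rewrite (enorm_subC _ k); move: xr kr; rewrite /eball /=; lra.
Qed.

Lemma effros_point xi : mvec xi -> effros (fun w => [set xi w]).
Proof.
move=> mx; split=> [w|K cK].
  by apply: compact_closed; [exact: norm_hausdorff|exact: compact_set1].
rewrite (_ : hits _ _ = [set w | K (xi w)]).
  apply: measurable_preimage_closed => //.
  by apply: compact_closed; first exact: norm_hausdorff.
apply/seteqP; split => w /=; first by move=> [_ [-> ]].
by exists (xi w).
Qed.

Lemma effros_cst F : closed F -> effros (fun=> F : set 'rV[R]_d).
Proof. by move=> cF; split=> // K _; exact: measurable_Prop. Qed.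

(** The event that the sum hits K is expressed by rational balls hit separately by X and by Y, hence
    by countably many events known to be measurable. *)
Lemma effros_sum X Y : effros X -> effros Y ->
  effros (fun w => closed_sum (X w) (Y w)).
Proof.
move=> [cX mX] [cY mY]; split=> [w|K cK]; first exact: closed_closure.
(* The radius is three units: one each for replacing x by r and y by s, and one for approximating a
   point of the closure by x + y. *)
rewrite (_ : hits _ _ = [set w | forall n : nat, exists rs : 'rV[rat]_d * 'rV[rat]_d,
    [/\ (X w `&` eball (ratv rs.1) (invS n)) !=set0,
     (Y w `&` eball (ratv rs.2) (invS n)) !=set0 &
     eball (ratv rs.1 + ratv rs.2) (3 * invS n) `&` K !=set0]]).
  apply: measurable_forall => n; apply: measurable_exists => -[r s] /=.
  rewrite [X in measurable X](_ : _ = hits X (eball (ratv r) (invS n)) `&`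
    (hits Y (eball (ratv s) (invS n)) `&`
     [set w | eball (ratv r + ratv s) (3 * invS n) `&` K !=set0])).
    apply: measurableI; first exact/mX/eball_compact.
    apply: measurableI; last exact: measurable_Prop.
    exact/mY/eball_compact.
  by apply/seteqP; split => w /=; [move=> []|move=> [? []]].
apply/seteqP; split => w /=.
  move=> [z [/closureP_enorm h Kz]] n.
  have [_ [x Xx [y Yy <-]] zxy] := h _ (invS_gt0 R n).
  have [r xr] := ratv_dense x (invS_gt0 R n).
  have [s ys] := ratv_dense y (invS_gt0 R n).
  exists (r, s); split.
  - by exists x; split => //; exact: ltW.
  - by exists y; split => //; exact: ltW.
  exists z; split => //; rewrite /eball /=.
  apply: le_trans (enorm_subD _ (x + y) _) _.
  have -> : x + y - (ratv r + ratv s) = x - ratv r + (y - ratv s) by rewrite opprD addrACA.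
  have := enormD (x - ratv r) (y - ratv s).
  by move: xr ys zxy; lra.
move=> h; apply: closed_compact_dist => //; first exact: closed_closure.
(* Five units: two from x and y to their centres, three from the sum of the centres to k. *)
move=> e e0; have [N Ne] := exists_invS_lt (divr_gt0 e0 (ltr0n R 5)).
have [[r s] [/= [x [Xx xr]] [y [Yy ys]] [k [krs Kk]]]] := h N.
exists (x + y); first by apply: subset_closure; exists x => //; exists y.
exists k => //; apply: le_lt_trans (enorm_subD _ (ratv r + ratv s) _) _.
rewrite (enorm_subC _ k).
have -> : x + y - (ratv r + ratv s) = x - ratv r + (y - ratv s) by rewrite opprD addrACA.
have := enormD (x - ratv r) (y - ratv s).
move: xr ys krs; rewrite /eball /=; lra.
Qed.

(** The sum with a random singleton, where taking the closure changes nothing. *)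
Lemma effros_translate X xi : mvec xi -> effros X ->
  effros (fun w => [set x + xi w | x in X w]).
Proof.
move=> mx mX; have := effros_sum mX (effros_point mx).
congr effros; apply/funext => w.
have [cX _] := mX; rewrite /closed_sum -(closure_id _).1.
  apply/seteqP; split => [_ [x Xx [_ -> <-]]|_ [x Xx <-]]; first by exists x.
  by exists x => //; exists (xi w).
rewrite (_ : [set _ | _ in _ & _ in _] = [set x + xi w | x in X w]).
  exact: closed_translate.
apply/seteqP; split => [_ [x Xx [_ -> <-]]|_ [x Xx <-]]; first by exists x.
by exists x => //; exists (xi w).
Qed.

Lemma effros_scale X (c : R) : 0 < c -> effros X ->
  effros (fun w => [set c *: x | x in X w]).
Proof.
move=> c0 [cX mX]; split=> [w|K cK]; first exact: closed_scale.
rewrite (_ : hits _ _ = hits X [set c^-1 *: x | x in K]).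
  apply/mX; apply: continuous_compact => //; apply: continuous_subspaceT => y.
  exact: (@scaler_continuous R 'rV[R]_d c^-1 y).
apply/seteqP; split => w [x [Xx Kx]].
  case: Xx => y Xy yx; exists y; split => //; exists x => //.
  by rewrite -yx scalerA mulVf ?gt_eqF// scale1r.
case: Kx => y Ky yx; exists y; split => //; exists x => //.
by rewrite -yx scalerA mulfV ?gt_eqF// scale1r.
Qed.

Lemma measurable_nonempty X : effros X -> measurable [set w | X w !=set0].
Proof.
move=> [_ mX]; rewrite (_ : [set w | _] = [set w | exists n : nat, hits X (eball 0 n%:R) w]).
  by apply: measurable_exists => n; exact/mX/eball_compact.
apply/seteqP; split => w /=; last by move=> [n [x [Xx _]]]; exists x.
move=> [x Xx]; exists (Num.bound (enorm x)); exists x; split => //.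
by rewrite /eball /= subr0 ltW// archi_boundP// enorm_ge0.
Qed.

(** h > a iff X hits a rational ball all of whose points have product above a with zeta, the radius
    times |zeta| being the largest loss over the ball. *)
Lemma measurable_support X zeta : effros X -> mvec zeta ->
  measurable_fun setT (fun w => support_fun (X w) (zeta w)).
Proof.
move=> [cX mX] mz.
apply: (measurability _ (ErealGenOInfty.measurableE R)) => // _ [_ [a ->] <-].
rewrite setTI (_ : _ @^-1` _ = [set w | exists rn : 'rV[rat]_d * nat,
   hits X (eball (ratv rn.1) (invS rn.2)) w /\
   a < dotv (ratv rn.1) (zeta w) - (invS rn.2) * enorm (zeta w)]).
  apply: measurable_exists => -[r n] /=; apply: measurableI.
    exact/mX/eball_compact.
  apply: measurable_ltrs; first exact: measurable_cst.
  apply: measurable_funB; first by apply: measurable_dotv => //; exact: mvec_cst.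
  by apply: measurable_funM; [exact: measurable_cst|exact: measurable_enorm].
apply/seteqP; split => w /=; rewrite in_itv /= andbT.
  move=> /ereal_sup_gt[_ [x Xx <-]]; rewrite lte_fin => ax.
  (* Factor 2: |zeta| times the radius is lost once in passing from x to r and once in the penalty;
     the summand 1 allows zeta w = 0. *)
  have e0 : 0 < (dotv x (zeta w) - a) / (2 * (enorm (zeta w) + 1)).
    by rewrite divr_gt0 ?subr_gt0// mulr_gt0// ltr_wpDl// enorm_ge0.
  have [n ne] := exists_invS_lt e0; have [r xr] := ratv_dense x (invS_gt0 R n).
  exists (r, n); split=> /=; first by exists x; split => //; exact: ltW.
  have z0 := enorm_ge0 (zeta w).
  have h1 : dotv (x - ratv r) (zeta w) <= invS n * enorm (zeta w).
    apply: le_trans (dotv_enorm _ _) _; rewrite ler_wpM2r//; exact: ltW.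
  have h2 : invS n * (2 * (enorm (zeta w) + 1)) < dotv x (zeta w) - a.
    by rewrite -ltr_pdivlMr// mulr_gt0// ltr_wpDl.
  have h3 := invS_gt0 R n.
  by rewrite dotvBl in h1; lra.
move=> [[r n] /= [[x [Xx xr]] ar]].
apply: lt_le_trans (support_fun_ge (zeta w) Xx); rewrite lte_fin.
apply: lt_le_trans ar _.
have := dotv_enorm (ratv r - x) (zeta w); rewrite dotvBl.
have : enorm (ratv r - x) * enorm (zeta w) <= invS n * enorm (zeta w).
  by rewrite ler_wpM2r ?enorm_ge0// enorm_subC.
lra.
Qed.

End RandomClosedSets.

(** * Expected support functions *)

Section IntegralBelow.
Context {R : realType} {disp : measure_display} {T : measurableType disp}.
Context (P : probability T R).
Implicit Types (f g : T -> \bar R) (u v : T -> R).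
Local Open Scope ereal_scope.

(** The case of interest is an infinite integral of g: the negative part of u + g is at most |u|,
    hence integrable, while the positive part plus |u| is at least g, hence has infinite
    integral. *)
Lemma integralD_ge0 u g : integrableR P u -> measurable_fun setT g ->
  (forall w, 0 <= g w) ->
  \int[P]_w ((u w)%:E + g w) = (\int[P]_w u w)%:E + \int[P]_w g w.
Proof.
move=> Iu mg g0; have mu := integrableR_measurable Iu.
have [gfin|ginf] := ltP (\int[P]_w g w) +oo.
  rewrite integralD//; first by rewrite integrableR_EFin.
  apply/integrableP; split => //.
  by under eq_integral do rewrite gee0_abs//.
have gy : \int[P]_w g w = +oo by apply/eqP; rewrite -leye_eq.
rewrite gy addey//.
pose h w := (u w)%:E + g w.
have mh : measurable_fun setT h by apply: emeasurable_funD => //; exact/measurable_EFinP.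
have hn : \int[P]_w (h^\- w) < +oo.
  have /integrableP[_ ] := integrableR_norm Iu; apply: le_lt_trans.
  apply: ge0_le_integral => //.
  - exact: measurable_funeneg.
  - by apply: measurableT_comp => //; apply/measurable_EFinP; apply: measurableT_comp.
  move=> w _; rewrite funenegE /h /= normr_id.
  have := g0 w; case: (g w) => [r| |]//; rewrite ?lee_fin => r0.
    rewrite -EFinD -EFin_max lee_fin ge_max normr_ge0 andbT.
    by rewrite opprD; have := ler_norm (- u w); rewrite normrN; lra.
  by rewrite addey//= max_r ?leNye// lee_fin.
have hp : \int[P]_w (h^\+ w) = +oo.
  apply/eqP; rewrite -leye_eq -gy.
  have : \int[P]_w g w <= \int[P]_w (h^\+ w + `|u w|%:E).
    apply: ge0_le_integral => //.
    - apply: emeasurable_funD; first exact: measurable_funepos.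
      by apply/measurable_EFinP; apply: measurableT_comp.
    move=> w _; rewrite funeposE /h; case: (g w) (g0 w) => [r| |]// r0.
      rewrite -EFinD -EFin_max -EFinD lee_fin; have := ler_norm (- u w); rewrite normrN.
      by have : (u w + r <= Order.max (u w + r)%R 0)%R; [rewrite le_max lexx|lra].
  rewrite gy ge0_integralD//; last 2 first.
  - exact: measurable_funepos.
  - by apply/measurable_EFinP; apply: measurableT_comp.
  rewrite integrableR_EFin; last exact: integrableR_norm.
  by case: (\int[P]_w h^\+ w).
rewrite integralE -/h hp addye//.
have : 0 <= \int[P]_w (h^\- w) by exact: integral_ge0.
by case: (\int[P]_w h^\- w) hn.
Qed.

(** Truncating f - u at 0 makes it nonnegative everywhere although u <= f holds only almost surely;
    comparison and additivity below then follow from the nonnegative case. *)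
Lemma integral_split f u : measurable_fun setT f -> integrableR P u ->
  {ae P, forall w, (u w)%:E <= f w} ->
  \int[P]_w f w = (\int[P]_w u w)%:E + \int[P]_w maxe (f w - (u w)%:E) 0.
Proof.
move=> mf Iu uf; have mu := integrableR_measurable Iu.
have mg : measurable_fun setT (fun w => maxe (f w - (u w)%:E) 0).
  apply: measurable_maxe; last exact: measurable_cst.
  by apply: emeasurable_funB => //; exact/measurable_EFinP.
rewrite -integralD_ge0//; last by move=> w; rewrite le_max lexx orbT.
apply: ae_eq_integral => //.
- by apply: emeasurable_funD => //; exact/measurable_EFinP.
apply: filterS uf => w uf _; rewrite max_l ?sube_ge0//.
by rewrite addeC subeK.
Qed.

Lemma integral_ge f u : measurable_fun setT f -> integrableR P u ->
  {ae P, forall w, (u w)%:E <= f w} -> (\int[P]_w u w)%:E <= \int[P]_w f w.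
Proof.
move=> mf Iu uf; rewrite (integral_split mf Iu uf) leeDl//.
by apply: integral_ge0 => w _; rewrite le_max lexx orbT.
Qed.

Lemma integral_le f g u : measurable_fun setT f -> measurable_fun setT g -> integrableR P u ->
  {ae P, forall w, (u w)%:E <= f w} -> {ae P, forall w, f w <= g w} ->
  \int[P]_w f w <= \int[P]_w g w.
Proof.
move=> mf mg Iu uf fg; have mu := integrableR_measurable Iu.
have ug : {ae P, forall w, (u w)%:E <= g w}.
  by apply: filterS2 uf fg => w; exact: le_trans.
have mm h : measurable_fun setT h -> measurable_fun setT (fun w => maxe (h w - (u w)%:E) 0).
  move=> mh; apply: measurable_maxe; last exact: measurable_cst.
  by apply: emeasurable_funB => //; exact/measurable_EFinP.
rewrite (integral_split mf Iu uf) (integral_split mg Iu ug) leeD2l//.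
apply: ae_ge0_le_integral => //.
- by move=> w _; rewrite le_max lexx orbT.
- exact: mm.
- by move=> w _; rewrite le_max lexx orbT.
- exact: mm.
apply: filterS fg => w fg _; rewrite ge_max !le_max lexx !orbT andbT.
by rewrite leeB.
Qed.

Lemma integralD_ge f g u v : measurable_fun setT f -> measurable_fun setT g ->
  integrableR P u -> integrableR P v ->
  {ae P, forall w, (u w)%:E <= f w} -> {ae P, forall w, (v w)%:E <= g w} ->
  \int[P]_w (f w + g w) = \int[P]_w f w + \int[P]_w g w.
Proof.
move=> mf mg Iu Iv uf vg.
have mu := integrableR_measurable Iu; have mv := integrableR_measurable Iv.
have mm u' h : measurable_fun setT u' -> measurable_fun setT h ->
    measurable_fun setT (fun w => maxe (h w - (u' w : R)%:E) 0).
  move=> mu' mh; apply: measurable_maxe; last exact: measurable_cst.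
  by apply: emeasurable_funB => //; exact/measurable_EFinP.
have m0 u' h w : 0 <= maxe (h w - (u' w : R)%:E) 0 by rewrite le_max lexx orbT.
rewrite (integral_split mf Iu uf) (integral_split mg Iv vg).
have uvfg : {ae P, forall w, (u w + v w)%:E <= f w + g w}.
  by apply: filterS2 uf vg => w uf vg; rewrite EFinD leeD.
have mfg : measurable_fun setT (fun w => f w + g w) by exact: emeasurable_funD.
rewrite (integral_split mfg (integrableRD Iu Iv) uvfg).
rewrite RintegralD// EFinD [RHS]addeACA; congr (_ + _).
rewrite -ge0_integralD//; [|exact: mm|exact: mm].
apply: ge0_ae_eq_integral => //.
- by apply: mm => //; exact: measurable_funD.
- by apply: emeasurable_funD; exact: mm.
- by move=> w _; rewrite le_max lexx orbT.
- by move=> w _; apply: adde_ge0; exact: m0.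
apply: filterS2 uf vg => w uf vg _.
rewrite !max_l ?sube_ge0// ?EFinD ?leeD//.
by rewrite fin_num_oppeD// addeACA.
Qed.

End IntegralBelow.

(** * Operations on integrable random sets and their expected support functions *)

Section RandomSetsLp.
Context {R : realType} {disp : measure_display} {T : measurableType disp}.
Context (P : probability T R) {d : nat}.
Variables (p q : \bar R) (C : set 'rV[R]_d).
Hypotheses (p1 : (1 <= p)%E) (pq : (p^-1 + q^-1 = 1)%E).
Hypotheses (C_closed : closed C) (C_convex : @convex_set R 'rV[R]_d C).
Hypothesis C_cone : cone C.
Implicit Types (X Y : T -> set 'rV[R]_d) (xi zeta : T -> 'rV[R]_d) (F : set 'rV[R]_d).

Local Notation LC := (LpcoFC P p C).

Let q1 : (1 <= q)%E := conjugate_ge1 p1 pq.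

Lemma LpcoFC_intro X xi : effros X -> (forall w, coFC C (X w)) -> selLp P p X xi -> LC X.
Proof.
move=> [cX mX] coX Lxi; split=> //; last by exists xi.
by split=> //; apply: filterS Lxi.2 => w Xx; exists (xi w).
Qed.

Lemma LpcoFC_effros X : LC X -> effros X.
Proof. by move=> [[cX mX _] _ _]. Qed.

Lemma LpcoFC_coFC X w : LC X -> coFC C (X w).
Proof. by move=> [_ coX _]. Qed.

Lemma LpcoFC_sel X : LC X -> exists xi, selLp P p X xi.
Proof. by move=> [_ _ [xi]]; exists xi. Qed.

Lemma LpcoFC_nonempty X : LC X -> {ae P, forall w, X w !=set0}.
Proof. by move=> [[]]. Qed.

Lemma selLp_cst F x : F x -> selLp P p (fun=> F) (fun=> x).
Proof. by move=> Fx; split; [exact: vecLp_cst|exact: aeW]. Qed.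

Lemma LpcoFC_cst F : coFC C F -> F !=set0 -> LC (fun=> F).
Proof.
move=> cF [x Fx]; apply: (@LpcoFC_intro _ (fun=> x)) => //; last exact: selLp_cst.
by apply: effros_cst; case: cF => -[].
Qed.

Lemma LpcoFC_translate X xi : LC X -> vecLp P p xi -> LC (fun w => [set x + xi w | x in X w]).
Proof.
move=> LX Lxi; have [eta [Le eX]] := LpcoFC_sel LX.
apply: (@LpcoFC_intro _ (fun w => eta w + xi w)).
- by apply: effros_translate; [exact: vecLp_mvec Lxi|exact: LpcoFC_effros].
- by move=> w; apply: coFC_translate => //; exact: LpcoFC_coFC.
split; first exact: vecLpD.
by apply: filterS eX => w Xe; exists (eta w).
Qed.

Lemma LpcoFC_scale X c : 0 < c -> LC X -> LC (fun w => [set c *: x | x in X w]).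
Proof.
move=> c0 LX; have [eta [Le eX]] := LpcoFC_sel LX.
apply: (@LpcoFC_intro _ (fun w => c *: eta w)).
- by apply: effros_scale => //; exact: LpcoFC_effros.
- by move=> w; apply: coFC_scale => //; exact: LpcoFC_coFC.
split; first exact: vecLpZ.
by apply: filterS eX => w Xe; exists (eta w).
Qed.

Lemma LpcoFC_sum X Y : LC X -> LC Y -> LC (fun w => closed_sum (X w) (Y w)).
Proof.
move=> LX LY; have [eta [Le eX]] := LpcoFC_sel LX; have [xi [Lx xY]] := LpcoFC_sel LY.
apply: (@LpcoFC_intro _ (fun w => eta w + xi w)).
- by apply: effros_sum => //; exact: LpcoFC_effros.
- move=> w; apply: coFC_closed_sum => //; last exact: LpcoFC_coFC.
  by have [] := LpcoFC_coFC w LX.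
split; first exact: vecLpD.
apply: filterS2 eX xY => w Xe Yx; apply: subset_closure.
by exists (eta w) => //; exists (xi w).
Qed.

Lemma LpcoFC_cone : LC (fun=> C).
Proof. by apply: LpcoFC_cst; [exact: coFC_cone|exists 0; exact: cone0]. Qed.

(** Written in the order of summands used by [minimal]; [addCE] gives it as a translate of the
    constant set C. *)
Definition addC xi := fun w => [set xi w + x | x in C].

Lemma addCE xi : addC xi = fun w => [set x + xi w | x in C].
Proof. by apply/funext => w; rewrite /addC image_translatelE image_translateE. Qed.

Lemma LpcoFC_point xi : vecLp P p xi -> LC (addC xi).
Proof. by move=> Lx; rewrite addCE; apply: LpcoFC_translate => //; exact: LpcoFC_cone. Qed.

Lemma sel_addC_sub X xi : LC X -> selLp P p X xi -> {ae P, forall w, addC xi w `<=` X w}.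
Proof.
move=> LX [_]; apply: filterS => w Xx _ [c Cc <-].
have /(coFCP C_cone)[_] := LpcoFC_coFC w LX.
exact.
Qed.

Section Support.
Variable zeta : T -> 'rV[R]_d.
Hypothesis Lzeta : vecLp P q zeta.
Let h X w := support_fun (X w) (zeta w).

Let mh X : LC X -> measurable_fun setT (h X).
Proof.
by move=> LX; apply: measurable_support; [exact: LpcoFC_effros|exact: vecLp_mvec Lzeta].
Qed.

Let sel_le X xi : selLp P p X xi -> {ae P, forall w, ((dotv (xi w) (zeta w))%:E <= h X w)%E}.
Proof. by move=> [_]; apply: filterS => w; exact: support_fun_ge. Qed.

Let sel_int X xi : selLp P p X xi -> integrableR P (fun w => dotv (xi w) (zeta w)).
Proof. by move=> [Lx _]; exact: (pairing_integrable p1 pq Lx Lzeta). Qed.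

Lemma expect_support_ge X xi : LC X -> selLp P p X xi ->
  ((pairing P xi zeta)%:E <= expect_support P X zeta)%E.
Proof.
move=> LX sx; rewrite pairingE; apply: integral_ge; [exact: mh|exact: sel_int sx|].
exact: sel_le.
Qed.

Lemma expect_support_gtNy X : LC X -> (-oo < expect_support P X zeta)%E.
Proof.
move=> LX; have [xi sx] := LpcoFC_sel LX.
by apply: lt_le_trans (expect_support_ge LX sx); exact: ltNyr.
Qed.

Lemma expect_support_le X Y : LC X -> LC Y -> {ae P, forall w, X w `<=` Y w} ->
  (expect_support P X zeta <= expect_support P Y zeta)%E.
Proof.
move=> LX LY XY; have [xi sx] := LpcoFC_sel LX.
apply: (integral_le (mh LX) (mh LY) (sel_int sx) (sel_le sx)).
by apply: filterS XY => w; exact: support_funS.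
Qed.

Lemma expect_support_sum X Y : LC X -> LC Y ->
  expect_support P (fun w => closed_sum (X w) (Y w)) zeta =
  (expect_support P X zeta + expect_support P Y zeta)%E.
Proof.
move=> LX LY; have [xi sx] := LpcoFC_sel LX; have [eta se] := LpcoFC_sel LY.
rewrite -(integralD_ge (mh LX) (mh LY) (sel_int sx) (sel_int se) (sel_le sx) (sel_le se)).
apply: ae_eq_integral => //.
- exact: mh (LpcoFC_sum LX LY).
- by apply: emeasurable_funD; exact: mh.
apply: filterS2 (LpcoFC_nonempty LX) (LpcoFC_nonempty LY) => w X0 Y0 _.
exact: support_closed_sum.
Qed.

Lemma expect_support_translate X xi : LC X -> vecLp P p xi ->
  expect_support P (fun w => [set x + xi w | x in X w]) zeta =
  (expect_support P X zeta + (pairing P xi zeta)%:E)%E.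
Proof.
move=> LX Lx; have [eta se] := LpcoFC_sel LX.
have Ix := pairing_integrable p1 pq Lx Lzeta.
rewrite /expect_support; under eq_integral do rewrite support_translate.
rewrite (integralD_ge (mh LX) _ (sel_int se) Ix (sel_le se)).
- by rewrite pairingE integrableR_EFin.
- by apply/measurable_EFinP; exact: integrableR_measurable Ix.
- exact: aeW.
Qed.

Lemma expect_support_scale X c : 0 < c -> LC X ->
  expect_support P (fun w => [set c *: x | x in X w]) zeta =
  (c%:E * expect_support P X zeta)%E.
Proof.
move=> c0 LX; have [xi sx] := LpcoFC_sel LX.
rewrite /expect_support (integral_split (mh LX) (sel_int sx) (sel_le sx)).
under eq_integral do rewrite support_scale//.
have Icx := integrableRZ c (sel_int sx).
have mch : measurable_fun setT (fun w => c%:E * h X w)%E by apply: measurable_funeM; exact: mh.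
rewrite (integral_split mch Icx); last first.
  by apply: filterS (sel_le sx) => w; rewrite EFinM lee_pmul2l.
rewrite RintegralZl//; last exact: sel_int sx.
rewrite muleDr//.
  rewrite EFinM; congr (_ + _)%E; rewrite -ge0_integralZl//.
  - apply: eq_integral => w _; rewrite maxeMr ?ltW// mule0 EFinM muleBr// fin_num_adde_defl//.
  - apply: measurable_maxe; last exact: measurable_cst.
    apply: emeasurable_funB; first exact: mh.
    by apply/measurable_EFinP; exact: integrableR_measurable (sel_int sx).
  - by move=> w _; rewrite le_max lexx orbT.
  - by rewrite lee_fin ltW.
Qed.

Lemma expect_support_cone : selLp P q (fun=> polar_cone C) zeta ->
  expect_support P (fun=> C) zeta = 0%E.
Proof.
move=> [_ zG]; rewrite /expect_support.
rewrite (@ae_eq_integral _ _ _ P _ (cst 0%E))//; first by rewrite integral0.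
  exact: mh LpcoFC_cone.
by apply: filterS zG => w /support_cone ->.
Qed.

Lemma expect_support_point xi : selLp P q (fun=> polar_cone C) zeta -> vecLp P p xi ->
  expect_support P (addC xi) zeta = (pairing P xi zeta)%:E.
Proof.
move=> zG Lx; rewrite addCE expect_support_translate//; last exact: LpcoFC_cone.
by rewrite expect_support_cone// add0e.
Qed.

End Support.

End RandomSetsLp.

(** * Measurable nearest-point projections *)

Section Selections.
Context {R : realType} {disp : measure_display} {T : measurableType disp} {d : nat}.
Implicit Types (X : T -> set 'rV[R]_d).

(** The obtuse angle at y gives |z - x|^2 >= |y - x|^2 + |z - y|^2. *)
Lemma nearest_point_unique (F : set 'rV[R]_d) x y z : @convex_set R 'rV[R]_d F ->
  F y -> (forall t, F t -> dotv (y - x) (y - x) <= dotv (t - x) (t - x)) ->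
  F z -> dotv (z - x) (z - x) <= dotv (y - x) (y - x) -> z = y.
Proof.
move=> cF Fy ymin Fz zx; have ob := nearest_point_obtuse cF Fy ymin Fz.
apply/eqP; rewrite -subr_eq0 -dotv_eq0 eq_le dotv_ge0 andbT.
move: zx ob; rewrite (_ : z - x = (z - y) - (x - y)); last first.
  by rewrite opprB addrA subrK.
rewrite (_ : y - x = - (x - y)); last by rewrite opprB.
rewrite (dotvBl (z - y)) !(dotvBr (z - y)) dotvNl dotvNr opprK (dotvC (z - y) (x - y)).
lra.
Qed.

(** X w may be empty on a null set; the value 0 prescribed there determines the projection
    everywhere, as exact measurability requires. *)
Definition is_proj X (x : 'rV[R]_d) (pi : T -> 'rV[R]_d) := forall w,
  (X w !=set0 -> X w (pi w) /\
     forall z, X w z -> dotv (pi w - x) (pi w - x) <= dotv (z - x) (z - x)) /\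
  (~ (X w !=set0) -> pi w = 0).

Lemma exists_proj X x : (forall w, closed (X w)) -> exists pi, is_proj X x pi.
Proof.
move=> cX; suff /choice[pi Hpi] : forall w, exists y, (X w !=set0 -> X w y /\
     forall z, X w z -> dotv (y - x) (y - x) <= dotv (z - x) (z - x)) /\
  (~ (X w !=set0) -> y = 0) by exists pi.
move=> w; have [X0|X0] := pselect (X w !=set0); last by exists 0.
by have [y Xy ymin] := nearest_point x (cX w) X0; exists y; split.
Qed.

Lemma mvec_of_closed (xi : T -> 'rV[R]_d) :
  (forall K, compact K -> measurable [set w | K (xi w)]) -> mvec xi.
Proof.
move=> mK i; apply/measurable_EFinP.
apply: (measurability _ (ErealGenOInfty.measurableE R)) => // _ [_ [a ->] <-].
rewrite setTI -(setCK (_ @^-1` _)); apply: measurableC.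
rewrite [X in measurable X](_ : _ = [set w | exists n : nat,
    ([set y : 'rV[R]_d | y ord0 i <= a] `&` eball 0 n%:R) (xi w)]).
  apply: measurable_exists => n; apply: (mK (_ `&` _)).
  rewrite setIC; apply: compact_closedI; first exact: eball_compact.
  have := @closed_halfspace R d (delta_mx ord0 i) a.
  by under eq_set do rewrite dotv_delta.
apply/seteqP; split => w /=; rewrite in_itv /= andbT.
  move=> /negP; rewrite -leNgt lee_fin => xa.
  exists (Num.bound (enorm (xi w))); split => //.
  by rewrite /eball /= subr0 ltW// archi_boundP// enorm_ge0.
by move=> [n [xa _]]; apply/negP; rewrite -leNgt lee_fin.
Qed.

(* The projection lies in K iff every ball around x that hits X also hits X through K. *)
Lemma mvec_proj X x pi : effros X -> (forall w, @convex_set R 'rV[R]_d (X w)) ->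
  is_proj X x pi -> mvec pi.
Proof.
move=> eX coX Hpi; have [cX mX] := eX.
apply: mvec_of_closed => K cK.
have clK : closed K by apply: compact_closed; first exact: norm_hausdorff.
pose B (a : rat) := [set y : 'rV[R]_d | dotv (y - x) (y - x) <= ratr a].
pose NE := [set w | X w !=set0].
have mNE : measurable NE by exact: measurable_nonempty.
rewrite (_ : [set w | _] =
    (NE `&` [set w | forall a : rat, (~` hits X (B a) `|` hits X (K `&` B a)) w])
    `|` (~` NE `&` [set w | K 0])).
  apply: measurableU.
    apply: measurableI => //; apply: measurable_forall => a; apply: measurableU.
      by apply: measurableC; apply: mX; exact: compact_ball.
    by apply/mX/compact_closedI => //; exact: closed_ball_dotv.
  apply: measurableI; first exact: measurableC.
  exact: measurable_Prop.
apply/seteqP; split => w /=.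
  have [h1 h2] := Hpi w; move=> Kpi.
  have [X0|X0] := pselect (X w !=set0); last by right; rewrite -(h2 X0).
  have [Xpi pimin] := h1 X0.
  left; split => // a; have [ha|] := pselect (hits X (B a) w); last by left.
  right; exists (pi w); split => //; split => //.
  by have [z [Xz Bz]] := ha; exact: le_trans (pimin z Xz) Bz.
move=> [[X0 H]|[X0 K0]]; last by have [_ ->] := Hpi w.
have [/(_ X0)[Xpi pimin] _] := Hpi w.
set m := dotv (pi w - x) (pi w - x).
(* A rational radius just above the minimum m yields points of X w in K almost as near to x as the
   projection. So the nearest point of the closed set X w [&] K is at minimal distance, and
   uniqueness identifies it with the projection. *)
have XK (e : R) : 0 < e -> exists z, [/\ X w z, K z & dotv (z - x) (z - x) < m + e].
  move=> e0; have [|a] := @rat_in_itvoo R m (m + e); first by rewrite ltrDl.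
  rewrite in_itv /= => /andP[ma ae].
  have [nha|[z [Xz [Kz Bz]]]] := H a.
    by exfalso; apply: nha; exists (pi w); split => //; exact: ltW.
  by exists z; split => //; exact: le_lt_trans ae.
have [|z [Xz Kz] zmin] := @nearest_point _ _ (X w `&` K) x (closedI (cX w) clK).
  by have [z [Xz Kz _]] := XK 1 ltr01; exists z.
rewrite -(nearest_point_unique (coX w) Xpi pimin Xz)//.
apply/ler_addgt0Pr => e e0; have [t [Xt Kt te]] := XK e e0.
by apply: le_trans (ltW te); exact: zmin.
Qed.

End Selections.

(** * Expected support functions as suprema over selections *)

Section SupOverSelections.
Context {R : realType} {disp : measure_display} {T : measurableType disp}.
Context (P : probability T R) {d : nat}.
Variables (p q : \bar R) (C : set 'rV[R]_d).
Hypotheses (p1 : (1 <= p)%E) (pq : (p^-1 + q^-1 = 1)%E).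
Implicit Types (X : T -> set 'rV[R]_d) (xi zeta : T -> 'rV[R]_d).

(* A Castaing representation, made p-integrable by truncation towards a fixed selection. *)
Lemma dense_selections X : LpcoFC P p C X -> exists c : nat -> T -> 'rV[R]_d,
  (forall n, selLp P p X (c n)) /\
  {ae P, forall w, forall x e, X w x -> 0 < e -> exists n, enorm (x - c n w) < e}.
Proof.
move=> LX; have eX := LpcoFC_effros LX; have [cX _] := eX.
have coX w : @convex_set R 'rV[R]_d (X w) by have [[]] := LpcoFC_coFC w LX.
have [xi0 [Lx0 x0X]] := LpcoFC_sel LX.
have /choice[pi Hpi] (r : 'rV[rat]_d) := exists_proj (ratv r) cX.
have mpi r : mvec (pi r) := mvec_proj eX coX (Hpi r).
pose c (rM : 'rV[rat]_d * nat) w :=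
  if enorm (pi rM.1 w) <= rM.2%:R then pi rM.1 w else xi0 w.
have sc rM : selLp P p X (c rM).
  case: rM => r M; split.
    apply: (@vecLp_le _ _ _ _ _ p p1 _ (fun w => M%:R + enorm (xi0 w))).
    - apply: (@mvec_if _ _ _ _ (fun w => enorm (pi r w) <= M%:R)) => //.
        apply: measurable_fun_ler; first exact: measurable_enorm.
        exact: measurable_cst.
      exact: vecLp_mvec Lx0.
    - apply: LfunD => //; last exact: Lfun_enorm.
      by apply: (@Lfun_bounded _ _ _ _ p _ `|M%:R|) => //; exact: aeW.
    apply: aeW => w; rewrite /c /=; case: ifPn => [h|_]; last by rewrite lerDr.
    by rewrite (le_trans h)// lerDl enorm_ge0.
  apply: filterS2 x0X (LpcoFC_nonempty LX) => w Xx0 X0; rewrite /c /=.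
  by case: ifP => // _; have [/(_ X0)[]] := Hpi r w.
exists (fun n => if unpickle n is Some rM then c rM else xi0); split.
  by move=> n; case: (unpickle n).
apply: filterS (LpcoFC_nonempty LX) => w X0 x e Xx e0.
have [r xr] := ratv_dense x (divr_gt0 e0 (ltr0n R 2)).
(* At this w the truncation level exceeds the norm of the projection, so this index yields the
   projection of r itself. Its distance to r is below e / 2, since x also lies in X w and
   competes. *)
exists (pickle (r, Num.bound (enorm (pi r w)))); rewrite pickleK /c /=.
rewrite ifT; last by rewrite ltW// archi_boundP// enorm_ge0.
have [/(_ X0)[Xpi pimin] _] := Hpi r w.
apply: le_lt_trans (enorm_subD _ (ratv r) _) _.
have : enorm (ratv r - pi r w) <= enorm (x - ratv r).
  by rewrite enorm_subC; apply: ler_wsqrtr; exact: pimin.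
by move=> h; rewrite (splitr e) ltrD// (le_lt_trans h).
Qed.

Lemma selLp_if X (b : T -> bool) xi eta : measurable_fun setT b ->
  selLp P p X xi -> selLp P p X eta -> selLp P p X (fun w => if b w then xi w else eta w).
Proof.
move=> mb [Lx xX] [Le eX]; split; last first.
  by apply: filterS2 xX eX => w Xx Xe; case: (b w).
apply: (@vecLp_le _ _ _ _ _ p p1 _ (fun w => enorm (xi w) + enorm (eta w))).
- by apply: mvec_if => //; [exact: vecLp_mvec Lx|exact: vecLp_mvec Le].
- by apply: LfunD => //; exact: Lfun_enorm.
by apply: aeW => w; case: (b w); rewrite ?lerDl ?lerDr enorm_ge0.
Qed.

(** Selections may be pasted along measurable events. Pasting the dense ones gives selections whose
    products with zeta increase to the support function, and monotone convergence applies once the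
    integrable first product is subtracted. *)
Theorem expect_support_sup X zeta : LpcoFC P p C X -> vecLp P q zeta ->
  expect_support P X zeta = ereal_sup [set (pairing P xi zeta)%:E | xi in selLp P p X].
Proof.
move=> LX Lz; apply/eqP; rewrite eq_le; apply/andP; split; last first.
  apply: ge_ereal_sup => _ [xi sx <-]; exact: (expect_support_ge p1 pq Lz LX sx).
have [c [sc dc]] := dense_selections LX.
have mz : mvec zeta := vecLp_mvec Lz.
pose u xi w := dotv (xi w) (zeta w).
have mu xi : selLp P p X xi -> measurable_fun setT (u xi).
  by move=> [Lx _]; apply: measurable_dotv => //; exact: vecLp_mvec Lx.
(* At each w the recursion keeps whichever of [eta m] and [c m] has the larger product with zeta, so
   [eta n] realises a running maximum. *)
pose eta := fix eta n := if n is m.+1 then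
  fun w => if u (eta m) w < u (c m) w then c m w else eta m w else c 0%N.
have se n : selLp P p X (eta n).
  elim: n => [|n IH] //=; apply: selLp_if => //.
  by apply: measurable_fun_ltr; apply: mu.
have ueta n w : u (eta n.+1) w = Num.max (u (eta n) w) (u (c n) w).
  by rewrite /u /=; case: ltP.
have Iu xi : selLp P p X xi -> integrableR P (u xi).
  by move=> [Lx _]; exact: (pairing_integrable p1 pq Lx Lz).
have nd w : {homo (fun n => u (eta n) w) : m n / (m <= n)%N >-> m <= n}.
  by apply/nondecreasing_seqP => n; rewrite ueta le_max lexx.
set S := ereal_sup _.
pose h w := support_fun (X w) (zeta w).
have mh : measurable_fun setT h by apply: measurable_support => //; exact: LpcoFC_effros LX.
have hge : {ae P, forall w, ((u (eta 0%N) w)%:E <= h w)%E}.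
  by apply: filterS (se 0%N).2 => w; exact: support_fun_ge.
rewrite /expect_support -/h (integral_split mh (Iu _ (se 0%N)) hge).
pose g n w := (u (eta n) w - u (eta 0%N) w)%:E.
have mg n : measurable_fun setT (g n).
  by apply/measurable_EFinP; apply: measurable_funB; apply: mu.
have g0 n w : (0 <= g n w)%E by rewrite lee_fin subr_ge0; exact: nd.
have ndg w : {homo (fun n => g n w) : m n / (m <= n)%N >-> (m <= n)%E}.
  by move=> m n mn; rewrite lee_fin lerB//; exact: nd.
have -> : (\int[P]_w maxe (h w - (u (eta 0%N) w)%:E) 0 = \int[P]_w limn (fun n => g n w))%E.
  apply: ae_eq_integral => //.
  - apply: measurable_maxe; last exact: measurable_cst.
    by apply: emeasurable_funB => //; apply/measurable_EFinP; exact: mu.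
  - by apply: (emeasurable_fun_cvg g) => // w _; apply: ereal_nondecreasing_is_cvgn; exact: ndg.
  have hn : {ae P, forall w, forall n, ((u (eta n) w)%:E <= h w)%E}.
    by apply/ae_foralln => n; apply: filterS (se n).2 => w; exact: support_fun_ge.
  apply: filterS2 hn dc => w hn dc _; rewrite max_l ?sube_ge0//.
  rewrite (cvg_lim _ (ereal_nondecreasing_cvgn (ndg w)))//.
  apply/eqP; rewrite eq_le; apply/andP; split.
    rewrite leeBlDr//; apply/support_fun_leP => x Xx.
    rewrite -leeBlDr//; apply/lee_addgt0Pr => e e0.
    have e1 : 0 < e / (enorm (zeta w) + 1) by rewrite divr_gt0// ltr_wpDl// enorm_ge0.
    have [n xn] := dc x _ Xx e1.
    apply: (@le_trans _ _ (g n.+1 w + e%:E)%E); last first.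
      by apply: leeD => //; apply: ereal_sup_ubound; exists n.+1.
    rewrite /g ueta -EFinB -EFinD lee_fin.
    have h1 : u (c n) w <= Num.max (u (eta n) w) (u (c n) w) by rewrite le_max lexx orbT.
    have h2 : dotv x (zeta w) - u (c n) w <= e.
      rewrite -dotvBl; apply: le_trans (dotv_enorm _ _) _.
      have z0 := enorm_ge0 (zeta w).
      move: xn; rewrite ltr_pdivlMr ?ltr_wpDl// => xn; apply: le_trans (ltW xn).
      by rewrite ler_wpM2l ?enorm_ge0// lerDl.
    by move: h1 h2; set M := Num.max _ _; lra.
  apply: ge_ereal_sup => _ [n _ <-]; rewrite leeBrDr// -EFinD subrK.
  exact: hn.
rewrite monotone_convergence//.
rewrite addeC -leeBrDr//; apply: lime_le.
  apply: ereal_nondecreasing_is_cvgn => m n mn; apply: ge0_le_integral => //.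
  by move=> w _; exact: ndg.
apply: nearW => n; rewrite leeBrDr// integrableR_EFin; last exact: (integrableRB (Iu _ (se n)) (Iu _ (se 0%N))).
rewrite RintegralB//; [|exact: Iu|exact: Iu].
rewrite -EFinD subrK -pairingE; apply: ereal_sup_ubound.
by exists (eta n).
Qed.

End SupOverSelections.

(** * From the cones to the expectation *)

Lemma le_limn_einf (R : realType) (u v : nat -> \bar R) :
  (forall n, (u n <= v n)%E) -> (limn_einf u <= limn_einf v)%E.
Proof.
move=> uv; rewrite !limn_einf_lim; apply: lee_lim; [exact: is_cvg_einfs|exact: is_cvg_einfs|].
apply: nearW => n; apply: le_ereal_inf_tmp => _ [m /= nm <-].
by apply: le_trans (uv m); apply: ereal_inf_lbound; exists m.
Qed.

Lemma limn_einf_cst (R : realType) (a : \bar R) : limn_einf (fun=> a) = a.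
Proof. by have [] := @cvg_limn_einf_sup R (fun=> a) a (cvg_cst a). Qed.

Lemma ereal_supDr (R : realType) (I : Type) (A : set I) (f : I -> \bar R) (c : R) :
  ereal_sup [set (f i + c%:E)%E | i in A] = (ereal_sup [set f i | i in A] + c%:E)%E.
Proof.
apply/eqP; rewrite eq_le; apply/andP; split.
  by apply: ge_ereal_sup => _ [i Ai <-]; rewrite leeD2r// ereal_sup_ubound//; exists i.
rewrite -leeBrDr//; apply: ge_ereal_sup => _ [i Ai <-]; rewrite leeBrDr//.
by apply: ereal_sup_ubound; exists i.
Qed.

Lemma ereal_sup_scale (R : realType) (I : Type) (A : set I) (f : I -> \bar R) (c : R) :
  0 < c -> ereal_sup [set (c%:E * f i)%E | i in A] = (c%:E * ereal_sup [set f i | i in A])%E.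
Proof.
move=> c0; apply/eqP; rewrite eq_le; apply/andP; split.
  by apply: ge_ereal_sup => _ [i Ai <-]; rewrite lee_pmul2l// ereal_sup_ubound//; exists i.
rewrite -lee_pdivlMl//; apply: ge_ereal_sup => _ [i Ai <-]; rewrite lee_pdivlMl//.
by apply: ereal_sup_ubound; exists i.
Qed.

Section Backward.
Context {R : realType} {disp : measure_display} {T : measurableType disp}.
Context (P : probability T R) {d : nat}.
Variables (p q : \bar R) (C : set 'rV[R]_d).
Variable E : (T -> set 'rV[R]_d) -> set 'rV[R]_d.
Variable Z : 'rV[R]_d -> set (T -> 'rV[R]_d).
Hypotheses (p1 : (1 <= p)%E) (pq : (p^-1 + q^-1 = 1)%E).
Hypotheses (C_closed : closed C) (C_convex : @convex_set R 'rV[R]_d C).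
Hypothesis C_cone : cone C.
Hypothesis coE : forall X, LpcoFC P p C X -> coF (E X).
Hypotheses (HZ : cone_family P p q C Z) (dual : dual_representation P p C E Z).
Implicit Types (X Y : T -> set 'rV[R]_d) (xi zeta : T -> 'rV[R]_d) (F : set 'rV[R]_d).

Local Notation LC := (LpcoFC P p C).
Local Notation G := (polar_cone C).
Let q1 : (1 <= q)%E := conjugate_ge1 p1 pq.

Definition Zat u : set (T -> 'rV[R]_d) := [set zeta | Z u zeta /\ expect_vec P zeta = u].

Let Zat_sel u zeta : G u -> Zat u zeta -> selLp P q (fun=> G) zeta.
Proof. by move=> Gu [Zz _]; exact: (cf_sub HZ Gu Zz). Qed.

(** Keeps the supremum of the representation off -oo; for nonzero u it is the value t = 1 in
    [cf_expect]. *)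
Let Zat_nonempty u : G u -> exists zeta, Zat u zeta.
Proof.
move=> Gu; have [->|u0] := eqVneq u 0.
  exists (fun=> 0); split; last exact: expect_vec0.
  by rewrite (cf_zero HZ); split; [exact: vecLp0|exact: aeW].
have : [set t *: u | t in [set t : R | 0 <= t]] u by exists 1; rewrite //= scale1r.
by rewrite -(cf_expect HZ Gu u0) => -[zeta Zz Ez]; exists zeta.
Qed.

Let support_polar X u : LC X -> G u ->
  support_fun (E X) u = ereal_sup [set expect_support P X zeta | zeta in Zat u].
Proof. by move=> LX Gu; have [_ ->] := dual LX. Qed.

Let support_nonpolar X u : LC X -> ~ G u -> support_fun (E X) u = +oo%E.
Proof. by move=> LX nGu; have [->] := dual LX. Qed.

Let subE X Y : LC X -> LC Y -> (forall zeta, selLp P q (fun=> G) zeta ->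
    (expect_support P X zeta <= expect_support P Y zeta)%E) -> E X `<=` E Y.
Proof.
move=> LX LY XY; apply: sub_support; first exact: coE.
move=> u; have [Gu|nGu] := pselect (G u); last by rewrite (support_nonpolar LY)// leey.
rewrite !support_polar//; apply: ge_ereal_sup => _ [zeta Zz <-].
apply: le_trans (XY _ (Zat_sel Gu Zz)) _.
by apply: ereal_sup_ubound; exists zeta.
Qed.

Let E_nonempty X : LC X -> E X !=set0.
Proof.
move=> LX; apply: (@support_funN0 _ _ _ 0).
have [zeta Zz] := Zat_nonempty (polar_cone0 C).
rewrite (support_polar LX (polar_cone0 C)).
apply: (@lt_le_trans _ _ (expect_support P X zeta)); last first.
  by apply: ereal_sup_ubound; exists zeta.
apply: (expect_support_gtNy p1 pq) LX.
exact: (Zat_sel (polar_cone0 C) Zz).1.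
Qed.

Let E_translation X (a : 'rV[R]_d) : LC X ->
  E (fun w => [set x + a | x in X w]) = [set x + a | x in E X].
Proof.
move=> LX; have La : vecLp P p (fun=> a) by exact: vecLp_cst.
have LXa := LpcoFC_translate p1 C_cone LX La.
apply: eq_support; [exact: coE|apply: coF_translate; exact: coE|move=> u].
rewrite support_translate; have [Gu|nGu] := pselect (G u); last first.
  by rewrite !support_nonpolar.
rewrite !support_polar// -ereal_supDr; congr ereal_sup; apply: eq_imagel => zeta Zz.
have [Lz _] := Zat_sel Gu Zz.
by rewrite (expect_support_translate p1 pq Lz LX La) (pairing_cst p1 pq)// Zz.2.
Qed.

Let E_homogeneous X (c : R) : LC X -> 0 < c ->
  E (fun w => [set c *: x | x in X w]) = [set c *: x | x in E X].
Proof.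
move=> LX c0; have LXc := LpcoFC_scale p1 C_cone c0 LX.
apply: eq_support; [exact: coE|apply: coF_scale => //; exact: coE|move=> u].
rewrite support_scale//; have [Gu|nGu] := pselect (G u); last first.
  by rewrite !support_nonpolar// gt0_muley.
rewrite !support_polar// -ereal_sup_scale//; congr ereal_sup; apply: eq_imagel => zeta Zz.
have [Lz _] := Zat_sel Gu Zz.
exact: (expect_support_scale p1 pq Lz c0 LX).
Qed.

Let E_deterministic F : coFC C F -> F !=set0 -> F `<=` E (fun=> F).
Proof.
move=> cF F0; have LF := LpcoFC_cst P p1 cF F0.
apply: sub_support; first exact: coE.
move=> u; have [Gu|nGu] := pselect (G u); last by rewrite support_nonpolar// leey.
rewrite support_polar//; have [zeta Zz] := Zat_nonempty Gu.
have [Lz _] := Zat_sel Gu Zz.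
apply/support_fun_leP => x Fx; apply: (@le_trans _ _ (expect_support P (fun=> F) zeta)).
  by rewrite -Zz.2 -(pairing_cst p1 pq _ Lz); exact: (expect_support_ge p1 pq Lz LF (selLp_cst P p1 Fx)).
by apply: ereal_sup_ubound; exists zeta.
Qed.

Let E_monotone X Y : LC X -> LC Y -> {ae P, forall w, X w `<=` Y w} -> E X `<=` E Y.
Proof.
by move=> LX LY XY; apply: subE => // zeta [Lz _]; exact: (expect_support_le p1 pq Lz LX LY XY).
Qed.

Let E_subadditive X Y : LC X -> LC Y ->
  E (fun w => closed_sum (X w) (Y w)) `<=` closed_sum (E X) (E Y).
Proof.
move=> LX LY; have LXY := LpcoFC_sum p1 C_cone LX LY.
apply: sub_support; first by apply: coF_closed_sum; exact: coE.
move=> u; rewrite support_closed_sum; [|exact: E_nonempty|exact: E_nonempty].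
have [Gu|nGu] := pselect (G u); last by rewrite !support_nonpolar.
rewrite !support_polar//; apply: ge_ereal_sup => _ [zeta Zz <-].
have [Lz _] := Zat_sel Gu Zz.
rewrite (expect_support_sum p1 pq C_cone Lz LX LY).
by apply: leeD; apply: ereal_sup_ubound; exists zeta.
Qed.

Let E_normalised : normalised C E.
Proof.
have LCC := LpcoFC_cone P p1 C_closed C_convex C_cone.
apply: eq_support; [exact: coE|by []|move=> u].
have [Gu|nGu] := pselect (G u); last by rewrite support_nonpolar// support_cone_pinfty.
rewrite support_polar// support_cone//.
have H zeta : Zat u zeta -> expect_support P (fun=> C) zeta = 0%E.
  by move=> /(Zat_sel Gu) sz; have [Lz _] := sz; exact: (expect_support_cone p1 C_closed C_convex C_cone Lz).
apply/eqP; rewrite eq_le; apply/andP; split.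
  by apply: ge_ereal_sup => _ [zeta /H -> <-].
have [zeta Zz] := Zat_nonempty Gu; rewrite -(H _ Zz).
by apply: ereal_sup_ubound; exists zeta.
Qed.

(** An interchange of suprema: [expect_support_sup] writes E h(X, zeta) as a supremum over xi, and
    each pairing is the expected support function of xi + C. *)
Let E_minimal : minimal P p C E.
Proof.
move=> X LX; have [xi0 sx0] := LpcoFC_sel LX.
have LP xi : selLp P p X xi -> LC (addC C xi).
  by move=> [Lx _]; exact: LpcoFC_point.
apply: eq_support; [exact: coE|exact: coF_hull|move=> u].
rewrite support_hull; apply/eqP; rewrite eq_le; apply/andP; split; last first.
  apply: support_funS => x [xi sx]; apply: E_monotone => //; first exact: LP.
  exact: (sel_addC_sub C_cone LX sx).
set U := \bigcup_(_ in _) _.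
have HU xi : selLp P p X xi -> (support_fun (E (addC C xi)) u <= support_fun U u)%E.
  by move=> sx; apply: support_funS => x Ex; exists xi.
have [Gu|nGu] := pselect (G u); last first.
  by apply: le_trans (HU _ sx0); rewrite (support_nonpolar (LP _ sx0))// leey.
rewrite support_polar//; apply: ge_ereal_sup => _ [zeta Zz <-].
have sz := Zat_sel Gu Zz; have [Lz _] := sz.
rewrite (expect_support_sup p1 pq LX Lz); apply: ge_ereal_sup => _ [xi sx <-].
apply: le_trans (HU _ sx); rewrite support_polar//; last exact: LP.
rewrite -(expect_support_point p1 pq C_closed C_convex C_cone Lz sz sx.1).
by apply: ereal_sup_ubound; exists zeta.
Qed.

(** For u in G the support function is a supremum of functionals that converge along the sequence by
    the very definition of scalar convergence. *)
Let E_lsc : scalarly_lsc P p q C E.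
Proof.
move=> X_ X LX_ LX cX u; have [Gu|nGu] := pselect (G u); last first.
  under eq_fun do rewrite support_nonpolar//.
  by rewrite support_nonpolar// limn_einf_cst.
rewrite support_polar//; apply: ge_ereal_sup => _ [zeta Zz <-].
have [<- _] := cvg_limn_einf_sup (cX _ (Zat_sel Gu Zz)).
apply: le_limn_einf => n; rewrite support_polar//.
by apply: ereal_sup_ubound; exists zeta.
Qed.

Lemma dual_representation_sufficient :
  [/\ sublinear_expectation P p C E, normalised C E, minimal P p C E & scalarly_lsc P p q C E].
Proof.
split=> //; split=> //.
by move=> X LX; split; [exact: coE|exact: E_nonempty].
Qed.

End Backward.

(** * The Hahn-Banach and Riesz theorems *)

Lemma inf_le_add (R : realType) (A B D : set R) : has_lbound A -> B !=set0 -> D !=set0 ->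
  (forall b c, B b -> D c -> exists2 a, A a & a <= b + c) -> inf A <= inf B + inf D.
Proof.
move=> lA B0 D0 h; rewrite -lerBlDr; apply: lb_le_inf => // b Bb.
rewrite lerBlDr -lerBlDl; apply: lb_le_inf => // c Dc; rewrite lerBlDl.
by have [a Aa ab] := h b c Bb Dc; exact: le_trans (ge_inf lA Aa) ab.
Qed.

Lemma inf_le_scale (R : realType) (A B : set R) (c : R) : 0 < c -> has_lbound A -> B !=set0 ->
  (forall b, B b -> exists2 a, A a & a <= c * b) -> inf A <= c * inf B.
Proof.
move=> c0 lA B0 h; rewrite mulrC -ler_pdivrMr//; apply: lb_le_inf => // b Bb.
rewrite ler_pdivrMr// mulrC; have [a Aa ab] := h b Bb.
exact: le_trans (ge_inf lA Aa) ab.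
Qed.

Section HahnBanach.
Context {R : realType} {V : lmodType R} (W : set V).
Hypotheses (W0 : W 0) (WD : forall x y, W x -> W y -> W (x + y)).
Hypothesis WZ : forall c x, W x -> W (c *: x).
Implicit Types (x y : V) (g h : V -> R).

Definition sublinear_on h := (forall x y, W x -> W y -> h (x + y) <= h x + h y) /\
  (forall c x, 0 < c -> W x -> h (c *: x) <= c * h x).

Definition linear_on h := (forall x y, W x -> W y -> h (x + y) = h x + h y) /\
  (forall c x, W x -> h (c *: x) = c * h x).

Let WN x : W x -> W (- x).
Proof. by move=> Wx; rewrite -scaleN1r; exact: WZ. Qed.

Lemma sublinear_onZ h c x : sublinear_on h -> 0 < c -> W x -> h (c *: x) = c * h x.
Proof.
move=> [_ hZ] c0 Wx; apply/eqP; rewrite eq_le hZ//=.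
have := hZ c^-1 (c *: x); rewrite invr_gt0 scalerA mulVf ?gt_eqF// scale1r => /(_ c0 (WZ _ Wx)).
by rewrite mulrC ler_pdivlMr// mulrC.
Qed.

Lemma sublinear_on0 h : sublinear_on h -> h 0 = 0.
Proof.
by move=> hs; have := sublinear_onZ hs (ltr0n R 2) W0; rewrite scaler0; lra.
Qed.

Lemma sublinear_on_ge h x : sublinear_on h -> W x -> - h (- x) <= h x.
Proof.
move=> hs Wx; have := hs.1 _ _ Wx (WN Wx); rewrite subrr sublinear_on0//; lra.
Qed.

(** Lowers h as far as the ray of x allows: the result is sublinear and below h, and its value at -x
    is at most -h x. A minimal sublinear h cannot be lowered, hence is odd, hence additive. *)
Definition directional h x y := inf [set h (y + t *: x) - t * h x | t in [set t : R | 0 <= t]].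

Lemma directional_lb h x y : sublinear_on h -> W x -> W y ->
  lbound [set h (y + t *: x) - t * h x | t in [set t : R | 0 <= t]] (- h (- y)).
Proof.
move=> hs Wx Wy _ [t /= t0 <-].
have := hs.1 (y + t *: x) (- y) (WD Wy (WZ t Wx)) (WN Wy).
rewrite addrAC subrr add0r.
move: t0; rewrite [0 <= t]le_eqVlt => /predU1P[<-|t0].
  by rewrite scale0r addr0 mul0r sublinear_on0// subr0; lra.
by rewrite (sublinear_onZ hs t0 Wx); lra.
Qed.

Lemma directional_le h x y t : sublinear_on h -> W x -> W y -> 0 <= t ->
  directional h x y <= h (y + t *: x) - t * h x.
Proof.
move=> hs Wx Wy t0; apply: ge_inf; last by exists t.
by exists (- h (- y)); exact: directional_lb.
Qed.

Lemma directional_le_id h x y : sublinear_on h -> W x -> W y -> directional h x y <= h y.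
Proof.
move=> hs Wx Wy; have := directional_le hs Wx Wy (lexx 0).
by rewrite scale0r addr0 mul0r subr0.
Qed.

Lemma directional_opp h x : sublinear_on h -> W x -> directional h x (- x) <= - h x.
Proof.
move=> hs Wx; have := directional_le hs Wx (WN Wx) ler01.
by rewrite scale1r addNr mul1r sublinear_on0// sub0r.
Qed.

Lemma directional_sublinear h x : sublinear_on h -> W x -> sublinear_on (directional h x).
Proof.
move=> hs Wx.
have S0 y : [set h (y + t *: x) - t * h x | t in [set t : R | 0 <= t]] !=set0.
  by exists (h (y + 0 *: x) - 0 * h x); exists 0 => //=.
split=> [y z Wy Wz|c y c0 Wy].
  apply: inf_le_add; [|exact: S0|exact: S0|].
    by exists (- h (- (y + z))); apply: directional_lb => //; exact: WD.
  move=> _ _ [t /= t0 <-] [s /= s0 <-].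
  exists (h (y + z + (t + s) *: x) - (t + s) * h x); first by exists (t + s) => //=; exact: addr_ge0.
  have := hs.1 (y + t *: x) (z + s *: x) (WD Wy (WZ t Wx)) (WD Wz (WZ s Wx)).
  by rewrite addrACA -scalerDl; lra.
apply: inf_le_scale => //.
  by exists (- h (- (c *: y))); apply: directional_lb => //; exact: WZ.
move=> _ [t /= t0 <-].
exists (h (c *: y + (c * t) *: x) - (c * t) * h x).
  by exists (c * t) => //=; rewrite mulr_ge0// ltW.
rewrite -scalerA -scalerDr; have := hs.2 c (y + t *: x) c0 (WD Wy (WZ t Wx)).
by rewrite mulrBr mulrA; lra.
Qed.

Lemma minimal_sublinear_linear h : sublinear_on h ->
  (forall k, sublinear_on k -> (forall x, W x -> k x <= h x) -> forall x, W x -> h x <= k x) ->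
  linear_on h.
Proof.
move=> hs hmin.
have hN x : W x -> h (- x) = - h x.
  move=> Wx; apply/eqP; rewrite eq_le; apply/andP; split; last first.
    by rewrite lerNl; exact: sublinear_on_ge.
  apply: le_trans (directional_opp hs Wx).
  apply: hmin; [exact: directional_sublinear| |exact: WN].
  by move=> y Wy; exact: directional_le_id.
split=> [x y Wx Wy|c x Wx].
  apply/eqP; rewrite eq_le hs.1//=.
  have := hs.1 (x + y) (- y) (WD Wx Wy) (WN Wy); rewrite addrK hN//; lra.
have [c0|c0|->] := ltgtP c 0; last by rewrite scale0r mul0r sublinear_on0.
- rewrite -(opprK c) scaleNr hN; last exact: WZ.
  by rewrite (sublinear_onZ hs _ Wx) ?oppr_gt0// -mulNr.
- exact: sublinear_onZ.
Qed.

Theorem exists_minimal_sublinear g : sublinear_on g -> exists h, [/\ sublinear_on h,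
  (forall x, W x -> h x <= g x) &
  (forall k, sublinear_on k -> (forall x, W x -> k x <= h x) -> forall x, W x -> h x <= k x)].
Proof.
move=> gs; pose S := {h : V -> R | sublinear_on h /\ forall x, W x -> h x <= g x}.
have gS : sublinear_on g /\ forall x, W x -> g x <= g x by [].
(* The order is reversed, so that Zorn's lemma yields a minimal functional. The bound of a chain is
   its pointwise infimum: finite because every member is at least -g (- x), and subadditive because
   any two members are comparable. *)
pose rel (h k : S) := `[< forall x, W x -> sval k x <= sval h x >].
have [|h k l /asboolP hk /asboolP kl|A Atot|[h [hs hg]] hmin] := @ZL_preorder S (exist _ g gS) rel.
- by move=> h; apply/asboolP.
- by apply/asboolP => x Wx; exact: le_trans (kl x Wx) (hk x Wx).
- have [A0|A0] := pselect (A !=set0); last first.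
    by exists (exist _ g gS) => s As; exfalso; apply: A0; exists s.
  have [h0 Ah0] := A0.
  pose Ax x := [set sval h x | h in A].
  have Ax0 x : Ax x !=set0 by exists (sval h0 x); exists h0.
  have lb x : W x -> has_lbound (Ax x).
    move=> Wx; exists (- g (- x)) => _ [h Ah <-].
    apply: le_trans (sublinear_on_ge (svalP h).1 Wx); rewrite lerN2.
    exact: (svalP h).2 (WN Wx).
  pose k x := inf (Ax x).
  have kS : sublinear_on k /\ forall x, W x -> k x <= g x.
    split; last first.
      move=> x Wx; apply: le_trans ((svalP h0).2 x Wx).
      by apply: ge_inf; [exact: lb|exists h0].
    split=> [x y Wx Wy|c x c0 Wx].
      apply: inf_le_add => //; first exact/lb/WD.
      move=> _ _ [h1 Ah1 <-] [h2 Ah2 <-].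
      have [/asboolP h12|/asboolP h21] := Atot _ _ Ah1 Ah2.
        exists (sval h2 (x + y)); first by exists h2.
        by apply: le_trans ((svalP h2).1.1 _ _ Wx Wy) _; rewrite lerD2r; exact: h12.
      exists (sval h1 (x + y)); first by exists h1.
      by apply: le_trans ((svalP h1).1.1 _ _ Wx Wy) _; rewrite lerD2l; exact: h21.
    apply: inf_le_scale => //; first exact/lb/WZ.
    move=> _ [h Ah <-]; exists (sval h (c *: x)); first by exists h.
    exact: (svalP h).1.2.
  exists (exist _ k kS) => h Ah; apply/asboolP => x Wx /=.
  by apply: ge_inf; [exact: lb|exists h].
exists h; split => // k ks kh x Wx.
have kS : sublinear_on k /\ forall x, W x -> k x <= g x.
  by split=> // y Wy; exact: le_trans (kh y Wy) (hg y Wy).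
have /asboolP := hmin (exist _ k kS) ltac:(by apply/asboolP).
by apply.
Qed.

(** Minimising below [directional g x0] rather than below g gives f (- x0) <= - g x0, which is what
    forces equality at x0. *)
Theorem hahn_banach g x0 : sublinear_on g -> W x0 ->
  exists f, [/\ linear_on f, (forall x, W x -> f x <= g x) & f x0 = g x0].
Proof.
move=> gs Wx0; have [h [hs hg hmin]] := exists_minimal_sublinear (directional_sublinear gs Wx0).
have hle x : W x -> h x <= g x.
  by move=> Wx; apply: le_trans (hg x Wx) _; exact: directional_le_id.
have hlin := minimal_sublinear_linear hs hmin.
exists h; split => //; apply/eqP; rewrite eq_le hle//=.
have := le_trans (hg _ (WN Wx0)) (directional_opp gs Wx0).
by rewrite -scaleN1r hlin.2// mulN1r lerN2.
Qed.

End HahnBanach.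

(** * Dominated convergence and the converse of Hoelder's inequality *)

Section ConverseHoelder.
Context {R : realType} {disp : measure_display} {T : measurableType disp}.
Context (P : probability T R).
Implicit Types (h z : T -> R).

Lemma dominated_cvg_Rintegral (h_ : nat -> T -> R) h g :
  (forall n, measurable_fun setT (h_ n)) -> measurable_fun setT h -> integrableR P g ->
  (forall n, {ae P, forall w, `|h_ n w| <= g w}) ->
  {ae P, forall w, h_ n w @[n --> \oo] --> h w} ->
  \int[P]_w h_ n w @[n --> \oo] --> \int[P]_w h w.
Proof.
move=> mh_ mh Ig hg hcv.
have Ih_ n : integrableR P (h_ n) by exact: (integrableR_le_ae (mh_ n) Ig (hg n)).
have hcv' : {ae P, forall w, setT w -> (EFin \o h_ n) w @[n --> \oo] --> (EFin \o h) w}.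
  by apply: filterS hcv => w hw _; apply/cvg_EFin => //; exact: nearW.
have hg' : {ae P, forall w n, setT w -> (`|(EFin \o h_ n) w| <= (EFin \o g) w)%E}.
  have := @ae_foralln _ _ _ P _ hg; apply: filterS => w hw n _.
  by rewrite /= lee_fin.
have [If _ H] := dominated_convergence measurableT
  (fun n => (measurable_EFinP _ _).2 (mh_ n)) ((measurable_EFinP _ _).2 mh) hcv' Ig hg'.
by apply: fine_cvg; rewrite -integrableR_EFin.
Qed.

Lemma ae_zero_Rintegral h : integrableR P h -> (forall w, 0 <= h w) -> \int[P]_w h w <= 0 ->
  {ae P, forall w, h w = 0}.
Proof.
move=> Ih h0 hle; have mh := integrableR_measurable Ih.
have : (\int[P]_w `|(h w)%:E| = 0)%E.
  under eq_integral do rewrite gee0_abs ?lee_fin//.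
  rewrite integrableR_EFin//; congr EFin; apply/eqP; rewrite eq_le hle.
  exact: Rintegral_ge0.
move=> /(ae_eq_integral_abs P measurableT ((measurable_EFinP _ _).2 mh)).
by apply: filterS => w /(_ I) [].
Qed.

(** The value at 0 is 1, so that the absolute value is 1 everywhere. *)
Definition sgn1 (x : R) : R := if 0 <= x then 1 else -1.

Lemma norm_sgn1 x : `|sgn1 x| = 1.
Proof. by rewrite /sgn1; case: ifP => _; rewrite ?normrN normr1. Qed.

Lemma sgn1_mul x : sgn1 x * x = `|x|.
Proof.
rewrite /sgn1; case: ifPn => [x0|]; first by rewrite mul1r ger0_norm.
by rewrite -ltNge => x0; rewrite mulN1r ltr0_norm.
Qed.

Lemma measurable_sgn1 z : measurable_fun setT z -> measurable_fun setT (fun w => sgn1 (z w)).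
Proof.
move=> mz; rewrite /sgn1; apply: measurable_fun_ifT => //.
by apply: measurable_fun_ler.
Qed.

(** The test function is the sign of z on the event |z| > K: if that event had positive mass, the
    integral of |z| over it would exceed K times its mass. *)
Lemma converse_hoelder1 z (K : R) : 0 <= K -> integrableR P z ->
  (forall h (M : R), measurable_fun setT h -> (forall w, `|h w| <= M) ->
    \int[P]_w (h w * z w) <= K * nrm P 1 h) ->
  {ae P, forall w, `|z w| <= K}.
Proof.
move=> K0 Iz H; have mz := integrableR_measurable Iz.
pose b w := K < `|z w|.
have mb : measurable_fun setT b.
  by apply: measurable_fun_ltr; [exact: measurable_cst|exact: measurableT_comp].
pose i w : R := if b w then 1 else 0.
have mi : measurable_fun setT i by exact: measurable_fun_ifT.
have mh : measurable_fun setT (fun w => sgn1 (z w) * i w).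
  by apply: measurable_funM => //; exact: measurable_sgn1.
have i1 w : `|i w| <= 1 by rewrite /i; case: (b w); rewrite ?normr1 ?normr0.
have h1 w : `|sgn1 (z w) * i w| <= 1 by rewrite normrM norm_sgn1 mul1r.
have Ii : integrableR P i.
  apply: (integrableR_le_ae mi (integrableR_cst P 1)); exact: aeW.
have Iiz : integrableR P (fun w => i w * `|z w|).
  apply: (integrableR_le_ae _ (integrableR_norm Iz)).
    by apply: measurable_funM => //; exact: measurableT_comp.
  by apply: aeW => w; rewrite normrM normr_id ler_piMl.
have nh : nrm P 1 (fun w => sgn1 (z w) * i w) = \int[P]_w i w.
  rewrite /nrm Lnorm1; congr fine; apply: eq_integral => w _ /=.
  by rewrite normrM norm_sgn1 mul1r /i; case: (b w); rewrite ?normr1 ?normr0.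
have := H _ _ mh h1; rewrite nh.
under eq_Rintegral do rewrite mulrAC sgn1_mul mulrC.
move=> le0.
have /ae_zero_Rintegral : integrableR P (fun w => i w * `|z w| - K * i w).
  by apply: integrableRB => //; exact: integrableRZ.
have i0 w : 0 <= i w * `|z w| - K * i w.
  by rewrite /i /b; case: ltP => [/ltW|_]; rewrite ?mul1r ?mulr1 ?mul0r ?mulr0 subr_ge0.
rewrite RintegralB//; last exact: integrableRZ.
rewrite RintegralZl// subr_le0 => /(_ i0 le0).
apply: filterS => w; rewrite /i /b; case: ltP => // Kz.
by rewrite mul1r mulr1 => /eqP; rewrite subr_eq0 => /eqP zK; rewrite zK ltxx in Kz.
Qed.

(** Test with the sign of z times |z|^(s-1), cut off at |z| <= n. If a is the integral of |z|^s over
    that event, then (s-1) r = s turns the hypothesis into a <= K a^(1/r), so a <= K^s uniformly in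
    n. *)
Lemma converse_hoelder_power z (K r s : R) : 1 < r -> 0 < s -> r^-1 + s^-1 = 1 ->
  0 <= K -> integrableR P z ->
  (forall h (M : R), measurable_fun setT h -> (forall w, `|h w| <= M) ->
    \int[P]_w (h w * z w) <= K * nrm P r%:E h) ->
  finite_norm P s%:E z.
Proof.
move=> r1 s0 rs K0 Iz H; have mz := integrableR_measurable Iz.
have r0 : 0 < r by exact: lt_trans r1.
have s1 : 0 <= s - 1.
  have : s^-1 <= 1 by rewrite -rs lerDr invr_ge0 ltW.
  by rewrite invf_le1// subr_ge0.
have srs : (s - 1) * r = s.
  have : s + r = s * r.
    have : (r^-1 + s^-1) * (s * r) = s * r by rewrite rs mul1r.
    by move=> <-; field; rewrite !gt_eqF.
  by move=> h; rewrite mulrBl mul1r -h addrK.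
have mpow t : measurable_fun setT (fun w => `|z w| `^ t).
  apply: (@measurableT_comp _ _ _ _ _ _ (@powR R ^~ t)) => //.
  exact: measurableT_comp.
pose c n w : R := if `|z w| <= n%:R then 1 else 0.
have mc n : measurable_fun setT (c n).
  rewrite /c; apply: measurable_fun_ifT => //.
  by apply: measurable_fun_ler; [exact: measurableT_comp|exact: measurable_cst].
pose b n w := c n w * `|z w| `^ s.
have b0 n w : 0 <= b n w by rewrite mulr_ge0 ?powR_ge0// /c; case: ifP.
have pown n t w : 0 <= t -> c n w * `|z w| `^ t <= n%:R `^ t.
  move=> t0; rewrite /c; case: ifPn => zn; last by rewrite mul0r powR_ge0.
  by rewrite mul1r ge0_ler_powR// nnegrE.
have mb n : measurable_fun setT (b n) by exact: measurable_funM.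
have Ib n : integrableR P (b n).
  apply: (integrableR_le_ae (mb n) (integrableR_cst P (n%:R `^ s))).
  by apply: aeW => w; rewrite ger0_norm// pown// ltW.
pose h n w := sgn1 (z w) * (c n w * `|z w| `^ (s - 1)).
have mh n : measurable_fun setT (h n).
  apply: measurable_funM; first exact: measurable_sgn1.
  exact: measurable_funM.
have hn n w : `|h n w| <= n%:R `^ (s - 1).
  rewrite normrM norm_sgn1 mul1r ger0_norm; first exact: pown.
  by rewrite mulr_ge0 ?powR_ge0// /c; case: ifP.
have hz n : \int[P]_w (h n w * z w) = \int[P]_w b n w.
  apply: eq_Rintegral => w _; rewrite /h /b mulrAC sgn1_mul mulrCA; congr (_ * _).
  by rewrite mulr_powRB1.
have nh n : nrm P r%:E (h n) = (\int[P]_w b n w) `^ r^-1.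
  rewrite /nrm unlock fine_poweR; congr (_ `^ _); congr fine.
  apply: eq_integral => w _; rewrite poweR_EFin; congr EFin.
  rewrite normrM norm_sgn1 mul1r /b /c; case: ifPn => _.
    by rewrite !mul1r ger0_norm ?powR_ge0// -powRrM srs.
  by rewrite !mul0r normr0 powR0// gt_eqF.
have bK n : \int[P]_w b n w <= K `^ s.
  have := H _ _ (mh n) (hn n); rewrite hz nh.
  have : 0 <= \int[P]_w b n w by apply: Rintegral_ge0.
  move: (\int[P]_w b n w) => a; rewrite le_eqVlt => /predU1P[<- _|a0 aK].
    exact: powR_ge0.
  have aK' : a `^ s^-1 <= K.
    rewrite -(ler_pM2r (powR_gt0 r^-1 a0)) -powRD; last by apply/implyP => _; rewrite gt_eqF.
    by rewrite addrC rs powRr1// ltW.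
  rewrite -[leLHS]powRr1 ?(ltW a0)// -[X in a `^ X](mulVf (lt0r_neq0 s0)) powRrM.
  by rewrite ge0_ler_powR ?nnegrE ?powR_ge0// ltW.
rewrite /finite_norm unlock; apply: poweR_lty.
apply: (@le_lt_trans _ _ (K `^ s)%:E); last exact: ltry.
have -> : (\int[P]_w (`|(EFin \o z) w| `^ s) = \int[P]_w limn (fun n => (b n w)%:E))%E.
  apply: eq_integral => w _; apply/esym/cvg_lim => //.
  apply: cvg_near_cst; exists (Num.bound `|z w|) => // n /= zn.
  rewrite /b /c ifT ?mul1r ?poweR_EFin//.
  by apply: le_trans (ltW (archi_boundP _)) _ => //; rewrite ler_nat.
have nd w : {homo (fun n => (b n w)%:E) : m n / (m <= n)%N >-> (m <= n)%E}.
  move=> m n mn; rewrite lee_fin ler_wpM2r ?powR_ge0// /c.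
  case: ifPn => // zm; last by case: ifP.
  by rewrite ifT// (le_trans zm)// ler_nat.
have mbE n : measurable_fun setT (fun w => (b n w)%:E) by exact/measurable_EFinP.
rewrite monotone_convergence//; last by move=> n w _; rewrite lee_fin.
apply: lime_le.
  apply: ereal_nondecreasing_is_cvgn => m n mn; apply: ge0_le_integral => //.
  - by move=> w _; rewrite lee_fin.
  - by move=> w _; exact: nd.
by apply: nearW => n; rewrite integrableR_EFin// lee_fin.
Qed.

Lemma converse_hoelder z (K : R) (p q : \bar R) : (1 <= p)%E -> (p^-1 + q^-1 = 1)%E -> p != +oo%E ->
  0 <= K -> integrableR P z ->
  (forall h (M : R), measurable_fun setT h -> (forall w, `|h w| <= M) ->
    \int[P]_w (h w * z w) <= K * nrm P p h) ->
  z \in Lfun P q.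
Proof.
move=> p1 pq poo K0 Iz H; have mz := integrableR_measurable Iz.
have q1 := conjugate_ge1 p1 pq.
case: p p1 pq poo H => [r|//|//]; rewrite lee_fin => r1 pq _ H.
have r0 : 0 < r by exact: lt_le_trans r1.
move: r1; rewrite le_eqVlt => /predU1P[r1|r1].
  suff -> : q = +oo%E.
    by apply/LfunyP; split => //; exists K; apply: converse_hoelder1 => //; rewrite -r1 in H.
  move: pq; rewrite -r1 inve1; case: q q1 => [s s1|//|//].
  rewrite inver; case: eqP => [s0|_ []]; first by move: s1; rewrite s0 lee_fin ler10.
  rewrite lee_fin in s1.
  move=> h; have /eqP : s^-1 = 0 by lra.
  rewrite invr_eq0 => /eqP s0.
  by rewrite s0 ler10 in s1.
case: q q1 pq => [s|_|//].
  rewrite lee_fin => s1; have s0 : 0 < s by exact: lt_le_trans s1.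
  rewrite !inver !gt_eqF// => -[rs].
  by apply: LfunI => //; exact: (converse_hoelder_power r1 s0 rs K0 Iz).
rewrite inver gt_eqF// invey adde0 => -[/eqP]; rewrite invr_eq1 => /eqP r1'.
by rewrite r1' ltxx in r1.
Qed.

End ConverseHoelder.

Section Seminorm.
Context {R : realType} {disp : measure_display} {T : measurableType disp}.
Context (P : probability T R) {d : nat} (p : \bar R).
Implicit Types (xi eta zeta : T -> 'rV[R]_d) (A : nat -> set T).

(* On L^p, p finite, this is the norm; on L^oo it is a weaker seminorm whose dual lies in L^1 *)
Record continuous_seminorm (N : (T -> 'rV[R]_d) -> R) : Prop := ContinuousSeminorm {
  cs_add : forall xi eta, vecLp P p xi -> vecLp P p eta ->
    N (fun w => xi w + eta w) <= N xi + N eta ;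
  cs_scale : forall c xi, vecLp P p xi -> N (fun w => c *: xi w) = `|c| * N xi ;
  cs_solid : forall xi eta, mvec xi -> vecLp P p eta ->
    {ae P, forall w, enorm (xi w) <= enorm (eta w)} -> N xi <= N eta ;
  cs_ocont : forall xi A, vecLp P p xi -> (forall n, measurable (A n)) ->
    {ae P, forall w, exists n0, forall n, (n0 <= n)%N -> ~ A n w} ->
    N (fun w => \1_(A n) w *: xi w) @[n --> \oo] --> 0 ;
  cs_bound : p != +oo%E -> exists2 K, 0 <= K & forall (f : T -> R) x,
    f \in Lfun P p -> N (fun w => f w *: x) <= K * enorm x * nrm P p f
}.

End Seminorm.

(** * Representation of functionals bounded by a continuous seminorm *)

Section Riesz.
Context {R : realType} {disp : measure_display} {T : measurableType disp}.
Context (P : probability T R) {d : nat}.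
Variables (p q : \bar R).
Hypotheses (p1 : (1 <= p)%E) (pq : (p^-1 + q^-1 = 1)%E).
Variable N : (T -> 'rV[R]_d) -> R.
Hypothesis NP : continuous_seminorm P p N.
Variable f : (T -> 'rV[R]_d) -> R.
Hypothesis f_lin : @linear_on R (T -> 'rV[R]_d) (vecLp P p) f.
Hypothesis f_le : forall xi, vecLp P p xi -> f xi <= N xi.
Implicit Types (xi eta zeta : T -> 'rV[R]_d) (h : T -> R) (A : set T).

Let fD xi eta : vecLp P p xi -> vecLp P p eta -> f (fun w => xi w + eta w) = f xi + f eta.
Proof. by move=> Lx Le; exact: f_lin.1. Qed.

Let fZ c xi : vecLp P p xi -> f (fun w => c *: xi w) = c * f xi.
Proof. by move=> Lx; exact: f_lin.2. Qed.

Let f_abs xi : vecLp P p xi -> `|f xi| <= N xi.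
Proof.
move=> Lx; rewrite ler_norml f_le// andbT lerNl.
have := f_le (vecLpZ p1 (-1) Lx).
by rewrite fZ// (cs_scale NP)// normrN1 mulN1r mul1r.
Qed.

Let vecLp_scal h x (M : R) : measurable_fun setT h -> (forall w, `|h w| <= M) ->
  vecLp P p (fun w => h w *: (x : 'rV[R]_d)).
Proof.
move=> mh hM; apply: (@vecLp_bounded _ _ _ _ _ p p1 _ (M * enorm x)).
  by apply: mvecZ => //; exact: mvec_cst.
by apply: aeW => w; rewrite enormZ ler_wpM2r ?enorm_ge0.
Qed.

Let indM A w : `|\1_A w| <= 1 :> R.
Proof. by rewrite indicE; case: (_ \in _); rewrite ?normr1 ?normr0. Qed.

Let vecLp_ind A x : measurable A -> vecLp P p (fun w => \1_A w *: (x : 'rV[R]_d)).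
Proof. by move=> mA; apply: (@vecLp_scal _ x 1) => // w; exact: indM. Qed.

Section OneVector.
Variable x : 'rV[R]_d.

Definition functional_charge A : \bar R := (f (fun w => \1_A w *: x))%:E.
Local Notation nu := functional_charge.

Let nu0 : nu set0 = 0%E.
Proof.
rewrite /nu (_ : (fun w => _) = fun w => 0 *: (0 : 'rV[R]_d)); last first.
  by apply/funext => w; rewrite indic0 !scale0r.
by rewrite fZ ?mul0r//; exact: vecLp0.
Qed.

Let nu_fin A : measurable A -> nu A \is a fin_num.
Proof. by []. Qed.

(** With B n the union of the F i for i >= n, a partial sum is the value on the whole union minus
    the value on B n. The B n decrease to the empty set, so [cs_ocont] sends the latter to 0. *)
Let nu_sigma : semi_sigma_additive nu.
Proof.
move=> F mF tF mUF.
pose B n := \bigcup_(i in [set i | (n <= i)%N]) F i.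
have mB n : measurable (B n) by apply: bigcup_measurable => i _; exact: mF.
have BS n w : \1_(B n) w = \1_(F n) w + \1_(B n.+1) w :> R.
  rewrite !indicE; have [Fw|nFw] := boolP (w \in F n).
    rewrite mem_set; last by exists n => //=; exact: set_mem.
    rewrite memNset ?addr0// => -[i /= ni Fi].
    have ni' : n = i by apply: (tF n i I I); exists w; split => //; exact: set_mem.
    by rewrite ni' ltnn in ni.
  rewrite add0r; congr (_%:R); congr nat_of_bool; apply/idP/idP => /set_mem[i /= ni Fi]; apply/mem_set.
    exists i => //=; rewrite ltn_neqAle ni andbT; apply/eqP => ni'.
    by move: nFw; rewrite ni' mem_set.
  by exists i => //=; exact: ltnW.
have sumE n : (\sum_(0 <= i < n) nu (F i))%E =
    (f (fun w => \1_(\bigcup_i F i) w *: x) - f (fun w => \1_(B n) w *: x))%:E.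
  elim: n => [|n IH].
    rewrite big_geq// (_ : B 0%N = \bigcup_i F i) ?subrr//.
    by apply: eq_bigcupl.
  rewrite big_nat_recr//= IH /nu -EFinD; congr EFin.
  have -> : f (fun w => \1_(B n) w *: x) =
      f (fun w => \1_(F n) w *: x) + f (fun w => \1_(B n.+1) w *: x).
    rewrite -fD; [|exact: vecLp_ind|exact: vecLp_ind].
    by congr f; apply/funext => w; rewrite BS scalerDl.
  by ring.
under eq_fun do rewrite sumE.
apply/cvg_EFin; first exact: nearW.
rewrite /comp /=.
suff H : f (fun w => \1_(B n) w *: x) @[n --> \oo] --> 0.
  rewrite -[X in _ --> X]subr0; apply: cvgB => //; exact: cvg_cst.
apply/norm_cvg0P.
have NB : N (fun w => \1_(B n) w *: x) @[n --> \oo] --> 0.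
  apply: (cs_ocont NP) => //; first exact: vecLp_cst.
  apply: aeW => w; have [[i _ Fi]|nF] := pselect ((\bigcup_i F i) w); last first.
    by exists 0%N => n _ [i _ Fi]; apply: nF; exists i.
  exists i.+1 => n ni [j /= nj Fj].
  have ij : i = j by apply: (tF i j I I); exists w.
  by move: (leq_trans ni nj); rewrite ij ltnn.
apply: (squeeze_cvgr _ (cvg_cst 0) NB).
by apply: nearW => n; rewrite normr_ge0 f_abs//; exact: vecLp_ind.
Qed.

HB.instance Definition _ := isCharge.Build _ _ _ nu nu0 nu_fin nu_sigma.

Let nu_dom : nu `<< P.
Proof.
move=> A' PA' A mA AA'; have PA : P A = 0%E by exact: PA'.
rewrite /nu; congr EFin; apply/eqP; rewrite -normr_eq0 eq_le normr_ge0 andbT.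
apply: le_trans (f_abs (vecLp_ind x mA)) _.
apply: (@le_trans _ _ (N (fun w => 0 *: (0 : 'rV[R]_d)))).
  apply: (cs_solid NP).
  - by apply: mvecZ => //; exact: mvec_cst.
  - by apply: vecLpZ => //; exact: vecLp0.
  - exists A; split => // w /=; apply: contra_notP => nAw.
    by rewrite indicE memNset// !scale0r.
by rewrite (cs_scale NP) ?normr0 ?mul0r//; exact: vecLp0.
Qed.

Lemma exists_density : exists2 z : T -> R, integrableR P z &
  forall A, measurable A -> f (fun w => \1_A w *: x) = \int[P]_w (\1_A w * z w).
Proof.
pose g := Radon_Nikodym nu P.
have gfin w : g w \is a fin_num by exact: Radon_Nikodym_fin_num.
have Ig : P.-integrable setT g by exact: Radon_Nikodym_integrable.
have gE : g = EFin \o (fine \o g) by apply/funext => w; rewrite /= fineK.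
exists (fine \o g); first by rewrite /integrableR -gE.
move=> A mA; have := Radon_Nikodym_integral nu_dom mA; rewrite -/g => H.
apply: EFin_inj; rewrite -/(nu A) H integral_mkcond -integrableR_EFin.
  apply: eq_integral => w _; rewrite patchE indicE /=.
  by case: ifPn => _; rewrite ?mul1r ?mul0r ?fineK.
have : P.-integrable setT (g \_ A).
  by apply/(integrable_mkcond _ mA); exact: integrableS Ig.
rewrite /integrableR (_ : _ \_ _ = EFin \o (fun w => \1_A w * (fine \o g) w))//.
apply/funext => w; rewrite patchE /= indicE.
by case: ifPn => _; rewrite ?mul1r ?mul0r ?fineK.
Qed.

Variable z : T -> R.
Hypothesis Iz : integrableR P z.
Hypothesis zE : forall A, measurable A -> f (fun w => \1_A w *: x) = \int[P]_w (\1_A w * z w).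

Let Ihz h (M : R) : measurable_fun setT h -> (forall w, `|h w| <= M) ->
  integrableR P (fun w => h w * z w).
Proof.
move=> mh hM; apply: (integrableR_le_ae _ (integrableRZ M (integrableR_norm Iz))).
  by apply: measurable_funM => //; exact: (integrableR_measurable Iz).
by apply: aeW => w; rewrite normrM ler_wpM2r.
Qed.

(** The error of the density z on multiples of x; it vanishes on indicators by [zE]. *)
Let D h := f (fun w => h w *: x) - \int[P]_w (h w * z w).

Let D_comb (a b : R) h (k : T -> R) (M : R) : measurable_fun setT h -> measurable_fun setT k ->
  (forall w, `|h w| <= M) -> (forall w, `|k w| <= M) ->
  D (fun w => a * h w + b * k w) = a * D h + b * D k.
Proof.
move=> mh mk hM kM; rewrite /D.
have -> : (fun w => (a * h w + b * k w) *: x) = fun w => a *: (h w *: x) + b *: (k w *: x).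
  by apply/funext => w; rewrite scalerDl !scalerA.
have Lh := vecLp_scal x mh hM; have Lk := vecLp_scal x mk kM.
rewrite fD; [|exact: vecLpZ|exact: vecLpZ].
rewrite !fZ//; under eq_Rintegral do rewrite mulrDl -!mulrA.
rewrite RintegralD//; [|exact/integrableRZ/(Ihz mh hM)|exact/integrableRZ/(Ihz mk kM)].
rewrite !RintegralZl//; [|exact: (Ihz mk kM)|exact: (Ihz mh hM)].
by ring.
Qed.

Let D_ind A : measurable A -> D (\1_A) = 0.
Proof. by move=> mA; rewrite /D zE// subrr. Qed.

(* Binary digits: D h = D (2 h - 1_{h >= 1/2}) / 2, so D h is smaller than any B / 2^n. *)
Let D_unit h : measurable_fun setT h -> (forall w, 0 <= h w <= 1) -> D h = 0.
Proof.
(* A common bound of |D| over all functions with values in [0, 1], which is what the halving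
   argument starts from. *)
pose B := N (fun=> x) + \int[P]_w `|z w|.
have DB (k : T -> R) : measurable_fun setT k -> (forall w, 0 <= k w <= 1) -> `|D k| <= B.
  move=> mk k01.
  have k1 w : `|k w| <= 1 by have /andP[? ?] := k01 w; rewrite ger0_norm.
  rewrite /D; apply: le_trans (ler_normB _ _) _; apply: lerD.
    apply: le_trans (f_abs (vecLp_scal x mk k1)) _; apply: (cs_solid NP).
    - by apply: mvecZ => //; exact: mvec_cst.
    - exact: vecLp_cst.
    - by apply: aeW => w; rewrite enormZ ler_piMl ?enorm_ge0.
  apply: le_trans (le_normr_Rintegral measurableT (Ihz mk k1)) _.
  apply: le_Rintegral => //.
  - exact: integrableR_norm (Ihz mk k1).
  - exact: integrableR_norm.
  - by move=> w _; rewrite normrM ler_piMl.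
have key n : forall k : T -> R, measurable_fun setT k -> (forall w, 0 <= k w <= 1) -> `|D k| <= B / 2 ^+ n.
  elim: n => [|n IH] k mk k01; first by rewrite expr0 divr1; exact: DB.
  pose A := [set w | 2^-1 <= k w].
  have mA : measurable A by apply: measurable_lers => //; exact: measurable_cst.
  have mI : measurable_fun setT (\1_A : T -> R) by exact: measurable_indic.
  pose r w := 2 * k w + -1 * \1_A w.
  have mr : measurable_fun setT r.
    by apply: measurable_funD; apply: measurable_funM.
  have r01 w : 0 <= r w <= 1.
    rewrite /r indicE; have := k01 w; have [/set_mem|/negP] := boolP (w \in A).
      rewrite /A /= => h1 /andP[h2 h3]; rewrite mulr1n; lra.
    move=> nA /andP[h2 h3]; rewrite mulr0n.
    have : k w < 2^-1 by rewrite ltNge; apply/negP => kA; apply: nA; apply/mem_set.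
    lra.
  have k1 w : `|k w| <= 1 by have /andP[? ?] := k01 w; rewrite ger0_norm.
  have : D r = 2 * D k + -1 * D (\1_A).
    by apply: (@D_comb _ _ _ _ 1) => // w; exact: indM.
  rewrite D_ind// mulr0 addr0 => Dr.
  have := IH r mr r01; rewrite Dr normrM ger0_norm// exprS invfM mulrCA.
  by move: (B / 2 ^+ n) => b; lra.
move=> mh h01; apply/eqP; rewrite -normr_eq0 eq_le normr_ge0 andbT.
have B0 : 0 <= B by apply: le_trans (DB _ mh h01).
rewrite leNgt; apply/negP => Dpos.
have [n Bn] : exists n, B / `|D h| < 2 ^+ n.
  exists (Num.bound (B / `|D h|)); apply: lt_le_trans (archi_boundP _) _.
    by rewrite divr_ge0.
  by rewrite -natrX ler_nat ltnW// ltn_expl.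
have := key n h mh h01; rewrite leNgt ltr_pdivrMr ?exprn_gt0//.
by rewrite mulrC -ltr_pdivrMr// Bn.
Qed.

Lemma bounded_density h (M : R) : measurable_fun setT h -> (forall w, `|h w| <= M) ->
  f (fun w => h w *: x) = \int[P]_w (h w * z w).
Proof.
move=> mh hM; pose M' := `|M| + 1.
have M'0 : 0 < M' by rewrite ltr_wpDl.
have hM' w : `|h w| <= M'.
  by rewrite (le_trans (hM w))// (le_trans (ler_norm _))// lerDl.
(* g = (h + M') / (2 M') has values in [0, 1]. The constant is written as an indicator so that D is
   known to vanish on it, and h is recovered as a combination of g and that indicator. *)
pose g w := (2 * M')^-1 * h w + 2^-1 * \1_[set: T] w.
have mI : measurable_fun setT (\1_[set: T] : T -> R) by exact: measurable_indic.
have mg : measurable_fun setT g by apply: measurable_funD; apply: measurable_funM.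
have gE w : g w = (h w + M') / (2 * M').
  by rewrite /g indicE mem_set// mulr1n; field; rewrite gt_eqF.
have g01 w : 0 <= g w <= 1.
  have := hM' w; rewrite ler_norml => /andP[h1 h2].
  by rewrite gE ler_pdivlMr ?mulr_gt0// ler_pdivrMr ?mulr_gt0//; apply/andP; split; lra.
have g1 w : `|g w| <= 1 by have /andP[? ?] := g01 w; rewrite ger0_norm.
have := @D_comb (2 * M') (- M') g (\1_[set: T]) 1 mg mI g1 (indM _).
rewrite (D_unit mg g01) (D_ind measurableT) !mulr0 addr0.
rewrite (_ : (fun w => _) = h); first by move=> /eqP; rewrite subr_eq0 => /eqP.
by apply/funext => w; rewrite gE indicE mem_set// mulr1n; field; rewrite gt_eqF.
Qed.

End OneVector.

Let f_sum n (xi : 'I_n -> T -> 'rV[R]_d) : (forall i, vecLp P p (xi i)) ->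
  vecLp P p (fun w => \sum_i xi i w) /\ f (fun w => \sum_i xi i w) = \sum_i f (xi i).
Proof.
elim: n xi => [|n IH] xi Lx.
  rewrite big_ord0; under eq_fun do rewrite big_ord0.
  split; first exact: vecLp0.
  have := fZ 0 (vecLp0 P p1); rewrite mul0r => <-.
  by congr f; apply/funext => w; rewrite scaler0.
under eq_fun do rewrite big_ord_recl; rewrite big_ord_recl.
have [L1 E1] := IH (fun i => xi (lift ord0 i)) (fun i => Lx _).
by split; [exact: vecLpD|rewrite fD// E1].
Qed.

(** Coordinatewise: [cs_ocont] makes the set function countably additive, [cs_solid] makes it
    absolutely continuous, and its density is the coordinate of zeta. *)
Theorem riesz : exists2 zeta, vecLp P q zeta &
  forall xi, vecLp P p xi -> f xi = pairing P xi zeta.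
Proof.
have q1 := conjugate_ge1 p1 pq.
pose e (i : 'I_d) : 'rV[R]_d := delta_mx ord0 i.
have /choice[z Hz] (i : 'I_d) : exists z, integrableR P z /\
    forall A, measurable A -> f (fun w => \1_A w *: e i) = \int[P]_w (\1_A w * z w).
  by have [z Iz zE] := exists_density (e i); exists z.
have bd i h (M : R) : measurable_fun setT h -> (forall w, `|h w| <= M) ->
    f (fun w => h w *: e i) = \int[P]_w (h w * z i w).
  by move=> mh hM; have [Iz zE] := Hz i; exact: (bounded_density Iz zE mh hM).
pose zeta w := \row_i z i w.
have Lzeta : vecLp P q zeta.
  apply/(vecLpP _ q1) => i; under eq_fun do rewrite mxE.
  have [Iz _] := Hz i.
  (* For p = oo the exponent q is 1 and integrability of the density is all that is claimed; for
     finite p [cs_bound] feeds the converse of Hoelder's inequality. *)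
  have [poo|pfin] := eqVneq p +oo%E.
    have -> : q = 1%E.
      by move: pq; rewrite poo invey add0e => /eqP; rewrite inve_eq1 => /eqP.
    exact/Lfun1_integrable.
  have [K K0 HK] := cs_bound NP pfin.
  have eK : 0 <= K * enorm (e i) by rewrite mulr_ge0// enorm_ge0.
  apply: (converse_hoelder p1 pq pfin eK Iz) => h M mh hM.
  rewrite -(bd _ _ _ mh hM); apply: le_trans (f_le (vecLp_scal (e i) mh hM)) _.
  by apply: HK; apply: (@Lfun_bounded _ _ _ _ p _ M) => //; exact: aeW.
exists zeta => //.
have bounded xi M : mvec xi -> (forall w, enorm (xi w) <= M) -> f xi = pairing P xi zeta.
  move=> mx xM.
  have cM i w : `|xi w ord0 i| <= M by exact: le_trans (enorm_coord_le _ _) (xM w).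
  have Lc i : vecLp P p (fun w => xi w ord0 i *: e i) by exact: (vecLp_scal (e i) (mx i) (cM i)).
  have -> : f xi = f (fun w => \sum_i xi w ord0 i *: e i).
    by congr f; apply/funext => w; exact: row_sum_delta.
  rewrite (f_sum Lc).2 pairingE /dotv RintegralS.
    apply: eq_bigr => i _; rewrite (bd _ _ _ (mx i) (cM i)).
    by apply: eq_Rintegral => w _; rewrite mxE.
  move=> i; have [K _ H] := hoelder_Lfun p1 pq ((vecLpP _ q1 _).1 Lzeta i).
  by apply: (H _ _).1; apply: (@Lfun_bounded _ _ _ _ p _ M) => //; exact: aeW.
move=> xi Lx; have mx := vecLp_mvec Lx.
(* Truncation at norm n reduces an unbounded xi to the bounded case. *)
pose A n := [set w | n%:R < enorm (xi w)].
have mA n : measurable (A n).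
  by apply: measurable_ltrs; [exact: measurable_cst|exact: measurable_enorm].
have Aev : forall w, exists n0, forall n, (n0 <= n)%N -> ~ A n w.
  move=> w; exists (Num.bound (enorm (xi w))) => n nn; apply/negP; rewrite -leNgt.
  by apply: le_trans (ltW (archi_boundP (enorm_ge0 _))) _; rewrite ler_nat.
have mI n : measurable_fun setT (\1_(A n) : T -> R) by exact: measurable_indic.
pose tail n w := \1_(A n) w *: xi w.
have Ltail n : vecLp P p (tail n).
  apply: (vecLp_le p1 _ (Lfun_enorm Lx)); first exact: mvecZ.
  by apply: aeW => w; rewrite enormZ ler_piMl ?enorm_ge0.
have Lhead n : vecLp P p (fun w => xi w - tail n w) by exact: vecLpB.
have head n : f (fun w => xi w - tail n w) = pairing P (fun w => xi w - tail n w) zeta.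
  apply: (@bounded _ n%:R); first exact: vecLp_mvec (Lhead n).
  move=> w; rewrite /tail indicE; have [_|/negP nA] := boolP (w \in A n).
    by rewrite scale1r subrr /enorm dotv0l sqrtr0.
  by rewrite scale0r subr0 leNgt; apply/negP => xn; apply: nA; apply/mem_set.
(* The left side is free of n, while both terms on the right tend to 0. *)
have split_f n : f xi - pairing P xi zeta = f (tail n) - pairing P (tail n) zeta.
  have xE : xi = fun w => (xi w - tail n w) + tail n w by apply/funext => w; rewrite subrK.
  rewrite {1 2}xE fD// (pairingDl p1 pq (Lhead n) (Ltail n) Lzeta) head; ring.
have f0 : f (tail n) @[n --> \oo] --> 0.
  have NB : N (tail n) @[n --> \oo] --> 0 by apply: (cs_ocont NP) => //; exact: aeW.
  apply/norm_cvg0P; apply: (squeeze_cvgr _ (cvg_cst 0) NB).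
  by apply: nearW => n; rewrite normr_ge0 f_abs.
have g0 : pairing P (tail n) zeta @[n --> \oo] --> 0.
  have Ixz := pairing_integrable p1 pq Lx Lzeta.
  have -> : 0 = \int[P]_w (0 : R) by rewrite Rintegral_cstT.
  under eq_fun do rewrite pairingE.
  apply: (dominated_cvg_Rintegral _ _ (integrableR_norm Ixz)) => [n|//|n|].
  - by apply: measurable_dotv; [exact: vecLp_mvec (Ltail n)|exact: vecLp_mvec Lzeta].
  - by apply: aeW => w; rewrite /tail dotvZl normrM ler_piMl.
  apply: aeW => w; apply: cvg_near_cst; have [n0 Hn0] := Aev w.
  exists n0 => // n /= nn; rewrite /tail indicE memNset ?scale0r ?dotv0l//.
  exact: Hn0.
apply/eqP; rewrite -subr_eq0; apply/eqP.
have /cvg_lim : (fun n => f (tail n) - pairing P (tail n) zeta) @ \oo --> 0 - (0 : R).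
  exact: cvgB.
rewrite subr0 => <- //.
under eq_fun do rewrite -split_f.
by rewrite lim_cst.
Qed.

End Riesz.

(** * Operations on continuous seminorms, and the norm of L^p for finite p *)

Section SeminormOperations.
Context {R : realType} {disp : measure_display} {T : measurableType disp}.
Context (P : probability T R) {d : nat} (p : \bar R).
Hypothesis p1 : (1 <= p)%E.
Implicit Types (xi eta zeta : T -> 'rV[R]_d) (N : (T -> 'rV[R]_d) -> R).

Lemma cs_zero N : continuous_seminorm P p N -> N (fun=> 0) = 0.
Proof.
move=> NP; have := cs_scale NP 0 (vecLp0 P p1); rewrite normr0 mul0r => <-.
by congr N; apply/funext => w; rewrite scaler0.
Qed.

Lemma cs_ge0 N xi : continuous_seminorm P p N -> vecLp P p xi -> 0 <= N xi.
Proof.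
move=> NP Lx; rewrite -(cs_zero NP); apply: (cs_solid NP) => //.
by apply: aeW => w; rewrite {1}/enorm dotv0l sqrtr0 enorm_ge0.
Qed.

Lemma cs_sub N xi eta : continuous_seminorm P p N -> vecLp P p xi -> vecLp P p eta ->
  N xi <= N eta + N (fun w => eta w - xi w).
Proof.
move=> NP Lx Le; have Ld := vecLpB p1 Le Lx.
rewrite (_ : N (fun w => eta w - xi w) = N (fun w => -1 *: (eta w - xi w))).
  rewrite {1}(_ : xi = fun w => eta w + -1 *: (eta w - xi w)).
    by apply: (cs_add NP) => //; exact: vecLpZ.
  by apply/funext => w; rewrite scaleN1r opprB addrC subrK.
by rewrite (cs_scale NP)// normrN1 mul1r.
Qed.

Lemma cs_mul N M : 0 <= M -> continuous_seminorm P p N ->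
  continuous_seminorm P p (fun xi => M * N xi).
Proof.
move=> M0 NP; split.
- by move=> xi eta Lx Le; rewrite -mulrDr ler_wpM2l//; exact: (cs_add NP).
- by move=> c xi Lx; rewrite (cs_scale NP)// mulrCA.
- by move=> xi eta mx Le xe; rewrite ler_wpM2l//; exact: (cs_solid NP).
- move=> xi A Lx mA Aev; rewrite -(mulr0 M); apply: cvgMl_tmp; exact: (cs_ocont NP).
- move=> pfin; have [K K0 HK] := cs_bound NP pfin.
  by exists (M * K); rewrite ?mulr_ge0// => f x Lf; rewrite -!mulrA ler_wpM2l// !mulrA HK.
Qed.

Lemma cs_plus N1 N2 : continuous_seminorm P p N1 -> continuous_seminorm P p N2 ->
  continuous_seminorm P p (fun xi => N1 xi + N2 xi).
Proof.
move=> P1 P2; split.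
- move=> xi eta Lx Le; rewrite addrACA; apply: lerD; [exact: (cs_add P1)|exact: (cs_add P2)].
- by move=> c xi Lx; rewrite (cs_scale P1)// (cs_scale P2)// mulrDr.
- by move=> xi eta mx Le xe; apply: lerD; [exact: (cs_solid P1)|exact: (cs_solid P2)].
- move=> xi A Lx mA Aev; rewrite -(addr0 0).
  by apply: cvgD; [exact: (cs_ocont P1)|exact: (cs_ocont P2)].
- move=> pfin; have [K K0 HK] := cs_bound P1 pfin; have [L L0 HL] := cs_bound P2 pfin.
  exists (K + L); rewrite ?addr_ge0// => f x Lf; rewrite !mulrDl; apply: lerD; [exact: HK|exact: HL].
Qed.

(** Order continuity is dominated convergence for the r-th powers. It is what fails for the norm of
    L^oo, where shrinking the event need not shrink the norm. *)
Lemma cs_nrm : p != +oo%E -> continuous_seminorm P p (fun xi => nrm P p (fun w => enorm (xi w))).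
Proof.
move=> pfin; split.
- move=> xi eta Lx Le; apply: le_trans (nrmD p1 (Lfun_enorm Lx) (Lfun_enorm Le)).
  apply: nrm_le_ae => //.
  + by apply: measurable_enorm; apply: mvecD; [exact: vecLp_mvec Lx|exact: vecLp_mvec Le].
  + by apply: LfunD => //; exact: Lfun_enorm.
  + apply: aeW => w; rewrite !ger0_norm ?addr_ge0 ?enorm_ge0//; exact: enormD.
- move=> c xi Lx; rewrite -[X in X * _]normr_id -nrmZ//; last exact: Lfun_enorm.
  by congr nrm; apply/funext => w; rewrite enormZ.
- move=> xi eta mx Le xe; apply: nrm_le_ae => //; first exact: measurable_enorm.
    exact: Lfun_enorm.
  by apply: filterS xe => w; rewrite !ger0_norm ?enorm_ge0.
- move=> xi A Lx mA Aev.
  case: p p1 pfin Lx => [r|//|//]; rewrite lee_fin => r1 _ Lx.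
  have r0 : 0 < r by exact: lt_le_trans r1.
  have mx := vecLp_mvec Lx.
  pose g w := enorm (xi w) `^ r.
  have Ig : integrableR P g.
    rewrite /integrableR (_ : EFin \o g = fun w => (`|enorm (xi w)| `^ r)%:E).
      exact: (Lfun_integrable r1 (Lfun_enorm Lx)).
    by apply/funext => w; rewrite /= ger0_norm ?enorm_ge0.
  pose h n w := enorm (\1_(A n) w *: xi w) `^ r.
  have hE n w : h n w = \1_(A n) w * g w.
    rewrite /h /g indicE; case: (_ \in _); rewrite ?scale1r ?mul1r//.
    by rewrite scale0r mul0r /enorm dotv0l sqrtr0 powR0// gt_eqF.
  have mh n : measurable_fun setT (h n).
    rewrite (_ : h n = fun w => \1_(A n) w * g w); last by apply/funext => w; rewrite hE.
    by apply: measurable_funM => //; exact: (integrableR_measurable Ig).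
  have hg n w : `|h n w| <= g w.
    by rewrite hE normrM (ger0_norm (powR_ge0 _ _)) ler_piMl ?powR_ge0// indicE; case: (_ \in _); rewrite ?normr1 ?normr0.
  have Ih n : integrableR P (h n).
    by apply: (integrableR_le_ae _ Ig) => //; exact: aeW.
  have Nn n : nrm P r%:E (fun w => enorm (\1_(A n) w *: xi w)) = (\int[P]_w h n w) `^ r^-1.
    rewrite /nrm unlock fine_poweR; congr (_ `^ _); congr fine.
    by apply: eq_integral => w _; rewrite poweR_EFin /= ger0_norm ?enorm_ge0.
  have h0 : \int[P]_w h n w @[n --> \oo] --> 0.
    have -> : 0 = \int[P]_w (0 : R) by rewrite Rintegral_cstT.
    apply: (dominated_cvg_Rintegral _ _ Ig) => // [n|]; first exact: aeW.
    apply: filterS Aev => w [n0 Hn0]; apply: cvg_near_cst; exists n0 => // n /= nn.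
    by rewrite hE indicE memNset ?mul0r//; exact: Hn0.
  under eq_fun do rewrite Nn.
  apply/cvgr0Pnorm_le => e e0; have er : 0 < e `^ r by exact: powR_gt0.
  have /cvgr0Pnorm_le /(_ _ er) := h0; apply: filterS => n hn.
  rewrite ger0_norm ?powR_ge0// -[leRHS](powRr1 (ltW e0)) -(mulfV (lt0r_neq0 r0)) powRrM.
  rewrite ge0_ler_powR ?nnegrE ?powR_ge0 ?invr_ge0 ?(ltW r0)//.
    by apply: Rintegral_ge0 => w _; exact: powR_ge0.
  by apply: le_trans hn; exact: ler_norm.
- move=> _; exists 1 => // f x Lf; rewrite mul1r.
  rewrite -[enorm x]ger0_norm ?enorm_ge0// -nrmZ//.
  apply: nrm_le_ae => //.
  + by apply: measurable_enorm; apply: mvecZ; [exact: Lfun_measurable Lf|exact: mvec_cst].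
  + exact: LfunZ.
  + by apply: aeW => w; rewrite enormZ !normrM normr_id mulrC.
Qed.

End SeminormOperations.

(** * A Fenchel-Moreau theorem for sublinear functionals *)

Section FenchelMoreau.
Context {R : realType} {disp : measure_display} {T : measurableType disp}.
Context (P : probability T R) {d : nat}.
Variables (p q : \bar R).
Hypotheses (p1 : (1 <= p)%E) (pq : (p^-1 + q^-1 = 1)%E).
Variable e : (T -> 'rV[R]_d) -> \bar R.
Implicit Types (xi eta zeta : T -> 'rV[R]_d).
Local Notation W := (@vecLp R disp T P d p).
Hypothesis e_add : forall xi eta, W xi -> W eta -> (e (fun w => xi w + eta w)%R <= e xi + e eta)%E.
Hypothesis e_scale : forall (c : R) xi, 0 < c -> W xi -> (e (fun w => c *: xi w)%R = c%:E * e xi)%E.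
Hypothesis e0 : (e (fun=> 0%R) <= 0)%E.
Variables (N : (T -> 'rV[R]_d) -> R) (delta r : R) (xi0 : T -> 'rV[R]_d).
Hypotheses (NP : continuous_seminorm P p N) (delta0 : 0 < delta) (Lx0 : W xi0).
Hypothesis e_near0 : forall eta, W eta -> N eta <= delta -> ((-1)%:E <= e eta)%E.
Hypothesis e_near : forall eta, W eta -> N (fun w => eta w - xi0 w) <= delta -> (r%:E <= e eta)%E.

(** Scale xi into the ball N <= delta and use homogeneity. *)
Let e_lower xi : W xi -> ((- (N xi / delta))%:E <= e xi)%E.
Proof.
move=> Lx; have N0 := cs_ge0 p1 NP Lx.
(* N xi may vanish, so the scaling divides by N xi + t and t is sent to 0. *)
suff H (t : R) : 0 < t -> ((- ((N xi + t) / delta))%:E <= e xi)%E.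
  apply/lee_addgt0Pr => t t0; have td : 0 < t * delta by exact: mulr_gt0.
  have := H _ td; rewrite mulrDl mulfK ?gt_eqF// opprD EFinB.
  by rewrite leeBlDr.
move=> t0; have nt : 0 < N xi + t by rewrite ltr_wpDl.
have c0 : 0 < delta / (N xi + t) by exact: divr_gt0.
have Nc : N (fun w => (delta / (N xi + t)) *: xi w) <= delta.
  rewrite (cs_scale NP)// gtr0_norm// mulrAC ler_pdivrMr//.
  by rewrite ler_wpM2l ?ltW// ltrDl.
have := e_near0 (vecLpZ p1 _ Lx) Nc; rewrite e_scale//.
rewrite -lee_pdivrMl// -EFinM => H; apply: le_trans H; rewrite lee_fin.
by rewrite invf_div mulrN1.
Qed.

(** The first summand lets M N dominate the lower bound of e, so that the infima below are finite.
    The second makes M D absorb [r] and [N xi0 / delta] as soon as D > delta in [g_ge]. *)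
Let M := delta^-1 + (`|r| + N xi0 / delta) / delta.

Let M_ge : delta^-1 <= M.
Proof.
rewrite lerDl mulr_ge0 ?invr_ge0 ?(ltW delta0)// addr_ge0// mulr_ge0 ?invr_ge0 ?(ltW delta0)//.
exact: cs_ge0 Lx0.
Qed.

Let M0 : 0 <= M.
Proof. by apply: le_trans M_ge; rewrite invr_ge0 ltW. Qed.

(** The infimum g of these values is the infimal convolution of e and M N, the largest sublinear
    functional below both. Using a real t above e xi keeps infinite values out. *)
Let S eta := [set s : R | exists xi t, [/\ W xi, (e xi <= t%:E)%E &
  s = t + M * N (fun w => eta w - xi w)]].

Let g eta := inf (S eta).

Let S_lb eta : W eta -> lbound (S eta) (- (N eta / delta)).
Proof.
move=> Le s [xi [t [Lx et ->]]].
have t1 : - (N xi / delta) <= t by rewrite -lee_fin; exact: le_trans (e_lower Lx) et.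
have N1 := cs_sub p1 NP Lx Le.
have Nd : 0 <= N (fun w => eta w - xi w) by apply: (cs_ge0 p1 NP); exact: vecLpB.
have h1 : N xi / delta <= (N eta + N (fun w => eta w - xi w)) / delta.
  by rewrite ler_wpM2r ?invr_ge0 ?(ltW delta0).
have h2 : N (fun w => eta w - xi w) / delta <= M * N (fun w => eta w - xi w).
  by rewrite mulrC ler_wpM2r.
by rewrite mulrDl in h1; lra.
Qed.

Let S_has_lb eta : W eta -> has_lbound (S eta).
Proof. by move=> Le; exists (- (N eta / delta)); exact: S_lb. Qed.

Let S_zero eta : W eta -> S eta (M * N eta).
Proof.
move=> Le; exists (fun=> 0), 0; split; [exact: vecLp0|exact: e0|].
by rewrite add0r; congr (_ * N _); apply/funext => w; rewrite subr0.
Qed.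

Let S_nonempty eta : W eta -> S eta !=set0.
Proof. by move=> Le; exists (M * N eta); exact: S_zero. Qed.

Let g_sublinear : @sublinear_on R (T -> 'rV[R]_d) W g.
Proof.
split=> [x y Wx Wy|c x c0 Wx].
  apply: inf_le_add; [apply: S_has_lb; exact: (vecLpD p1 Wx Wy)|exact: S_nonempty|exact: S_nonempty|].
  move=> _ _ [xi [t [Lx et ->]]] [eta [s [Le es ->]]].
  exists (t + s + M * N (fun w => (x w + y w) - (xi w + eta w))).
    exists (fun w => xi w + eta w), (t + s); split => //; first exact: vecLpD.
    by apply: le_trans (e_add Lx Le) _; rewrite EFinD leeD.
  have : N (fun w => x w + y w - (xi w + eta w)) <= N (fun w => x w - xi w) + N (fun w => y w - eta w).
    rewrite (_ : (fun w => _) = fun w => (x w - xi w) + (y w - eta w)).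
      by apply: (cs_add NP); exact: vecLpB.
    by apply/funext => w; rewrite opprD addrACA.
  by move=> /(ler_wpM2l M0); lra.
apply: inf_le_scale => //; [apply: S_has_lb; exact: (vecLpZ p1 c Wx)|exact: S_nonempty|].
move=> _ [xi [t [Lx et ->]]].
exists (c * t + M * N (fun w => c *: x w - c *: xi w)).
  exists (fun w => c *: xi w), (c * t); split => //; first exact: vecLpZ.
  by rewrite e_scale// EFinM lee_pmul2l.
rewrite (_ : (fun w => _) = fun w => c *: (x w - xi w)); last first.
  by apply/funext => w; rewrite scalerBr.
by rewrite (cs_scale NP); [rewrite gtr0_norm//; lra|exact: vecLpB].
Qed.

Let g_ge : r <= g xi0.
Proof.
apply: lb_le_inf; first exact: S_nonempty.
move=> _ [xi [t [Lx et ->]]].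
have Ld : W (fun w => xi0 w - xi w) by exact: vecLpB.
set D := N (fun w => xi0 w - xi w).
have D0 : 0 <= D by exact: (cs_ge0 p1 NP).
(* Near xi0 the local bound r on e decides; far from it the linear growth of M N outweighs
   [e_lower]. *)
have [Dd|Dd] := leP D delta.
  have MD : 0 <= M * D by exact: mulr_ge0.
  suff : r <= t by lra.
  rewrite -lee_fin; apply: le_trans et; apply: e_near => //.
  rewrite (_ : (fun w => _) = fun w => -1 *: (xi0 w - xi w)); last first.
    by apply/funext => w; rewrite scaleN1r opprB.
  by rewrite (cs_scale NP)// normrN1 mul1r.
have t1 : - (N xi / delta) <= t by rewrite -lee_fin; exact: le_trans (e_lower Lx) et.
have := cs_sub p1 NP Lx Lx0; rewrite -/D => N1.
have h1 : N xi / delta <= (N xi0 + D) / delta by rewrite ler_wpM2r ?invr_ge0 ?(ltW delta0).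
have k0 : 0 <= `|r| + N xi0 / delta.
  by rewrite addr_ge0// divr_ge0 ?(ltW delta0)// (cs_ge0 p1 NP).
have h2 : `|r| + N xi0 / delta <= (`|r| + N xi0 / delta) / delta * D.
  by rewrite mulrAC ler_pdivlMr// ler_wpM2l// ltW.
have h3 := ler_norm r.
rewrite /M mulrDl; rewrite mulrDl in h1; rewrite (mulrC delta^-1).
by move: h1 h2 t1; set a := N xi / delta; set b := N xi0 / delta; set c := D / delta; lra.
Qed.

(** Hahn-Banach for g at xi0: g <= M N puts the functional within reach of [riesz], g <= e gives the
    domination, and equality at xi0 the lower bound r. *)
Theorem fenchel_moreau : exists zeta, [/\ vecLp P q zeta,
  forall xi, W xi -> ((pairing P xi zeta)%:E <= e xi)%E & r <= pairing P xi0 zeta].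
Proof.
have W0 : W 0 by exact: (vecLp0 P p1).
have WD x y : W x -> W y -> W (x + y) by exact: (vecLpD p1).
have WZ c x : W x -> W (c *: x) by exact: (vecLpZ p1).
have [f [flin fg f0]] := @hahn_banach R (T -> 'rV[R]_d) W W0 WD WZ g xi0 g_sublinear Lx0.
have fN xi : W xi -> f xi <= M * N xi.
  move=> Lx; apply: le_trans (fg _ Lx) _; apply: ge_inf; [exact: S_has_lb|exact: S_zero].
have [zeta Lz fE] := riesz p1 pq (cs_mul M0 NP) flin fN.
exists zeta; split => //; last by rewrite -fE// f0; exact: g_ge.
move=> xi Lx; rewrite -fE//.
case E : (e xi) => [t| |]; last 2 first.
- by rewrite leey.
- by have := e_lower Lx; rewrite E.
rewrite lee_fin; apply: le_trans (fg _ Lx) _; apply: ge_inf; first exact: S_has_lb.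
exists xi, t; split; rewrite ?E// (_ : (fun w => _) = fun=> 0).
  by rewrite (cs_zero p1 NP) mulr0 addr0.
by apply/funext => w; rewrite subrr.
Qed.

End FenchelMoreau.

(** * Separation by continuous seminorms *)

Section AeConvergence.
Context {R : realType} {disp : measure_display} {T : measurableType disp}.
Context (P : probability T R) {d : nat}.
Implicit Types (xi eta zeta : T -> 'rV[R]_d) (K : set (T -> 'rV[R]_d)).

Definition ae_bounded (c : R) eta := {ae P, forall w, enorm (eta w) <= c}.

Definition ae_cvg (eta_ : nat -> T -> 'rV[R]_d) eta :=
  {ae P, forall w, forall i, eta_ n w ord0 i @[n --> \oo] --> eta w ord0 i}.

Lemma cvg_dotv (x_ : nat -> 'rV[R]_d) (x y : 'rV[R]_d) :
  (forall i, x_ n ord0 i @[n --> \oo] --> x ord0 i) ->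
  dotv (x_ n) y @[n --> \oo] --> dotv x y.
Proof.
move=> h; apply: (@cvg_big _ _ _ _ predT add_continuous) => i _.
exact: cvgMr_tmp (h i).
Qed.

Lemma cvg_enorm (x_ : nat -> 'rV[R]_d) (x : 'rV[R]_d) :
  (forall i, x_ n ord0 i @[n --> \oo] --> x ord0 i) ->
  enorm (x_ n) @[n --> \oo] --> enorm x.
Proof.
move=> h; apply: (@cvg_comp _ _ _ (fun n => dotv (x_ n) (x_ n)) Num.sqrt); last exact: sqrt_continuous.
apply: (@cvg_big _ _ _ _ predT add_continuous) => i _.
exact: cvgM (h i) (h i).
Qed.

Lemma ae_bounded_cvg (eta_ : nat -> T -> 'rV[R]_d) eta c :
  (forall n, ae_bounded c (eta_ n)) -> ae_cvg eta_ eta -> ae_bounded c eta.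
Proof.
move=> bd cv; have /ae_foralln bd' := bd.
apply: filterS2 bd' cv => w hb hc.
have : enorm (eta_ n w) @[n --> \oo] --> enorm (eta w) by exact: cvg_enorm.
move=> /cvg_lim <- //; apply: limr_le; last exact: nearW.
by apply/cvg_ex; exists (enorm (eta w)); exact: cvg_enorm.
Qed.

(* The limsup makes the limit measurable everywhere. *)
Lemma ae_cvg_of_series (eta_ : nat -> T -> 'rV[R]_d) (a : R) :
  (forall n, mvec (eta_ n)) ->
  (forall n, integrableR P (fun w => enorm (eta_ n.+1 w - eta_ n w))) ->
  (forall n, \sum_(0 <= j < n) \int[P]_w enorm (eta_ j.+1 w - eta_ j w) <= a) ->
  exists2 eta, mvec eta & ae_cvg eta_ eta.
Proof.
move=> me Iu ua.
pose u j w := enorm (eta_ j.+1 w - eta_ j w).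
have mu j : measurable_fun setT (u j) := integrableR_measurable (Iu j).
pose s n w := \sum_(0 <= j < n) u j w.
have Is n : integrableR P (s n) /\ \int[P]_w s n w = \sum_(0 <= j < n) \int[P]_w u j w.
  elim: n => [|n [I1 E1]].
    have -> : s 0%N = fun=> 0 by apply/funext => w; rewrite /s big_geq.
    by rewrite big_geq// Rintegral_cstT; split => //; exact: integrableR_cst.
  have -> : s n.+1 = fun w => s n w + u n w by apply/funext => w; rewrite /s big_nat_recr.
  rewrite big_nat_recr//= -E1 RintegralD//; last exact: Iu.
  by split => //; apply: integrableRD => //; exact: Iu.
have s0 n w : 0 <= s n w by apply: sumr_ge0 => j _; exact: enorm_ge0.
have nd w : {homo (fun n => s n w) : m n / (m <= n)%N >-> m <= n}.
  by apply/nondecreasing_seqP => n; rewrite /s big_nat_recr//= lerDl enorm_ge0.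
(* F is the total length of the increments. Its integral is at most a, so it is finite almost
   surely, and there every coordinate series converges absolutely. *)
pose F w := limn (fun n => (s n w)%:E).
have ndE w : {homo (fun n => (s n w)%:E) : m n / (m <= n)%N >-> (m <= n)%E}.
  by move=> m n mn; rewrite lee_fin; exact: nd.
have ms n : measurable_fun setT (fun w => (s n w)%:E).
  by apply/measurable_EFinP; exact: integrableR_measurable (Is n).1.
have sF w n : ((s n w)%:E <= F w)%E.
  rewrite /F (cvg_lim _ (ereal_nondecreasing_cvgn (ndE w)))//.
  by apply: ereal_sup_ubound; exists n.
have F0 w : (0 <= F w)%E by apply: le_trans (sF w 0%N); rewrite lee_fin.
have IF : P.-integrable setT F.
  apply/integrableP; split.
    by apply: (emeasurable_fun_cvg (fun n w => (s n w)%:E)) => // w _; exact: ereal_nondecreasing_is_cvgn.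
  under eq_integral do rewrite gee0_abs//.
  apply: (@le_lt_trans _ _ a%:E); last exact: ltry.
  rewrite /F monotone_convergence//; last by move=> n w _; rewrite lee_fin.
  apply: lime_le.
    apply: ereal_nondecreasing_is_cvgn => m n mn; apply: ge0_le_integral => //.
    - by move=> w _; rewrite lee_fin.
    - by move=> w _; exact: ndE.
  apply: nearW => n; rewrite integrableR_EFin; last exact: (Is n).1.
  by rewrite lee_fin (Is n).2.
have Ffin := integrable_ae measurableT IF.
pose eta w : 'rV[R]_d := \row_i fine (limn_esup (fun n => (eta_ n w ord0 i)%:E)).
exists eta.
  move=> i; under eq_fun do rewrite mxE.
  apply: (measurableT_comp (fine_measurable measurableT)).
  by apply: measurable_fun_limn_esup => n; apply/measurable_EFinP; exact: me.
apply: filterS Ffin => w /(_ I) Fw i.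
have cv : cvgn (fun n => eta_ n w ord0 i).
  pose x n := eta_ n w ord0 i; pose v j := x j.+1 - x j.
  have xE n : x n = series v n + x 0%N.
    elim: n => [|n IH]; first by rewrite /series /= big_geq// add0r.
    by rewrite /series /= big_nat_recr//= addrAC -/(series v n) -IH /v addrC subrK.
  have : cvgn (series v).
    apply: normed_cvg; apply: nondecreasing_is_cvgn.
      by apply/nondecreasing_seqP => n; rewrite -subr_ge0 seriesSB /=.
    exists (fine (F w)) => _ [n _ <-]; rewrite /= /series /=.
    apply: (@le_trans _ _ (s n w)); last by rewrite -lee_fin fineK.
    apply: ler_sum => j _; have := enorm_coord_le (eta_ j.+1 w - eta_ j w) i.
    by rewrite !mxE.
  move=> /cvg_ex[l lv]; apply/cvg_ex; exists (l + x 0%N).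
  rewrite [X in X @ _](_ : _ = fun n => series v n + x 0%N); last by apply/funext.
  by apply: cvgD => //; exact: cvg_cst.
have /cvg_ex[l lx] := cv.
have lxE : (eta_ n w ord0 i)%:E @[n --> \oo] --> l%:E.
  by apply/cvg_EFin; [exact: nearW|exact: lx].
by have [_ E] := cvg_limn_einf_sup lxE; rewrite mxE E.
Qed.

End AeConvergence.

(** * Convex sets closed under bounded almost sure convergence *)

Section KreinSmulian.
Context {R : realType} {disp : measure_display} {T : measurableType disp}.
Context (P : probability T R) {d : nat}.
Implicit Types (xi eta zeta : T -> 'rV[R]_d) (K : set (T -> 'rV[R]_d)).
Local Notation Loo := (@vecLp R disp T P d +oo%E).

Let oo1 : (1 <= +oo :> \bar R)%E. Proof. exact: leey. Qed.

Definition density (m : nat) (phi : T -> R) := [/\ measurable_fun setT phi,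
  forall w, 0 <= phi w <= m%:R & \int[P]_w phi w <= 1].

(* The supremum of these integrals is the mean of |eta| over its upper tail of mass 1/m. *)
Definition tail_mean_le (m : nat) (c : R) eta := forall phi, density m phi ->
  \int[P]_w (enorm (eta w) * phi w) <= c.

(** Midpoints are the form of convexity that the parallelogram law consumes. *)
Definition midconvex K := forall xi eta, K xi -> K eta ->
  K (fun w => 2^-1 *: (xi w + eta w)).

(** The common bound c is what makes dominated convergence available to those who verify it. *)
Definition ae_closed K := forall (eta_ : nat -> T -> 'rV[R]_d) eta c,
  (forall n, K (eta_ n)) -> mvec eta -> (forall n, ae_bounded P c (eta_ n)) ->
  ae_cvg P eta_ eta -> K eta.

Lemma density_integrable m phi : density m phi -> integrableR P phi.
Proof.
move=> [mphi b _]; apply: (integrableR_le_ae mphi (integrableR_cst P m%:R)).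
by apply: aeW => w; have /andP[? ?] := b w; rewrite ger0_norm.
Qed.

Lemma density_le m n phi : (m <= n)%N -> density m phi -> density n phi.
Proof.
move=> mn [mphi b i]; split=> // w; have /andP[-> /= h] := b w.
by apply: le_trans h _; rewrite ler_nat.
Qed.

Lemma tail_mean_le_mono m n c eta : (m <= n)%N -> tail_mean_le n c eta -> tail_mean_le m c eta.
Proof. by move=> mn H phi /(density_le mn); exact: H. Qed.

Lemma ae_bounded_Loo c eta : mvec eta -> ae_bounded P c eta -> Loo eta.
Proof. by move=> me be; exact: (vecLp_bounded oo1 me be). Qed.

Lemma Loo_ae_bounded eta : Loo eta -> exists2 c, 0 <= c & ae_bounded P c eta.
Proof.
move=> /(Lfun_enorm) /LfunyP[_ [M hM]]; exists `|M| => //.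
by apply: filterS hM => w; rewrite ger0_norm ?enorm_ge0// => h; rewrite (le_trans h)// ler_norm.
Qed.

Lemma density_mul_integrable m phi eta : density m phi -> Loo eta ->
  integrableR P (fun w => enorm (eta w) * phi w).
Proof.
move=> dphi Le; have [c c0 bc] := Loo_ae_bounded Le.
have [mphi b _] := dphi.
apply: (integrableR_le_ae _ (integrableRZ c (density_integrable dphi))).
  by apply: measurable_funM => //; apply: measurable_enorm; exact: vecLp_mvec Le.
apply: filterS bc => w ec; have /andP[p0 _] := b w.
by rewrite ger0_norm ?mulr_ge0 ?enorm_ge0// ler_wpM2r.
Qed.

Lemma density_mul_le m phi eta c : density m phi -> mvec eta -> 0 <= c -> ae_bounded P c eta ->
  \int[P]_w (enorm (eta w) * phi w) <= c.
Proof.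
move=> dphi me c0 bc; have Le := ae_bounded_Loo me bc; have [_ b i] := dphi.
apply: (@le_trans _ _ (\int[P]_w (c * phi w))).
  apply: ae_le_Rintegral.
  - exact: density_mul_integrable dphi Le.
  - exact/integrableRZ/(density_integrable dphi).
  - by apply: filterS bc => w ec; have /andP[p0 _] := b w; rewrite ler_wpM2r.
rewrite RintegralZl//; last exact: (density_integrable dphi).
by rewrite ler_piMr.
Qed.

Lemma midconvex_tail_mean m c : midconvex (Loo `&` tail_mean_le m c).
Proof.
move=> xi eta [Lx hx] [Le he]; split.
  by apply: (vecLpZ oo1); exact: (vecLpD oo1).
move=> phi dphi; have Ix := density_mul_integrable dphi Lx.
have Ie := density_mul_integrable dphi Le; have [_ b _] := dphi.
apply: (@le_trans _ _ (\int[P]_w (2^-1 * (enorm (xi w) * phi w + enorm (eta w) * phi w)))).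
  apply: ae_le_Rintegral.
  - apply: density_mul_integrable dphi _.
    by apply: (vecLpZ oo1); exact: (vecLpD oo1).
  - by apply: integrableRZ; exact: integrableRD.
  apply: aeW => w; have /andP[p0 _] := b w.
  by rewrite enormZ ger0_norm// -mulrDl mulrA ler_wpM2r// ler_wpM2l// enormD.
rewrite RintegralZl//; last exact: integrableRD.
by rewrite RintegralD//; have := hx _ dphi; have := he _ dphi; lra.
Qed.

Lemma ae_closed_tail_mean m c : ae_closed (Loo `&` tail_mean_le m c).
Proof.
move=> eta_ eta b K_ me bd cv.
have be : ae_bounded P b eta := ae_bounded_cvg bd cv.
have Le : Loo eta by exact: ae_bounded_Loo be.
split => // phi dphi; have [mphi pb _] := dphi.
have H : \int[P]_w (enorm (eta_ n w) * phi w) @[n --> \oo] --> \int[P]_w (enorm (eta w) * phi w).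
  apply: (dominated_cvg_Rintegral _ _ (integrableRZ b (density_integrable dphi))).
  - move=> n; apply: measurable_funM => //; apply: measurable_enorm.
    exact: vecLp_mvec (K_ n).1.
  - by apply: measurable_funM => //; exact: measurable_enorm.
  - move=> n; apply: filterS (bd n) => w ec; have /andP[p0 _] := pb w.
    by rewrite ger0_norm ?mulr_ge0 ?enorm_ge0// ler_wpM2r.
  - by apply: filterS cv => w cw; apply: cvgMr_tmp; exact: cvg_enorm.
rewrite -(cvg_lim _ H)//; apply: limr_le; first by apply/cvg_ex; eexists; exact: H.
by apply: nearW => n; exact: (K_ n).2.
Qed.

(** If |eta| > c + [invS n] on an event A of positive mass, then the indicator of A divided by P(A)
    is a density of height 1 / P(A), and the mean of |eta| under it exceeds c. *)
Lemma tail_mean_bounded eta c : 0 <= c -> Loo eta -> (forall m, tail_mean_le m c eta) ->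
  ae_bounded P c eta.
Proof.
move=> c0 Le H; have me := vecLp_mvec Le.
suff Hn n : {ae P, forall w, enorm (eta w) <= c + invS n}.
  have /ae_foralln := Hn; apply: filterS => w hw; apply/ler_addgt0Pr => e e0.
  have [n ne] := exists_invS_lt e0.
  by apply: le_trans (hw n) _; rewrite lerD2l ltW.
pose A := [set w | c + invS n < enorm (eta w)].
have mA : measurable A.
  by apply: measurable_ltrs; [exact: measurable_cst|exact: measurable_enorm].
exists A; split=> //; last first.
  by move=> w /= h; rewrite /A /= ltNge; apply/negP.
apply: contrapT => PA0.
pose a := fine (P A).
have aE : P A = a%:E by rewrite fineK// fin_num_measure.
have a0 : 0 < a.
  rewrite lt_def -lee_fin -aE measure_ge0 andbT; apply/eqP => a0.
  by apply: PA0; rewrite aE a0.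
pose phi w := a^-1 * \1_A w.
have IA : integrableR P (\1_A) by exact: integrable_indic.
have iA : \int[P]_w \1_A w = a by rewrite /Rintegral integral_indic// setIT.
have dphi : density (Num.bound a^-1) phi.
  split.
  - by apply: measurable_funM; [exact: measurable_cst|exact: measurable_indic].
  - move=> w; rewrite /phi indicE; case: (_ \in _); rewrite ?mulr1 ?mulr0 ?lexx ?ler0n//.
    by rewrite invr_ge0 ltW//= ltW// archi_boundP// invr_ge0 ltW.
  - by rewrite RintegralZl// iA mulVf// gt_eqF.
have := H _ _ dphi; apply/negP; rewrite -ltNge.
apply: (@lt_le_trans _ _ (\int[P]_w ((c + invS n) * phi w))).
  rewrite RintegralZl//; last exact: (density_integrable dphi).
  rewrite RintegralZl// iA mulVf ?gt_eqF// mulr1.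
  by rewrite ltrDl invS_gt0.
apply: ae_le_Rintegral.
- exact/integrableRZ/(density_integrable dphi).
- exact: density_mul_integrable dphi Le.
apply: aeW => w; rewrite /phi indicE; have [/set_mem Aw|_] := boolP (w \in A).
  by rewrite ler_wpM2r ?mulr1 ?invr_ge0 ?(ltW a0)// ltW.
by rewrite !mulr0.
Qed.

Definition energy eta := \int[P]_w dotv (eta w) (eta w).

Lemma energy_integrable c eta : mvec eta -> ae_bounded P c eta ->
  integrableR P (fun w => dotv (eta w) (eta w)).
Proof.
move=> me bc; apply: (integrableR_le_ae _ (integrableR_cst P (c ^+ 2))).
  exact: measurable_dotv.
apply: filterS bc => w ec; rewrite ger0_norm ?dotv_ge0// -enorm_leE//.
exact: le_trans (enorm_ge0 _) ec.
Qed.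

Lemma energy_le c eta : mvec eta -> ae_bounded P c eta -> energy eta <= c ^+ 2.
Proof.
move=> me bc; rewrite -[leRHS](Rintegral_cstT P); apply: ae_le_Rintegral.
- exact: energy_integrable bc.
- exact: integrableR_cst.
apply: filterS bc => w ec; rewrite -enorm_leE//; exact: le_trans (enorm_ge0 _) ec.
Qed.

Lemma energy_ge0 eta : 0 <= energy eta.
Proof. by apply: Rintegral_ge0 => w _; exact: dotv_ge0. Qed.

Lemma energy_parallelogram c xi eta : mvec xi -> mvec eta ->
  ae_bounded P c xi -> ae_bounded P c eta ->
  energy (fun w => eta w - xi w) =
  2 * energy xi + 2 * energy eta - 4 * energy (fun w => 2^-1 *: (xi w + eta w)).
Proof.
move=> mx me bx be.
have Ix := energy_integrable mx bx; have Ie := energy_integrable me be.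
have bm : ae_bounded P c (fun w => 2^-1 *: (xi w + eta w)).
  apply: filterS2 bx be => w hx he; rewrite enormZ ger0_norm//.
  by have := enormD (xi w) (eta w); lra.
have mm : mvec (fun w => 2^-1 *: (xi w + eta w)).
  by apply: mvecZ => //; exact: mvecD.
have Im := energy_integrable mm bm.
rewrite /energy -!RintegralZl// -RintegralD//; [|exact: integrableRZ|exact: integrableRZ].
rewrite -RintegralB//; [|by apply: integrableRD; exact: integrableRZ|exact: integrableRZ].
apply: eq_Rintegral => w _.
rewrite !dotvZl !dotvZr !dotvDl !dotvDr !dotvNl !dotvNr (dotvC (xi w) (eta w)).
by field.
Qed.

(* The sets K_m are nonempty, bounded, convex, decreasing and closed: points of nearly minimal
   energy form a Cauchy sequence by the parallelogram law, and its limit lies in every K_m.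
   Cauchy-Schwarz is replaced by |x| <= (2^j |x|^2 + 2^-j) / 2. *)
Lemma decreasing_intersection (K_ : nat -> set (T -> 'rV[R]_d)) c :
  (forall m, midconvex (K_ m)) -> (forall m, ae_closed (K_ m)) ->
  (forall m n, (m <= n)%N -> K_ n `<=` K_ m) ->
  (forall m eta, K_ m eta -> mvec eta /\ ae_bounded P c eta) ->
  (forall m, K_ m !=set0) ->
  exists2 eta, ae_bounded P c eta & forall m, K_ m eta.
Proof.
move=> Kmid Kcl Kdec Kb K0.
pose En m := [set energy eta | eta in K_ m].
have En0 m : En m !=set0 by have [eta Ke] := K0 m; exists (energy eta); exists eta.
have Enlb m : has_lbound (En m) by exists 0 => _ [eta _ <-]; exact: energy_ge0.
pose D m := inf (En m).
have Dle m eta : K_ m eta -> D m <= energy eta by move=> Ke; apply: ge_inf => //; exists eta.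
have Dmono m n : (m <= n)%N -> D m <= D n.
  by move=> mn; apply: lb_le_inf => // _ [eta Ke <-]; apply: Dle; exact: Kdec Ke.
have Dub : has_ubound (range D).
  exists (c ^+ 2) => _ [m _ <-]; have [eta Ke] := K0 m.
  by apply: le_trans (Dle _ _ Ke) _; have [me be] := Kb _ _ Ke; exact: energy_le.
pose d0 := sup (range D).
have Dd0 m : D m <= d0 by apply: ub_le_sup => //; exists m.
(* eps j = 4^-j, so that squared distances of this order give L^1 distances of the summable order
   2^-j. *)
pose eps j : R := (2^-1 ^+ j) ^+ 2.
have eps0 j : 0 < eps j by rewrite !exprn_gt0.
(* The index is taken so late that the minimal energy there is within eps j of its limit d0, and the
   point is within eps j above it. *)
have /choice[f Hf] (j : nat) : exists x : nat * (T -> 'rV[R]_d), [/\ (j <= x.1)%N,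
    d0 - eps j < D x.1, K_ x.1 x.2 & energy x.2 < d0 + eps j].
  have [|_ [m _ <-] Dm] := sup_adherent (eps0 j) (E := range D).
    by split => //; exists (D 0%N); exists 0%N.
  pose m' := maxn m j.
  have [|_ [eta Ke <-] ee] := inf_adherent (eps0 j) (E := En m').
    by split.
  exists (m', eta); split => //=; first exact: leq_maxr.
    by apply: lt_le_trans Dm _; apply: Dmono; exact: leq_maxl.
  by apply: lt_le_trans ee _; rewrite lerD2r; exact: Dd0.
pose eta_ j := (f j).2.
have K_eta m j : (m <= j)%N -> K_ m (eta_ j).
  by move=> mj; have [jf _ Kf _] := Hf j; apply: Kdec Kf; exact: leq_trans jf.
have me j : mvec (eta_ j) by have [_ _ Kf _] := Hf j; have [] := Kb _ _ Kf.
have be j : ae_bounded P c (eta_ j) by have [_ _ Kf _] := Hf j; have [] := Kb _ _ Kf.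
(* Both energies are below d0 + eps j, and the midpoint, lying in the larger of the two sets, has
   energy above d0 - eps j: 4 eps j + 4 eps j in the parallelogram law. *)
have diff j : energy (fun w => eta_ j.+1 w - eta_ j w) <= 8 * eps j.
  rewrite (energy_parallelogram (me j) (me j.+1) (be j) (be j.+1)).
  have [_ Dj Kj ej] := Hf j; have [_ Dj1 Kj1 ej1] := Hf j.+1.
  have e1 : eps j.+1 <= eps j.
    rewrite /eps ler_sqr ?nnegrE ?exprn_ge0// exprS ler_piMl ?exprn_ge0//; lra.
  have [mm|mm] := leqP (f j).1 (f j.+1).1.
    have := Dle _ _ (Kmid _ _ _ Kj (Kdec _ _ mm _ Kj1)).
    by rewrite -/(eta_ j) -/(eta_ j.+1) in ej ej1 *; lra.
  have := Dle _ _ (Kmid _ _ _ (Kdec _ _ (ltnW mm) _ Kj) Kj1).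
  by rewrite -/(eta_ j) -/(eta_ j.+1) in ej ej1 *; lra.
have mdiff j : mvec (fun w => eta_ j.+1 w - eta_ j w) by exact: mvecB.
have bdiff j : ae_bounded P (c + c) (fun w => eta_ j.+1 w - eta_ j w).
  apply: filterS2 (be j) (be j.+1) => w h1 h2; apply: le_trans (enormD _ _) _.
  by rewrite enormN lerD.
have Idiff j := energy_integrable (mdiff j) (bdiff j).
have In j : integrableR P (fun w => enorm (eta_ j.+1 w - eta_ j w)).
  apply: (integrableR_le_ae _ (integrableR_cst P (c + c))); first exact: measurable_enorm.
  by apply: filterS (bdiff j) => w; rewrite ger0_norm ?enorm_ge0.
(* With h = 2^-j, integrating |x| <= |x|^2 / (2h) + h / 2 against the bound 8 h^2 gives 4h + h / 2
   <= 5h. *)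
have L1 j : \int[P]_w enorm (eta_ j.+1 w - eta_ j w) <= 5 * 2^-1 ^+ j.
  have h0 : 0 < (2^-1 : R) ^+ j by rewrite exprn_gt0.
  have [h hE] : exists h : R, h = 2^-1 ^+ j by eexists.
  rewrite -hE in h0 *.
  apply: (@le_trans _ _ (\int[P]_w ((2 * h)^-1 * dotv (eta_ j.+1 w - eta_ j w) (eta_ j.+1 w - eta_ j w) + h / 2))).
    apply: ae_le_Rintegral => //.
      by apply: integrableRD; [exact: (integrableRZ (2 * h)^-1 (Idiff j))|exact: integrableR_cst].
    apply: aeW => w; rewrite -sqr_enorm; move: (enorm _) => x.
    rewrite -subr_ge0 (_ : _ - _ = (2 * h)^-1 * (x - h) ^+ 2).
      by rewrite mulr_ge0 ?sqr_ge0// invr_ge0 mulr_ge0// ltW.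
    by field; rewrite gt_eqF.
  rewrite RintegralD//; [|exact: (integrableRZ (2 * h)^-1 (Idiff j))|exact: integrableR_cst].
  rewrite [X in X + _]RintegralZl//; last exact: (Idiff j).
  rewrite Rintegral_cstT; have := diff j; rewrite /energy /eps -hE => dj.
  have : (2 * h)^-1 * \int[P]_w dotv (eta_ j.+1 w - eta_ j w) (eta_ j.+1 w - eta_ j w) <= (2 * h)^-1 * (8 * h ^+ 2).
    by rewrite ler_wpM2l// invr_ge0 mulr_ge0// ltW.
  by rewrite (_ : (2 * h)^-1 * (8 * h ^+ 2) = 4 * h); [lra|field; rewrite gt_eqF].
(* 10 is the sum of the geometric series of the 5 / 2^j. *)
have [|eta meta cveta] := @ae_cvg_of_series _ _ _ P d eta_ 10 me In.
  move=> n; suff : \sum_(0 <= j < n) \int[P]_w enorm (eta_ j.+1 w - eta_ j w) <= 10 - 10 * 2^-1 ^+ n.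
    by have : 0 <= (2^-1 : R) ^+ n by [rewrite exprn_ge0|]; lra.
  elim: n => [|n IH]; first by rewrite big_geq// expr0; lra.
  by rewrite big_nat_recr//= exprS; have := L1 n; lra.
exists eta; first exact: ae_bounded_cvg be cveta.
move=> m; apply: (Kcl m (fun n => eta_ (n + m)%N) eta c) => //.
- by move=> n; apply: K_eta; exact: leq_addl.
- apply: filterS cveta => w cw i.
  by rewrite (@cvg_shiftn m _ (fun n => eta_ n w ord0 i)).
Qed.

(** If every m failed, the elements of K bounded by c' with tail mean of order m at most c would
    form decreasing nonempty sets. A common point has all its tail means at most c, so it is bounded
    by c, which K excludes. *)
Lemma tail_mean_step K c c' : K `<=` Loo -> midconvex K -> ae_closed K -> 0 <= c ->
  (forall eta, K eta -> ~ ae_bounded P c eta) ->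
  exists m, forall eta, K eta -> tail_mean_le m c eta -> ~ ae_bounded P c' eta.
Proof.
move=> KL Kmid Kcl c0 Kc; apply: contrapT => H.
pose K_ m := [set eta | K eta /\ tail_mean_le m c eta /\ ae_bounded P c' eta].
have K0 m : K_ m !=set0.
  apply: contrapT => nK; apply: H; exists m => eta Ke te be; apply: nK.
  by exists eta.
have Kb m eta : K_ m eta -> mvec eta /\ ae_bounded P c' eta.
  by move=> [Ke [_ be]]; split => //; exact: vecLp_mvec (KL _ Ke).
have Kdec m n : (m <= n)%N -> K_ n `<=` K_ m.
  by move=> mn eta [Ke [te be]]; split => //; split => //; exact: tail_mean_le_mono te.
have Km m : midconvex (K_ m).
  move=> xi eta [Kx [tx bx]] [Ke [te be]]; split; first exact: Kmid.
  split; first exact: (midconvex_tail_mean (conj (KL _ Kx) tx) (conj (KL _ Ke) te)).2.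
  apply: filterS2 bx be => w hx he; rewrite enormZ ger0_norm//.
  by have := enormD (xi w) (eta w); lra.
have Kcl' m : ae_closed (K_ m).
  move=> eta_ eta b K_eta me bd cv; split.
    by apply: (Kcl eta_ eta b) => // n; have [] := K_eta n.
  split.
    apply: (@ae_closed_tail_mean m c eta_ eta b _ me bd cv).2 => n.
    by have [Ke [te _]] := K_eta n; split => //; exact: KL.
  by apply: (ae_bounded_cvg _ cv) => n; have [_ []] := K_eta n.
have [eta _ He] := decreasing_intersection Km Kcl' Kdec Kb K0.
have Ke : K eta := (He 0%N).1.
by apply: (Kc _ Ke); apply: tail_mean_bounded => // [|m]; [exact: KL|exact: (He m).2.1].
Qed.

End KreinSmulian.

(** * The seminorm made of weighted tail means *)

Section TailSeminorm.
Context {R : realType} {disp : measure_display} {T : measurableType disp}.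
Context (P : probability T R) {d : nat}.
Implicit Types (xi eta zeta : T -> 'rV[R]_d) (K : set (T -> 'rV[R]_d)).
Local Notation Loo := (@vecLp R disp T P d +oo%E).
Variable m_ : nat -> nat.

Let oo1 : (1 <= +oo :> \bar R)%E. Proof. exact: leey. Qed.

Definition tail_values eta : set R :=
  [set x | exists k phi, density P (m_ k) phi /\
    x = invS k * \int[P]_w (enorm (eta w) * phi w)].

Definition tail_seminorm eta := sup (tail_values eta).

Lemma density0 m : density P m (fun=> 0).
Proof.
split; first exact: measurable_cst.
  by move=> w; rewrite lexx ler0n.
by rewrite Rintegral_cstT.
Qed.

Lemma tail_values0 eta : tail_values eta 0.
Proof.
exists 0%N, (fun=> 0); split; first exact: density0.
by under eq_Rintegral do rewrite mulr0; rewrite Rintegral_cstT mulr0.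
Qed.

Lemma tail_values_le eta c : mvec eta -> 0 <= c -> ae_bounded P c eta ->
  ubound (tail_values eta) c.
Proof.
move=> me c0 bc _ [k [phi [dphi ->]]].
have := density_mul_le dphi me c0 bc; set I := Rintegral _ _ _ => Ic.
have k1 : invS k <= 1 :> R by rewrite -[leRHS](_ : invS 0 = 1) ?invS_le// /invS invr1.
have [I0|I0] := leP 0 I.
  by apply: le_trans Ic; rewrite ler_piMl.
by apply: le_trans c0; rewrite mulr_ge0_le0// ltW// invS_gt0.
Qed.

Lemma tail_values_ub eta : Loo eta -> has_ubound (tail_values eta).
Proof.
move=> Le; have [c c0 bc] := Loo_ae_bounded Le.
by exists c; apply: tail_values_le => //; exact: vecLp_mvec Le.
Qed.

Lemma tail_seminorm_ge eta k phi : Loo eta -> density P (m_ k) phi ->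
  invS k * \int[P]_w (enorm (eta w) * phi w) <= tail_seminorm eta.
Proof. by move=> Le dphi; apply: ub_le_sup; [exact: tail_values_ub|exists k, phi]. Qed.

Lemma tail_seminorm_le eta a : (forall k phi, density P (m_ k) phi ->
  invS k * \int[P]_w (enorm (eta w) * phi w) <= a) -> tail_seminorm eta <= a.
Proof.
move=> H; apply: ge_sup; first by exists 0; exact: tail_values0.
by move=> _ [k [phi [dphi ->]]]; exact: H.
Qed.

Lemma tail_seminorm_ge0 eta : Loo eta -> 0 <= tail_seminorm eta.
Proof. by move=> Le; apply: ub_le_sup; [exact: tail_values_ub|exact: tail_values0]. Qed.

Let seminorm_scale_le c xi : Loo xi -> tail_seminorm (fun w => c *: xi w) <= `|c| * tail_seminorm xi.
Proof.
move=> Lx; apply: tail_seminorm_le => k phi dphi.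
under eq_Rintegral do rewrite enormZ -mulrA.
rewrite RintegralZl//; last exact: (density_mul_integrable dphi Lx).
by rewrite mulrCA ler_wpM2l// tail_seminorm_ge.
Qed.

Let indic_density k phi A eta M : density P (m_ k) phi -> measurable A -> mvec eta -> 0 <= M ->
  ae_bounded P M eta ->
  \int[P]_w (enorm (\1_A w *: eta w) * phi w) <= M * (m_ k)%:R * \int[P]_w \1_A w.
Proof.
move=> dphi mA me M0 bM; have [_ b _] := dphi.
have IA : integrableR P (\1_A) by exact: integrable_indic.
have bA : ae_bounded P M (fun w => \1_A w *: eta w).
  apply: filterS bM => w h; rewrite enormZ indicE; case: (_ \in _); rewrite ?normr1 ?mul1r//.
  by rewrite normr0 mul0r.
have LA : Loo (fun w => \1_A w *: eta w).
  by apply: ae_bounded_Loo bA; apply: mvecZ => //; exact: measurable_indic.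
rewrite -RintegralZl//; apply: ae_le_Rintegral.
- exact: density_mul_integrable dphi LA.
- exact: integrableRZ.
- apply: filterS bM => w h; have /andP[p0 pm] := b w; rewrite enormZ indicE.
  case: (_ \in _); rewrite ?normr1 ?mul1r ?mulr1 ?normr0 ?mul0r ?mulr0//.
  by apply: ler_pM => //; exact: enorm_ge0.
Qed.

(** For order continuity the supremum is split at k0: late terms are small through the weight
    [invS k], whatever the density; the finitely many early ones involve densities with a common
    bound, so they vanish with P(A n). *)
Lemma cs_tail_seminorm : continuous_seminorm P +oo tail_seminorm.
Proof.
split => //.
- move=> xi eta Lx Le; apply: tail_seminorm_le => k phi dphi.
  have Ix := density_mul_integrable dphi Lx; have Ie := density_mul_integrable dphi Le.
  apply: le_trans (lerD (tail_seminorm_ge Lx dphi) (tail_seminorm_ge Le dphi)).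
  rewrite -mulrDr ler_wpM2l ?(ltW (invS_gt0 _ _))// -RintegralD//.
  apply: ae_le_Rintegral.
  + by apply: density_mul_integrable dphi _; exact: (vecLpD oo1).
  + exact: integrableRD.
  + apply: aeW => w; have [_ /(_ w)/andP[p0 _] _] := dphi.
    by rewrite -mulrDl ler_wpM2r// enormD.
- move=> c xi Lx; apply/eqP; rewrite eq_le seminorm_scale_le//=.
  have [->|c0] := eqVneq c 0.
    by rewrite normr0 mul0r; apply: tail_seminorm_ge0; exact: (vecLpZ oo1).
  rewrite -ler_pdivlMl ?normr_gt0// -normfV.
  rewrite [X in tail_seminorm X <= _](_ : xi = fun w => c^-1 *: (c *: xi w)).
    by apply: seminorm_scale_le; exact: (vecLpZ oo1).
  by apply/funext => w; rewrite scalerA mulVf// scale1r.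
- move=> xi eta mx Le xe.
  have Lx : Loo xi by apply: (vecLp_le oo1 mx (Lfun_enorm Le)).
  apply: tail_seminorm_le => k phi dphi.
  apply: le_trans (tail_seminorm_ge Le dphi); rewrite ler_wpM2l ?(ltW (invS_gt0 _ _))//.
  apply: ae_le_Rintegral.
  + exact: density_mul_integrable dphi Lx.
  + exact: density_mul_integrable dphi Le.
  + apply: filterS xe => w h; have [_ /(_ w)/andP[p0 _] _] := dphi.
    by rewrite ler_wpM2r.
- move=> xi A Lx mA Aev.
  have [M M0 bM] := Loo_ae_bounded Lx; have mx := vecLp_mvec Lx.
  have PA0 : \int[P]_w (\1_(A n) w : R) @[n --> \oo] --> (0 : R).
    rewrite -[X in _ --> X](Rintegral_cstT P).
    apply: (dominated_cvg_Rintegral _ _ (integrableR_cst P 1)).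
    + by move=> n; exact: measurable_indic.
    + exact: measurable_cst.
    + by move=> n; apply: aeW => w; rewrite indicE; case: (_ \in _); rewrite ?normr1// normr0.
    + apply: filterS Aev => w [n0 hn]; apply: cvg_near_cst; near=> n.
      by rewrite indicE memNset//; apply: hn; near: n; exact: nbhs_infty_ge.
  have LA n : Loo (fun w => \1_(A n) w *: xi w).
    apply: (vecLp_le oo1 _ (Lfun_enorm Lx)).
      by apply: mvecZ => //; exact: measurable_indic.
    apply: aeW => w; rewrite enormZ indicE; case: (_ \in _); rewrite ?normr1 ?mul1r//.
    by rewrite normr0 mul0r enorm_ge0.
  apply/cvgr0Pnorm_le => e e0.
  have [k0 hk0] := exists_invS_lt (divr_gt0 (divr_gt0 e0 (ltr0n R 2)) (ltr_pwDl ltr01 M0)).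
  (* The sum serves as one bound for all [m_ j] with j < k0. *)
  pose B : R := \sum_(j < k0) (m_ j)%:R.
  have B0 : 0 <= B by apply: sumr_ge0.
  have /cvgr0Pnorm_le H : M * B * \int[P]_w (\1_(A n) w : R) @[n --> \oo] --> (0 : R).
    by rewrite -(mulr0 (M * B)); exact: cvgMl_tmp.
  near=> n.
  have hn : `|M * B * \int[P]_w (\1_(A n) w : R)| <= e / 2.
    by near: n; apply: H; rewrite divr_gt0.
  have IA0 : 0 <= \int[P]_w (\1_(A n) w : R) by apply: Rintegral_ge0.
  rewrite ger0_norm ?tail_seminorm_ge0//; apply: tail_seminorm_le => k phi dphi.
  have k0' : 0 < invS k :> R by exact: invS_gt0.
  have [kk|kk] := ltnP k k0.
    apply: (@le_trans _ _ (e / 2)); last lra.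
    apply: le_trans (le_trans (ler_norm _) hn).
    apply: (@le_trans _ _ (1 * \int[P]_w (enorm (\1_(A n) w *: xi w) * phi w))).
      apply: ler_wpM2r; last by rewrite -[leRHS](_ : invS 0 = 1) ?invS_le// /invS invr1.
      apply: Rintegral_ge0 => w _; have [_ /(_ w)/andP[p0 _] _] := dphi.
      by rewrite mulr_ge0 ?enorm_ge0.
    rewrite mul1r; apply: le_trans (indic_density dphi (mA n) mx M0 bM) _.
    rewrite ler_wpM2r// ler_wpM2l// /B (bigD1 (Ordinal kk))//= lerDl; exact: sumr_ge0.
  have bA : ae_bounded P M (fun w => \1_(A n) w *: xi w).
    apply: filterS bM => w h; rewrite enormZ indicE; case: (_ \in _); rewrite ?normr1 ?mul1r//.
    by rewrite normr0 mul0r.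
  have := density_mul_le dphi (vecLp_mvec (LA n)) M0 bA; set I := Rintegral _ _ _ => IM.
  have kk' : invS k <= invS k0 :> R by exact: invS_le.
  apply: (@le_trans _ _ (invS k * M)); first by rewrite ler_wpM2l// ltW.
  apply: (@le_trans _ _ (invS k0 * (1 + M))).
    by apply: ler_pM => //; [exact: ltW|lra].
  move: hk0; rewrite ltr_pdivlMr; last lra.
  by move=> hk0; lra.
Unshelve. all: by end_near.
Qed.

End TailSeminorm.

(** * Separation of a convex set from 0 in L^oo *)

Section Separation.
Context {R : realType} {disp : measure_display} {T : measurableType disp}.
Context (P : probability T R) {d : nat}.
Implicit Types (xi eta zeta : T -> 'rV[R]_d) (K D : set (T -> 'rV[R]_d)).
Local Notation Loo := (@vecLp R disp T P d +oo%E).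

Let oo1 : (1 <= +oo :> \bar R)%E. Proof. exact: leey. Qed.

(** K_ n collects the elements of D whose k-th tail mean is at most delta (k+1) for all k < n, and
    the m_k are chosen so that none of them is bounded by delta (n+1). An element of D with N <=
    delta would belong to every K_ n, although it is bounded. *)
Theorem separating_seminorm_infty D : D `<=` Loo -> midconvex D -> ae_closed P D -> ~ D (fun=> 0) ->
  exists N, exists2 delta : R, 0 < delta &
    continuous_seminorm P +oo N /\ forall eta, D eta -> delta < N eta.
Proof.
move=> DL Dmid Dcl D0.
(* Otherwise elements of D bounded by [invS n] would converge uniformly to 0 and put 0 in D. *)
have [delta delta0 Dd] : exists2 delta : R, 0 < delta & forall eta, D eta -> ~ ae_bounded P delta eta.
  apply: contrapT => H.
  have /choice[eta_ He] (n : nat) : exists eta, D eta /\ ae_bounded P (invS n) eta.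
    apply: contrapT => h; apply: H; exists (invS n); first exact: invS_gt0.
    by move=> eta De be; apply: h; exists eta.
  apply: D0; apply: (Dcl eta_ _ 1).
  - by move=> n; have [] := He n.
  - exact: mvec_cst.
  - move=> n; apply: filterS (He n).2 => w h; apply: le_trans h _.
    by rewrite -[leRHS](_ : invS 0 = 1) ?invS_le// /invS invr1.
  - have /ae_foralln : forall n, {ae P, forall w, enorm (eta_ n w) <= invS n}.
      by move=> n; have [] := He n.
    apply: filterS => w h i; rewrite mxE; apply/cvgr0Pnorm_le => e e0.
    have [k ke] := exists_invS_lt e0; near=> n.
    apply: le_trans (enorm_coord_le _ _) (le_trans (h n) _).
    apply: le_trans (ltW ke); apply: invS_le; near: n; exact: nbhs_infty_ge.
(* The invariant of the recursion; its last clause advances from delta (n+1) to delta (n+2) by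
   [tail_mean_step]. *)
pose good (n : nat) K := [/\ K `<=` Loo, midconvex K, ae_closed P K &
  forall eta, K eta -> ~ ae_bounded P (delta * n.+1%:R) eta].
have /choice[f Hf] (x : nat * set (T -> 'rV[R]_d)) : exists m, good x.1 x.2 ->
    good x.1.+1 (x.2 `&` tail_mean_le P m (delta * x.1.+1%:R)).
  case: x => n K /=; have [[KL Kmid Kcl Kb]|nG] := pselect (good n K); last by exists 0%N.
  have c0 : 0 <= delta * n.+1%:R by rewrite mulr_ge0// ltW.
  have [m Hm] := tail_mean_step (delta * n.+2%:R) KL Kmid Kcl c0 Kb.
  exists m => _; split.
  - by move=> eta [/KL].
  - move=> xi eta [Kx tx] [Ke te]; split; first exact: Kmid.
    exact: (midconvex_tail_mean (conj (KL _ Kx) tx) (conj (KL _ Ke) te)).2.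
  - move=> eta_ eta b K_eta me bd cv; split.
      by apply: (Kcl eta_ eta b) => // k; have [] := K_eta k.
    apply: (@ae_closed_tail_mean _ _ _ P d m (delta * n.+1%:R) eta_ eta b _ me bd cv).2 => k.
    by have [Ke te] := K_eta k; split => //; exact: KL.
  - by move=> eta [Ke te]; exact: Hm.
pose K_ := fix K_ n := if n is k.+1 then
  K_ k `&` tail_mean_le P (f (k, K_ k)) (delta * k.+1%:R) else D.
have HK n : good n (K_ n).
  elim: n => [|n IH]; first by split => //; rewrite mulr1.
  exact: (Hf (n, K_ n) IH).
pose m_ n := f (n, K_ n).
exists (tail_seminorm P m_), delta => //; split; first exact: cs_tail_seminorm.
move=> eta De; have Le := DL _ De; rewrite ltNge; apply/negP => Nle.
have tm k : tail_mean_le P (m_ k) (delta * k.+1%:R) eta.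
  move=> phi dphi; have := le_trans (tail_seminorm_ge Le dphi) Nle.
  by rewrite /invS ler_pdivrMl// mulrC.
have KK n : K_ n eta by elim: n => [//|n IH] /=; split => //; exact: tm.
have [c c0 bc] := Loo_ae_bounded Le.
(* At this index n the excluded bound delta (n+1) exceeds the bound c of eta. *)
have [_ _ _ /(_ _ (KK (Num.bound (c / delta))))] := HK (Num.bound (c / delta)); apply.
apply: filterS bc => w h; apply: le_trans h _.
rewrite mulrC -ler_pdivrMr//; apply: ltW; apply: lt_le_trans (archi_boundP _) _.
  by rewrite divr_ge0// ltW.
by rewrite ler_nat.
Unshelve. all: by end_near.
Qed.

End Separation.

(** * Separation of weakly sequentially closed convex sets from 0 *)

Section WeakSeparation.
Context {R : realType} {disp : measure_display} {T : measurableType disp}.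
Context (P : probability T R) {d : nat} {p q : \bar R}.
Hypotheses (p1 : (1 <= p)%E) (pq : (p^-1 + q^-1 = 1)%E).
Implicit Types (xi eta zeta : T -> 'rV[R]_d) (D : set (T -> 'rV[R]_d)).
Local Notation W := (@vecLp R disp T P d p).
Local Notation V := (@vecLp R disp T P d q).

Let q1 : (1 <= q)%E. Proof. exact: conjugate_ge1 p1 pq. Qed.

Definition weak_cvg (eta_ : nat -> T -> 'rV[R]_d) eta := forall zeta, V zeta ->
  pairing P (eta_ n) zeta @[n --> \oo] --> pairing P eta zeta.

Definition weak_seq_closed D := forall (eta_ : nat -> T -> 'rV[R]_d) eta,
  (forall n, D (eta_ n)) -> W eta -> weak_cvg eta_ eta -> D eta.

Lemma norm_pairing_le M (f : T -> R) eta zeta : W eta -> V zeta -> integrableR P f ->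
  {ae P, forall w, enorm (eta w) * enorm (zeta w) <= f w} -> \int[P]_w f w <= M ->
  `|pairing P eta zeta| <= M.
Proof.
move=> Le Lz If ef fM; rewrite pairingE.
have I := pairing_integrable p1 pq Le Lz.
apply: le_trans (le_normr_Rintegral measurableT I) (le_trans _ fM).
apply: ae_le_Rintegral => //; first exact: integrableR_norm.
apply: filterS ef => w; apply: le_trans; exact: dotv_abs_enorm.
Qed.

(** Each exponent has its own mode of convergence that implies the weak one: bounded almost sure
    convergence for p = oo, by domination, and norm convergence for finite p, by Hoelder's
    inequality. *)
Lemma separating_seminorm D : D `<=` W -> midconvex D -> weak_seq_closed D -> ~ D (fun=> 0) ->
  exists N, exists2 delta : R, 0 < delta &
    continuous_seminorm P p N /\ forall eta, D eta -> delta < N eta.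
Proof.
move=> DW Dmid Dcl D0; have [poo|pfin] := eqVneq p +oo%E.
  move: Dcl; rewrite /weak_seq_closed => Dcl; move: poo p1 pq DW Dcl => -> oo1 ooq DW Dcl.
  apply: separating_seminorm_infty => // eta_ eta c De me bd cv.
  have Le : vecLp P +oo eta by exact: (ae_bounded_Loo me (ae_bounded_cvg bd cv)).
  apply: (Dcl eta_) => // zeta Lz; rewrite pairingE; under eq_fun do rewrite pairingE.
  have mz := vecLp_mvec Lz.
  have Iz : integrableR P (fun w => enorm (zeta w)) by exact: Lfun_integrableR (Lfun_enorm Lz).
  apply: (dominated_cvg_Rintegral _ _ (integrableRZ c Iz)).
  - by move=> n; apply: measurable_dotv => //; exact: vecLp_mvec (DW _ (De n)).
  - exact: measurable_dotv.
  - move=> n; apply: filterS (bd n) => w h; apply: le_trans (dotv_abs_enorm _ _) _.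
    by rewrite ler_wpM2r// enorm_ge0.
  - by apply: filterS cv => w; exact: cvg_dotv.
exists (fun xi => nrm P p (fun w => enorm (xi w))).
apply: contrapT => H.
have /choice[eta_ He] (n : nat) : exists eta, D eta /\ nrm P p (fun w => enorm (eta w)) <= invS n.
  apply: contrapT => h; apply: H; exists (invS n); first exact: invS_gt0.
  split; first exact: cs_nrm.
  by move=> eta De; rewrite ltNge; apply/negP => he; apply: h; exists eta.
apply: D0; apply: (Dcl eta_) => //; first by move=> n; have [] := He n.
  exact: vecLp0.
move=> zeta Lz.
have -> : pairing P (fun=> 0) zeta = 0.
  by rewrite pairingE; under eq_Rintegral do rewrite dotv0l; rewrite Rintegral_cstT.
have [M M0 hM] := hoelder_Lfun p1 pq (Lfun_enorm Lz).
apply/cvgr0Pnorm_le => e e0.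
have [k ke] := exists_invS_lt (divr_gt0 e0 (ltr_pwDl ltr01 M0)).
near=> n; have Len := DW _ (He n).1.
have [In hn] := hM _ (Lfun_enorm Len).
apply: (norm_pairing_le Len Lz (integrableR_norm In)).
  by apply: aeW => w; exact: ler_norm.
apply: le_trans hn _; have nk : invS n <= invS k :> R.
  by apply: invS_le; near: n; exact: nbhs_infty_ge.
have := (He n).2; set N := nrm _ _ _ => hN.
apply: (@le_trans _ _ (M * invS k)); first by rewrite ler_wpM2l// (le_trans hN).
have k0 := invS_gt0 R k.
by move: ke; rewrite ltr_pdivlMr; [lra|lra].
Unshelve. all: by end_near.
Qed.

End WeakSeparation.

(** * The weak topology *)

Section WeakTopology.
Context {R : realType} {disp : measure_display} {T : measurableType disp}.
Context (P : probability T R) {d : nat} {p q : \bar R}.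
Hypotheses (p1 : (1 <= p)%E) (pq : (p^-1 + q^-1 = 1)%E).
Implicit Types (xi eta zeta : T -> 'rV[R]_d) (S A : set (T -> 'rV[R]_d)).
Local Notation W := (@vecLp R disp T P d p).
Local Notation V := (@vecLp R disp T P d q).
Local Notation weak := (@weakLq R disp T P d p q).

Let q1 : (1 <= q)%E. Proof. exact: conjugate_ge1 p1 pq. Qed.

(* The library states pointwise_cvgP for a topological index type only, although the topology of
   pointwise convergence does not depend on that topology. *)
Let U : topologicalType := initial_topology (fun _ : set_type W => 0 : R).

Definition polarLp S : set (T -> 'rV[R]_d) :=
  [set zeta | V zeta /\ forall xi, S xi -> pairing P xi zeta <= 0].

Lemma continuous_pairing xi : W xi -> continuous (fun z : weak => pairing P xi (val z)).
Proof.
move=> Lx z; have xiW : xi \in W by exact: mem_set.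
pose x : set_type W := SigSub xiW.
have h := @initial_continuous _ _ (@weak_eval R disp T P d p q) z.
have FF : Filter (@weak_eval R disp T P d p q @ nbhs (z : weak)) by exact: fmap_filter.
exact: ((@pointwise_cvgP U R _ _ FF).1 h x).
Qed.

Lemma polarLp_closed S : S `<=` W -> weakly_closed P p q (polarLp S).
Proof.
move=> SW; rewrite /weakly_closed.
rewrite (_ : weak_trace _ = \bigcap_(xi in S) [set z : weak | pairing P xi (val z) <= 0]).
  apply: closed_bigI => xi Sx.
  apply: (@closed_comp _ _ (fun z : weak => pairing P xi (val z)) [set r | r <= 0]).
    by move=> z _; exact: continuous_pairing (SW _ Sx) z.
  exact: closed_le.
apply/seteqP; split=> [z [_ h] xi Sx|z h]; first exact: h.
by split; [exact: set_mem (valP z)|move=> xi Sx; exact: h].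
Qed.

Lemma polarLp_cone S : S `<=` W -> cone (polarLp S).
Proof.
move=> SW; split.
  exists (fun=> 0); split; first exact: vecLp0.
  move=> xi Sx; rewrite pairingE; under eq_Rintegral do rewrite dotv0r.
  by rewrite Rintegral_cstT.
move=> c zeta c0 [Lz h]; split; first exact: (vecLpZ q1).
move=> xi Sx; rewrite (pairingZr p1 pq)//; last exact: SW.
by rewrite mulr_ge0_le0// h.
Qed.

Lemma polarLp_add S zeta1 zeta2 : S `<=` W -> polarLp S zeta1 -> polarLp S zeta2 ->
  polarLp S (zeta1 + zeta2).
Proof.
move=> SW [L1 h1] [L2 h2]; split; first exact: (vecLpD q1).
move=> xi Sx; rewrite (pairingDr p1 pq)//; last exact: SW.
by have := h1 _ Sx; have := h2 _ Sx; lra.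
Qed.

Lemma polarLp_convex S : S `<=` W -> @convex_set R (T -> 'rV[R]_d) (polarLp S).
Proof.
move=> SW; apply/convex_setP => x y t Sx Sy /andP[t0 t1].
have [_ cZ] := polarLp_cone SW.
by apply: polarLp_add => //; apply: cZ => //; rewrite subr_ge0.
Qed.

(** The filter generated by the traces on A of the basic neighbourhoods of zeta, each given by
    finitely many xi and one error, is proper and converges weakly to zeta. *)
Lemma weak_closure_intro A zeta : V zeta -> A `<=` V ->
  (forall (s : seq (set_type W)) (e : R), 0 < e -> exists2 eta, A eta &
    forall x, x \in s -> `|pairing P (val x) zeta - pairing P (val x) eta| < e) ->
  weak_closure P p q A zeta.
Proof.
move=> Lz AV H; have zV : zeta \in V by exact: mem_set.
exists (SigSub zV) => //.
pose B (i : seq (set_type W) * R) : set weak := [set y | A (val y) /\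
  forall x, x \in i.1 -> `|pairing P (val x) zeta - pairing P (val x) (val y)| < i.2].
pose D : set (seq (set_type W) * R) := [set i | 0 < i.2].
have FF : ProperFilter (filter_from D B).
  apply: filter_from_proper.
    apply: filter_from_filter; first by exists ([::], 1); exact: ltr01.
    move=> [s1 e1] [s2 e2] /= e10 e20; exists (s1 ++ s2, Num.min e1 e2).
      by rewrite /D /= lt_min e10.
    move=> y [Ay h]; split; (split => // x xs; apply: lt_le_trans (h x _) _).
    - by rewrite mem_cat xs.
    - by rewrite ge_min lexx.
    - by rewrite mem_cat xs orbT.
    - by rewrite ge_min lexx orbT.
  move=> [s e] /= e0; have [eta Ae he] := H s e e0.
  by exists (SigSub (mem_set (AV _ Ae))).
rewrite closureEcvg; exists (filter_from D B) => //; split; last first.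
  move=> Q AQ; exists ([::], 1); first exact: ltr01.
  by move=> y [Ay _]; exact: AQ.
have cv : (@weak_eval R disp T P d p q) @ (filter_from D B) -->
    @weak_eval R disp T P d p q (SigSub zV).
  apply/(@pointwise_cvgP U R) => x; apply/cvgrPdist_lt => e e0.
  exists ([:: x], e) => // y [_ hy]; apply: hy; exact: mem_head.
move=> Q [B0 [] [D0 oD DE] Dz DQ]; rewrite -DE in Dz DQ.
have /cv : nbhs (@weak_eval R disp T P d p q (SigSub zV)) D0 by exact: open_nbhs_nbhs.
move=> h; exact: (filterS DQ h).
Qed.

Lemma pairing_sum k (a : 'rV[R]_k) (x : 'I_k -> T -> 'rV[R]_d) zeta :
  (forall i, W (x i)) -> V zeta ->
  W (fun w => \sum_i a ord0 i *: x i w) /\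
  pairing P (fun w => \sum_i a ord0 i *: x i w) zeta =
  dotv a (\row_i pairing P (x i) zeta).
Proof.
move=> Wx Lz; rewrite /dotv; under [in RHS]eq_bigr do rewrite mxE.
elim: k a x Wx => [|k IH] a x Wx.
  have -> : (fun w => \sum_i a ord0 i *: x i w) = fun=> 0.
    by apply/funext => w; rewrite big_ord0.
  split; first exact: vecLp0.
  rewrite big_ord0 pairingE; under eq_Rintegral do rewrite dotv0l.
  by rewrite Rintegral_cstT.
have [Ws Es] := IH (\row_i a ord0 (lift ord0 i)) (fun i => x (lift ord0 i)) (fun i => Wx _).
have sE : (fun w => \sum_i a ord0 i *: x i w) = fun w => a ord0 ord0 *: x ord0 w +
    \sum_i (\row_i a ord0 (lift ord0 i)) ord0 i *: x (lift ord0 i) w.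
  apply/funext => w; rewrite big_ord_recl; congr (_ + _).
  by apply: eq_bigr => i _; rewrite mxE.
have W0 : W (fun w => a ord0 ord0 *: x ord0 w) by exact: (vecLpZ p1).
rewrite sE; split; first exact: (vecLpD p1).
rewrite (pairingDl p1 pq W0 Ws Lz) (pairingZl p1 pq)// Es big_ord_recl; congr (_ + _).
by apply: eq_bigr => i _; rewrite mxE.
Qed.

Lemma coord_norm_le k (x : 'rV[R]_k) i : `|x ord0 i| <= `|x|.
Proof.
rewrite [leRHS]/Num.norm/= mx_normrE.
exact: (le_bigmax_cond _ (fun j : 'I_1 * 'I_k => `|x j.1 j.2|) (isT : predT (ord0, i))).
Qed.

(* Hahn-Banach for the weak topology: a neighbourhood involves finitely many pairings only, so
   that separation in a finite-dimensional space suffices. *)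
Lemma weak_separation A zeta : A `<=` V -> A !=set0 ->
  (forall x y, A x -> A y -> A (x + y)) ->
  (forall (c : R) x, 0 <= c -> A x -> A (c *: x)) ->
  V zeta -> ~ weak_closure P p q A zeta ->
  exists xi, [/\ W xi, forall eta, A eta -> pairing P xi eta <= 0 & 0 < pairing P xi zeta].
Proof.
move=> AV A0 AD AZ Lz nz.
have [s [e e0 H]] : exists (s : seq (set_type W)), exists2 e : R, 0 < e &
    forall eta, A eta -> exists2 x, x \in s &
      e <= `|pairing P (val x) zeta - pairing P (val x) eta|.
  apply: contrapT => h; apply: nz; apply: weak_closure_intro => // s e e0.
  apply: contrapT => h2; apply: h; exists s, e => // eta Ae.
  apply: contrapT => h3; apply: h2; exists eta => // x xs.
  by rewrite ltNge; apply/negP => h4; apply: h3; exists x.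
pose k := size s.
pose x (i : 'I_k) := val (tnth (in_tuple s) i).
have Wx i : W (x i) by exact: set_mem (valP (tnth (in_tuple s) i)).
(* Phi records the finitely many pairings that keep A away from zeta, and separation takes place in
   its range. *)
pose Phi eta : 'rV[R]_k := \row_i pairing P (x i) eta.
pose F := closure [set Phi eta | eta in A].
have cF : closed F by exact: closed_closure.
have F0 : F !=set0 by have [a Aa] := A0; exists (Phi a); apply: subset_closure; exists a.
have PhiD a b : V a -> V b -> Phi (a + b) = Phi a + Phi b.
  by move=> La Lb; apply/rowP => i; rewrite !mxE (pairingDr p1 pq).
have PhiZ (c : R) a : V a -> Phi (c *: a) = c *: Phi a.
  by move=> La; apply/rowP => i; rewrite !mxE (pairingZr p1 pq).
have convF : @convex_set R 'rV[R]_k F.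
  apply/convex_setP => a b t /closureP ha /closureP hb /andP[t0 t1]; apply/closureP => eps eps0.
  have [_ [a' Aa' <-] aa'] := ha _ eps0; have [_ [b' Ab' <-] bb'] := hb _ eps0.
  have La' := AV _ Aa'; have Lb' := AV _ Ab'.
  exists (Phi (t *: a' + (1 - t) *: b')).
    by exists (t *: a' + (1 - t) *: b') => //; apply: AD; apply: AZ => //; rewrite subr_ge0.
  rewrite PhiD ?PhiZ//; [|exact: (vecLpZ q1)|exact: (vecLpZ q1)].
  rewrite (_ : _ - _ = t *: (a - Phi a') + (1 - t) *: (b - Phi b')); last first.
    by apply/rowP => i; rewrite !mxE; ring.
  apply: le_lt_trans (ler_normD _ _) _; rewrite !normrZ !ger0_norm ?subr_ge0//.
  have [t00|tn0] := eqVneq t 0; first by rewrite t00 mul0r add0r subr0 mul1r.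
  have h1 : t * `|a - Phi a'| < t * eps by rewrite ltr_pM2l// lt_neqAle eq_sym tn0.
  have h2 : (1 - t) * `|b - Phi b'| <= (1 - t) * eps by rewrite ler_wpM2l ?subr_ge0// ltW.
  lra.
have nF : ~ F (Phi zeta).
  move=> /closureP /(_ _ e0)[_ [eta Ae <-]]; have [y ys] := H _ Ae.
  rewrite leNgt => /negP + h; apply.
  have /tnthP[i yE] : y \in in_tuple s by [].
  have := le_lt_trans (coord_norm_le _ i) h.
  by rewrite !mxE /x -yE.
have [u [r [hF hz]]] := separation cF convF F0 nF.
pose xi w := \sum_i u ord0 i *: x i w.
have Lxi : W xi by exact: (pairing_sum u Wx Lz).1.
have E eta : V eta -> pairing P xi eta = dotv (Phi eta) u.
  by move=> Le; rewrite (pairing_sum u Wx Le).2 dotvC.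
have hA eta : A eta -> pairing P xi eta <= r.
  by move=> Ae; rewrite E; [apply: hF; apply: subset_closure; exists eta|exact: AV].
have r0 : 0 <= r.
  have [a Aa] := A0; have A0a := AZ 0 a (lexx _) Aa; have := hA _ A0a.
  by rewrite (E _ (AV _ A0a)) (PhiZ _ _ (AV _ Aa)) scale0r dotv0l.
exists xi; split => //; last by rewrite E//; exact: le_lt_trans hz.
(* A is a cone, so a positive pairing could be scaled up to r + 1, above the bound r. *)
move=> eta Ae; rewrite leNgt; apply/negP => h.
have c0 : 0 <= (r + 1) / pairing P xi eta by rewrite divr_ge0 ?addr_ge0// ltW.
have := hA _ (AZ _ _ c0 Ae); rewrite (pairingZr p1 pq _ Lxi (AV _ Ae)) divfK ?gt_eqF//.
lra.
Qed.

End WeakTopology.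

(** * Construction of the cones *)

Section Forward.
Context {R : realType} {disp : measure_display} {T : measurableType disp}.
Context (P : probability T R) {d : nat}.
Variables (p q : \bar R) (C : set 'rV[R]_d).
Variable E : (T -> set 'rV[R]_d) -> set 'rV[R]_d.
Hypotheses (p1 : (1 <= p)%E) (pq : (p^-1 + q^-1 = 1)%E).
Hypotheses (C_closed : closed C) (C_convex : @convex_set R 'rV[R]_d C).
Hypothesis C_cone : cone C.
Hypotheses (HE : sublinear_expectation P p C E) (EC : normalised C E).
Hypotheses (Emin : minimal P p C E) (Elsc : scalarly_lsc P p q C E).
Implicit Types (X Y : T -> set 'rV[R]_d) (xi eta zeta : T -> 'rV[R]_d) (F : set 'rV[R]_d).
Implicit Types (u v a : 'rV[R]_d).

Local Notation LC := (LpcoFC P p C).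
Local Notation G := (polar_cone C).
Local Notation W := (@vecLp R disp T P d p).
Local Notation V := (@vecLp R disp T P d q).
Let q1 : (1 <= q)%E := conjugate_ge1 p1 pq.

Definition point_support u xi := support_fun (E (addC C xi)) u.
Local Notation e := point_support.

Let LP xi : W xi -> LC (addC C xi).
Proof. exact: LpcoFC_point. Qed.

Let LCC : LC (fun=> C).
Proof. exact: LpcoFC_cone. Qed.

Let E0 X : LC X -> E X !=set0.
Proof. by move=> /(se_values HE)[]. Qed.

Let e_gtNy u xi : W xi -> (-oo < e u xi)%E.
Proof. by move=> Lx; apply: support_fun_gtNy; exact/E0/LP. Qed.

Let addC0 : addC C (fun=> 0 : 'rV[R]_d) = (fun=> C) :> (T -> _).
Proof.
apply/funext => w; rewrite /addC; apply/seteqP; split=> [_ [x Cx <-]|x Cx].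
  by rewrite add0r.
by exists x; rewrite ?add0r.
Qed.

Let e_zero u : G u -> e u (fun=> 0) = 0%E.
Proof. by move=> Gu; rewrite /e addC0 EC support_cone. Qed.

Let e_cone u xi : G u -> selLp P p (fun=> C) xi -> (e u xi <= 0)%E.
Proof.
move=> Gu [Lx xC]; rewrite -(support_cone C_cone Gu) -[X in (_ <= support_fun X _)%E]EC.
apply: support_funS; apply: (se_monotone HE) => //; first exact: LP.
by apply: filterS xC => w Cx _ [y Cy <-]; exact: coneD.
Qed.

Let e_translate u xi a : W xi -> e u (fun w => xi w + a) = (e u xi + (dotv a u)%:E)%E.
Proof.
move=> Lx; rewrite /e -support_translate -(se_translation HE); last exact: LP.
congr (support_fun (E _) u); apply/funext => w; rewrite /addC.
apply/seteqP; split=> [_ [x Cx <-]|_ [_ [x Cx <-] <-]].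
  by exists (xi w + x); [exists x|rewrite addrAC].
by exists x => //; rewrite addrAC.
Qed.

(** Normalisation settles 0 through E(C) = C, and translation settles every other constant. *)
Let e_cst u a : G u -> e u (fun=> a) = (dotv a u)%:E.
Proof.
move=> Gu; rewrite (_ : (fun=> a) = fun _ : T => (fun=> 0 : 'rV[R]_d) tt + a).
  rewrite (@e_translate u (fun=> 0)); last exact: vecLp0.
  by rewrite e_zero// add0e.
by apply/funext => w; rewrite add0r.
Qed.

Let e_add u xi eta : W xi -> W eta -> (e u (fun w => xi w + eta w)%R <= e u xi + e u eta)%E.
Proof.
move=> Lx Le; rewrite /e -support_closed_sum; [|exact/E0/LP|exact/E0/LP].
apply: support_funS; apply: subset_trans (se_subadditive HE (LP Lx) (LP Le)).
apply: (se_monotone HE).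
- by apply: LP; exact: vecLpD.
- by apply: LpcoFC_sum => //; exact: LP.
- apply: aeW => w _ [x Cx <-]; apply: subset_closure.
  exists (xi w + x); first by exists x.
  by exists (eta w); [exists 0; [exact: cone0|rewrite addr0]|rewrite addrAC].
Qed.

Let e_scale u (c : R) xi : 0 < c -> W xi -> (e u (fun w => c *: xi w)%R = c%:E * e u xi)%E.
Proof.
move=> c0 Lx; rewrite /e -support_scale// -(se_homogeneous HE (LP Lx) c0).
congr (support_fun (E _) u); apply/funext => w; rewrite /addC.
apply/seteqP; split=> [_ [x Cx <-]|_ [_ [x Cx <-] <-]].
  exists (xi w + c^-1 *: x); first by exists (c^-1 *: x) => //; apply: coneZ => //; rewrite invr_ge0 ltW.
  by rewrite scalerDr scalerA mulfV ?gt_eqF// scale1r.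
by exists (c *: x); [apply: coneZ => //; exact: ltW|rewrite scalerDr].
Qed.

(** For zeta with values in G the expected support function of xi + C is the pairing of xi with
    zeta, so weak convergence of points is scalar convergence of the sets. *)
Let e_lsc u (xi_ : nat -> T -> 'rV[R]_d) xi : (forall n, W (xi_ n)) -> W xi ->
  weak_cvg P (q:=q) xi_ xi -> (e u xi <= limn_einf (fun n => e u (xi_ n)))%E.
Proof.
move=> Ln Lx cv; apply: (Elsc (X_ := fun n => addC C (xi_ n))) => //.
- by move=> n; exact: LP.
- exact: LP.
- move=> zeta zG; have [Lz _] := zG.
  rewrite (expect_support_point p1 pq C_closed C_convex C_cone Lz zG Lx).
  under eq_fun do rewrite (expect_support_point p1 pq C_closed C_convex C_cone Lz zG (Ln _)).
  by apply/cvg_EFin; [exact: nearW|exact: cv].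
Qed.

(** The shift moves eta0 to the origin: separating this set from 0 keeps e above s in a
    neighbourhood of eta0. *)
Let sublevel u eta0 (s : R) : set (T -> 'rV[R]_d) :=
  [set eta | W eta /\ (e u (fun w => eta w + eta0 w)%R <= s%:E)%E].

Let sublevelW u eta0 s : sublevel u eta0 s `<=` W.
Proof. by move=> eta []. Qed.

Let midconvex_sublevel u eta0 s : W eta0 -> midconvex (sublevel u eta0 s).
Proof.
move=> La xi eta [Lx ex] [Le ee]; split.
  by apply: vecLpZ => //; exact: vecLpD.
have Lxa := vecLpD p1 Lx La; have Lea := vecLpD p1 Le La.
rewrite (_ : (fun w => _) = fun w => 2^-1 *: ((xi w + eta0 w) + (eta w + eta0 w))); last first.
  by apply/funext => w; apply/rowP => i; rewrite !mxE; field.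
rewrite e_scale//; last exact: vecLpD.
rewrite -lee_pdivlMl//; apply: le_trans (e_add _ Lxa Lea) _.
rewrite -EFinM (_ : _ * s = s + s); last by field.
by rewrite EFinD leeD.
Qed.

Let closed_sublevel u eta0 s : W eta0 -> weak_seq_closed P (p:=p) (q:=q) (sublevel u eta0 s).
Proof.
move=> La eta_ eta h Le cv; split => //.
apply: (@le_trans _ _ (limn_einf (fun n => e u (fun w => eta_ n w + eta0 w)%R))).
  apply: e_lsc.
  - by move=> n; apply: vecLpD => //; have [] := h n.
  - exact: vecLpD.
  - move=> zeta Lz; rewrite (pairingDl p1 pq Le La Lz).
    under eq_fun => n do rewrite (pairingDl p1 pq (h n).1 La Lz).
    by apply: cvgD; [exact: cv|exact: cvg_cst].
rewrite -[leRHS](limn_einf_cst s%:E); apply: le_limn_einf => n; exact: (h n).2.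
Qed.

(** The subdifferential of e at 0. *)
Let dominated u zeta := V zeta /\ forall xi, W xi -> ((pairing P xi zeta)%:E <= e u xi)%E.

(* Fenchel-Moreau: e is bounded below near 0 and near xi because 0 does not belong to the sets
   [sublevel u 0 (-1)] and [sublevel u xi r]. *)
Let biconjugate u xi (r : R) : G u -> W xi -> (r%:E < e u xi)%E ->
  exists2 zeta, dominated u zeta & r <= pairing P xi zeta.
Proof.
move=> Gu Lx rx; have L0 := vecLp0 P p1 (d := d).
have [|N1 [d1 d10 [P1 H1]]] := separating_seminorm p1 pq (@sublevelW u _ (-1))
    (@midconvex_sublevel u _ (-1) L0) (@closed_sublevel u _ (-1) L0).
  move=> [_]; under eq_fun do rewrite addr0.
  by rewrite e_zero// lee_fin; lra.
have [|N2 [d2 d20 [P2 H2]]] := separating_seminorm p1 pq (@sublevelW u _ r)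
    (@midconvex_sublevel u _ r Lx) (@closed_sublevel u _ r Lx).
  move=> [_]; under eq_fun do rewrite add0r.
  by rewrite leNgt rx.
(* A ball of this radius for N1 + N2 lies in both of the balls found, so one seminorm serves near 0
   and near xi. *)
have delta0 : 0 < Num.min d1 d2 by rewrite lt_min d10.
have eD xi1 eta1 (L1 : W xi1) (L2 : W eta1) := e_add u L1 L2.
have eZ (c : R) xi1 (c0 : 0 < c) (L1 : W xi1) := e_scale u c0 L1.
have e0 : (e u (fun=> 0%R) <= 0)%E by rewrite e_zero.
have [||zeta [Lz dz rz]] := fenchel_moreau (r := r) p1 pq eD eZ e0 (cs_plus P1 P2) delta0 Lx.
- move=> eta Le; rewrite le_min => /andP[h _]; rewrite leNgt; apply/negP => he.
  have : d1 < N1 eta.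
    by apply: H1; split => //; under eq_fun do rewrite addr0; exact: ltW.
  have := cs_ge0 p1 P2 Le; lra.
- move=> eta Le; rewrite le_min => /andP[_ h]; rewrite leNgt; apply/negP => he.
  have Ld := vecLpB p1 Le Lx.
  have : d2 < N2 (fun w => eta w - xi w).
    by apply: H2; split => //; under eq_fun do rewrite subrK; exact: ltW.
  have := cs_ge0 p1 P1 Ld; lra.
by exists zeta.
Qed.

Definition acceptance_polar u : set (T -> 'rV[R]_d) :=
  polarLp P (q:=q) [set xi | W xi /\ (point_support u xi <= 0)%E].
Local Notation Z := acceptance_polar.

Let accW u : [set xi | W xi /\ (e u xi <= 0)%E] `<=` W.
Proof. by move=> xi []. Qed.

Let dominated_polar u zeta : dominated u zeta -> Z u zeta.
Proof.
move=> [Lz dz]; split => // xi [Lx ex].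
by rewrite -lee_fin; apply: le_trans (dz _ Lx) ex.
Qed.

(** On constants both sides of the domination are linear in a, and an inequality between linear
    functionals is an equality; a = m - u shows it. *)
Let dominated_expect u zeta : G u -> dominated u zeta -> expect_vec P zeta = u.
Proof.
move=> Gu [Lz dz]; set m := expect_vec P zeta.
have H a : dotv a m <= dotv a u.
  rewrite -(pairing_cst p1 pq)// -lee_fin -e_cst//; apply: dz; exact: vecLp_cst.
apply/eqP; rewrite -subr_eq0 -dotv_eq0 eq_le dotv_ge0 andbT dotvBr subr_le0; exact: H.
Qed.

(** The bipolar statement for the acceptance set: were e u xi positive, [biconjugate] would supply
    an element of its polar pairing positively with xi. *)
Let polar_acceptance u xi : G u -> W xi -> (forall zeta, Z u zeta -> pairing P xi zeta <= 0) ->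
  (e u xi <= 0)%E.
Proof.
move=> Gu Lx H; rewrite leNgt; apply/negP => e_pos.
have [r r0 re] : exists2 r : R, 0 < r & (r%:E < e u xi)%E.
  case: (e u xi) e_pos => [t| |]//=; last by exists 1; rewrite ?ltry.
  by rewrite lte_fin => t0; exists (t / 2); rewrite ?lte_fin; lra.
have [zeta dz rz] := biconjugate Gu Lx re.
by have := H _ (dominated_polar dz); lra.
Qed.

(** A Farkas argument on constants: the mean m is nonpositive on the half-space where u is, so it is
    a nonnegative multiple of u. *)
Let acceptance_expect u zeta : G u -> Z u zeta -> exists2 t : R, 0 <= t & expect_vec P zeta = t *: u.
Proof.
move=> Gu [Lz hz]; set m := expect_vec P zeta.
have H a : dotv a u <= 0 -> dotv a m <= 0.
  move=> au; rewrite -(pairing_cst p1 pq)//; apply: hz; split; first exact: vecLp_cst.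
  by rewrite e_cst.
have [u0|u0] := eqVneq u 0.
  exists 0 => //; rewrite scale0r; apply/eqP; rewrite -dotv_eq0 eq_le dotv_ge0 andbT.
  by apply: H; rewrite u0 dotv0r.
have uu : 0 < dotv u u by rewrite dotv_gt0.
(* The projection coefficient of m on u: a = -u gives its sign, and a = m - t u, which is orthogonal
   to u, gives m = t u. *)
pose t := dotv m u / dotv u u.
have tu : dotv (m - t *: u) u = 0 by rewrite dotvBl dotvZl divfK ?gt_eqF// subrr.
exists t.
  rewrite divr_ge0 ?(ltW uu)//.
  have := H (- u); rewrite !dotvNl oppr_le0 (dotvC u m) oppr_le0; apply; exact: ltW.
apply/eqP; rewrite -subr_eq0 -dotv_eq0 eq_le dotv_ge0 andbT dotvBr dotvZr tu mulr0 subr0.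
by apply: H; rewrite tu.
Qed.

(** Shift xi by a constant so that it becomes acceptable with equality. For u = 0 no constant shifts
    e, but there e vanishes identically. *)
Let polar_dominated u zeta : G u -> Z u zeta -> expect_vec P zeta = u -> dominated u zeta.
Proof.
move=> Gu [Lz hz] Eu; split => // xi Lx.
case E1 : (e u xi) (e_gtNy u Lx) => [r| |]// _; last by rewrite leey.
have [u0|u0] := eqVneq u 0.
  rewrite lee_fin; have -> : r = 0.
    apply: EFin_inj; rewrite -E1 u0; apply: support_fun0; exact/E0/LP.
  by apply: hz; split => //; rewrite u0 /e support_fun0//; exact/E0/LP.
have uu : dotv u u != 0 by rewrite dotv_eq0.
pose a := (- r / dotv u u) *: u.
have au : dotv a u = - r by rewrite dotvZl divfK.
have La : W (fun=> a) by exact: vecLp_cst.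
have : pairing P (fun w => xi w + a) zeta <= 0.
  apply: hz; split; first exact: (vecLpD p1 Lx La).
  by rewrite e_translate// E1 au -EFinD subrr.
rewrite (pairingDl p1 pq Lx La Lz) (pairing_cst p1 pq)// Eu au lee_fin; lra.
Qed.

Let e_scaler (c : R) u xi : 0 < c -> e (c *: u) xi = (c%:E * e u xi)%E.
Proof. by move=> c0; exact: support_scaler. Qed.

(** Since X w contains 0, the support function is nonnegative, while its integral, a supremum over
    selections, is at most 0. With X = C this puts zeta in G almost surely; with X the whole space
    it makes zeta vanish. *)
Let support_le0 X zeta : LC X -> V zeta -> (forall w, X w 0) ->
  (forall xi, selLp P p X xi -> pairing P xi zeta <= 0) ->
  {ae P, forall w, (support_fun (X w) (zeta w) <= 0)%E}.
Proof.
move=> LX Lz X0 H.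
have h0 w : (0 <= support_fun (X w) (zeta w))%E.
  by have := support_fun_ge (zeta w) (X0 w); rewrite dotv0l.
have mh : measurable_fun setT (fun w => support_fun (X w) (zeta w)).
  by apply: measurable_support; [exact: LpcoFC_effros LX|exact: vecLp_mvec Lz].
have : (expect_support P X zeta <= 0)%E.
  rewrite (expect_support_sup p1 pq LX Lz); apply: ge_ereal_sup => _ [xi sx <-].
  by rewrite lee_fin; exact: H.
rewrite /expect_support => I0.
have /(ae_eq_integral_abs _ measurableT mh) : (\int[P]_w `|support_fun (X w) (zeta w)| = 0)%E.
  under eq_integral do rewrite gee0_abs//.
  by apply/eqP; rewrite eq_le I0/=; apply: integral_ge0.
by apply: filterS => w /(_ I) ->.
Qed.

Lemma acceptance_cone_family : cone_family P p q C Z.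
Proof.
split.
- move=> u Gu zeta [Lz hz]; split => //.
  apply: (support_le0 LCC Lz) => [w|xi sx]; first exact: cone0.
  by apply: hz; split; [case: sx|exact: e_cone].
- by move=> u Gu; apply: (polarLp_convex p1 pq); exact: accW.
- by move=> u Gu; apply: polarLp_closed; exact: accW.
- by move=> u Gu; apply: (polarLp_cone p1 pq); exact: accW.
- move=> u Gu u0; apply/seteqP; split=> [_ [zeta Zz <-]|_ [t t0 <-]].
    by have [t t0 ->] := acceptance_expect Gu Zz; exists t.
  (* Only the existence of a dominated functional matters here, so any bound below e u 0 = 0 would
     do in place of -1. *)
  have [zeta dz _] : exists2 zeta, dominated u zeta & -1 <= pairing P (fun=> 0) zeta.
    by apply: biconjugate => //; [exact: vecLp0|rewrite e_zero// lte_fin; lra].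
  exists (fun w => t *: zeta w).
    have [_ cZ] := polarLp_cone p1 pq (accW (u := u)).
    by apply: cZ => //; exact: dominated_polar.
  by rewrite (expect_vecZ p1 pq t dz.1) (dominated_expect Gu dz).
- move=> u c Gu c0; rewrite /Z; congr (polarLp P (q:=q) _); apply/seteqP; split=> xi [Lx ex]; split => //.
    by move: ex; rewrite e_scaler// pmule_rle0.
  by rewrite e_scaler// pmule_rle0.
- have e0 xi : W xi -> e 0 xi = 0%E by move=> Lx; apply: support_fun0; exact/E0/LP.
  apply/seteqP; split=> zeta.
    move=> [Lz hz]; split => //.
    have cT : coFC C setT.
      by apply/(coFCP C_cone); split => //; split; [exact: closedT|apply/convex_setP].
    have LT : LC (fun=> setT) by apply: LpcoFC_cst => //; exists 0.
    have H : forall xi, selLp P p (fun=> setT) xi -> pairing P xi zeta <= 0.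
      by move=> xi [Lx _]; apply: hz; split; rewrite ?e0.
    (* The support function of the whole space at zeta w is tested at the point zeta w itself. *)
    have := support_le0 LT Lz (fun=> I) H; apply: filterS => w /support_fun_leP /(_ (zeta w) I).
    by rewrite lee_fin => h; apply/eqP; rewrite -dotv_eq0 eq_le h dotv_ge0.
  move=> [Lz z0]; split => // xi [Lx _].
  rewrite (_ : pairing P xi zeta = 0)//.
  have mx := vecLp_mvec Lx; have mz := vecLp_mvec Lz.
  have xx : {ae P, forall w, xi w = xi w} by exact: aeW.
  rewrite (pairing_ae mx mx mz (mvec_cst 0) xx z0) pairingE.
  by under eq_Rintegral do rewrite dotv0r; rewrite Rintegral_cstT.
- move=> u v Gu Gv zeta [Lz hz]; apply: contrapT => nz.
  have Z0 w : Z w (fun=> 0).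
    have [[z Zz] cZ] := polarLp_cone p1 pq (accW (u := w)).
    rewrite (_ : (fun=> 0) = 0 *: z); first exact: cZ.
    by apply/funext => t; rewrite /= scale0r.
  set A := [set zeta1 + zeta2 | zeta1 in Z u & zeta2 in Z v] in nz.
  have AV : A `<=` V by move=> _ [a [La _] [b [Lb _] <-]]; exact: (vecLpD q1).
  have A0 : A !=set0.
    by exists ((fun=> 0) + (fun=> 0)); exists (fun=> 0) => //; exists (fun=> 0).
  have AD x y : A x -> A y -> A (x + y).
    move=> [a Za [b Zb <-]] [a' Za' [b' Zb' <-]].
    exists (a + a'); first exact: (polarLp_add p1 pq (@accW u) Za Za').
    exists (b + b'); first exact: (polarLp_add p1 pq (@accW v) Zb Zb').
    by rewrite addrACA.
  have AZ (c : R) x : 0 <= c -> A x -> A (c *: x).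
    move=> c0 [a Za [b Zb <-]].
    exists (c *: a); first exact: (polarLp_cone p1 pq (@accW u)).2.
    exists (c *: b); first exact: (polarLp_cone p1 pq (@accW v)).2.
    by rewrite scalerDr.
  (* The separating xi is nonpositive on Z u and on Z v, as both contain 0; so it is acceptable for
     u and for v, hence for u + v, against its positive pairing with zeta. *)
  have [xi [Lx hA hz0]] := weak_separation p1 pq AV A0 AD AZ Lz nz.
  have eu : (e u xi <= 0)%E.
    apply: polar_acceptance => // a Za; apply: hA; exists a => //; exists (fun=> 0) => //.
    by apply/funext => w; rewrite /= addr0.
  have ev : (e v xi <= 0)%E.
    apply: polar_acceptance => // b Zb; apply: hA; exists (fun=> 0) => //; exists b => //.
    by apply/funext => w; rewrite /= add0r.
  have : pairing P xi zeta <= 0.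
    apply: hz; split => //; rewrite -(adde0 0%E).
    by apply: le_trans (support_subadd _ _ (E0 (LP Lx))) _; exact: leeD.
  by rewrite leNgt hz0.
Qed.

Lemma acceptance_dual_representation : dual_representation P p C E Z.
Proof.
move=> X LX; split=> u Gu.
  have [a Ca au] : exists2 a, C a & 0 < dotv a u.
    apply: contrapT => h; apply: Gu; apply/polar_coneP => a Ca.
    by rewrite leNgt; apply/negP => au; apply: h; exists a.
  (* X + a is contained in X for a in C, so the support function at u does not drop when dotv a u >
     0 is added to it; as it exceeds -oo, it must be +oo. *)
  have : (support_fun (E X) u + (dotv a u)%:E <= support_fun (E X) u)%E.
    rewrite -support_translate -(se_translation HE)//; apply: support_funS.
    apply: (se_monotone HE) => //.
      by apply: (@LpcoFC_translate _ _ _ P _ p C p1 C_cone X (fun=> a)) => //; exact: vecLp_cst.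
    apply: aeW => w _ [x Xx <-]; have /(coFCP C_cone)[_] := LpcoFC_coFC w LX; exact.
  have := support_fun_gtNy u (E0 LX); case: (support_fun (E X) u) => [r| |]// _.
  by rewrite -EFinD lee_fin gerDl leNgt au.
rewrite (Emin LX) support_hull; apply/eqP; rewrite eq_le; apply/andP; split; last first.
  apply: ge_ereal_sup => _ [zeta [Zz Ez] <-].
  have dz := polar_dominated Gu Zz Ez.
  rewrite (expect_support_sup p1 pq LX Zz.1); apply: ge_ereal_sup => _ [xi sx <-].
  apply: le_trans (dz.2 _ sx.1) _; apply: support_funS => x Ex.
  by exists xi.
apply/support_fun_leP => x [xi sx Ex].
apply: le_trans (support_fun_ge u Ex) _; rewrite leNgt; apply/negP => h.
set s := ereal_sup _ in h.
have sge zeta : dominated u zeta -> ((pairing P xi zeta)%:E <= s)%E.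
  move=> dz; apply: (@le_trans _ _ (expect_support P X zeta)).
    exact: (expect_support_ge p1 pq dz.1 LX sx).
  apply: ereal_sup_ubound; exists zeta => //; split; first exact: dominated_polar.
  exact: dominated_expect.
(* A level strictly between s and e u xi. The functional z dominated by e is there to exclude s =
   -oo. *)
have [r sr re] : exists2 r : R, (s < r%:E)%E & (r%:E < e u xi)%E.
  have [z dz _] : exists2 zeta, dominated u zeta & -1 <= pairing P (fun=> 0) zeta.
    by apply: biconjugate => //; [exact: vecLp0|rewrite e_zero// lte_fin; lra].
  move: (sge _ dz) h => {sge}; case: s => [s| |]//= _; last by rewrite ltNge leey.
  rewrite -/(e u xi); case: (e u xi) => [t| |]//.
    by rewrite lte_fin => st; exists ((s + t) / 2); rewrite lte_fin; lra.
  by move=> _; exists (s + 1); rewrite ?ltry// lte_fin; lra.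
have [zeta dz rz] := biconjugate Gu sx.1 re.
have := le_lt_trans (sge _ dz) sr; rewrite lte_fin; lra.
Qed.

End Forward.

Theorem theorem5p2 (R : realType) (disp : measure_display)
    (T : measurableType disp) (P : probability T R) (d : nat) (p q : \bar R)
    (C : set 'rV[R]_d) (E : (T -> set 'rV[R]_d) -> set 'rV[R]_d) :
  (1 <= d)%N -> (1 <= p)%E -> (p^-1 + q^-1 = 1)%E ->
  closed C -> @convex_set R 'rV[R]_d C -> cone C -> C <> setT ->
  (forall X, LpcoFC P p C X -> coF (E X)) ->
  [/\ sublinear_expectation P p C E, normalised C E, minimal P p C E
    & scalarly_lsc P p q C E]
  <->
  exists Z : 'rV[R]_d -> set (T -> 'rV[R]_d),
    cone_family P p q C Z /\ dual_representation P p C E Z.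
Proof.
move=> _ p1 pq cC convC coneC _ coE; split=> [[HE EC Emin Elsc]|[Z [HZ dual]]].
  exists (acceptance_polar P p q C E); split.
    exact: acceptance_cone_family.
  exact: acceptance_dual_representation.
exact: dual_representation_sufficient HZ dual.
Qed.
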